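(* Let $K$ be a number field and let $L\subseteq\overline{\mathbb{Q}}$ be an algebraic field extension of $K$ of infinite degree. For a number field $M$ with $K\subseteq M$ define $$\gamma(M/K)=\sup_{F}\left(N_{F/\mathbb{Q}}(D_{MF/F})\right)^{\frac{1}{[MF:\mathbb{Q}][MF:F]}},$$ where the supremum runs over all number fields $F\subseteq\overline{\mathbb{Q}}$ containing $K$, and $MF$ denotes the compositum of $M$ and $F$. Suppose that $$\liminf_{K\subseteq M\subseteq L}\gamma(M/K)=\infty,$$ where $M$ runs over all number fields with $K\subseteq M\subseteq L$; that is, for every real $X$ there are only finitely many number fields $M$ with $K\subseteq M\subseteq L$ and $\gamma(M/K)\le X$. Then $L$ has the Northcott property: for every $X\geq 1$ the set $\{\alpha\in L : H(\alpha)\le X\}$ is finite.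
   Context: All algebraic extensions of $\mathbb{Q}$ are regarded as subfields of a fixed algebraic closure $\overline{\mathbb{Q}}$. For a finite extension of number fields $E/F$, $D_{E/F}$ denotes the relative discriminant ideal of $E/F$ (an ideal of the ring of integers $\mathcal{O}_F$), and for a nonzero ideal $\mathfrak{A}$ of $\mathcal{O}_F$, $N_{F/\mathbb{Q}}(\mathfrak{A})$ denotes the positive rational integer generating the norm ideal (equivalently, the absolute norm $|\mathcal{O}_F/\mathfrak{A}|$). For $\alpha\in\overline{\mathbb{Q}}$, $H(\alpha)$ is the absolute multiplicative Weil height of $(1:\alpha)\in\mathbb{P}^1(\overline{\mathbb{Q}})$: for any number field $E$ containing $\alpha$, $H(\alpha)=\prod_{v\in M_E}\max\{1,|\alpha|_v\}^{d_v/[E:\mathbb{Q}]}$, where $M_E$ is the set of places of $E$, $|\cdot|_v$ is normalized to extend the usual archimedean or $p$-adic absolute value on $\mathbb{Q}$, and $d_v=[E_v:\mathbb{Q}_v]$ is the local degree. *)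

(* Defs.v *)
From HB Require Import structures.
From mathcomp Require Import all_boot all_order all_algebra all_field finmap.
From mathcomp Require Import all_classical all_reals all_analysis.
Set Implicit Arguments.
Unset Strict Implicit.
Unset Printing Implicit Defensive.
Import Order.TTheory GRing.Theory Num.Theory.
Import numFieldNormedType.Exports.
Local Open Scope classical_set_scope.
Local Open Scope ring_scope.

(* The fixed algebraic closure of the rationals is [algC]; its subfields are
   represented by their carriers, of type [set algC]. *)

Definition subfield (E : set algC) : Prop :=
  divring_closed (fun x : algC => x \in E).

Definition QQ : set algC := [set` Crat].

Definition field_basis (F E : set algC) (n : nat) (b : 'rV[algC]_n) : Prop :=
  (forall i, E (b 0 i)) /\
  (forall x, E x -> exists! c : 'rV[algC]_n,
      (forall i, F (c 0 i)) /\ x = \sum_i c 0 i * b 0 i).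

Definition finite_extension (F E : set algC) : Prop :=
  F `<=` E /\ exists (n : nat) (b : 'rV[algC]_n), field_basis F E b.

(* [E : F], with junk value 0 when E is not of finite degree over F *)
Definition ext_degree (F E : set algC) : nat :=
  xget 0%N [set n | exists b : 'rV[algC]_n, field_basis F E b].

Definition number_field (E : set algC) : Prop :=
  subfield E /\ finite_extension QQ E.

Definition compositum (M F : set algC) : set algC :=
  smallest subfield (M `|` F).

Definition adjoin_rat (a : algC) : set algC := smallest subfield [set a].

Definition ring_of_integers (E : set algC) : set algC := E `&` [set` Aint].

(* The trace of the F-linear endomorphism y |-> x * y of E; the matrix A
   represents it in the F-basis b, and the trace does not depend on b. *)
Definition ext_trace (F E : set algC) (x : algC) : algC :=
  xget 0 [set t | exists (n : nat) (b : 'rV[algC]_n) (A : 'M[algC]_n),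
    [/\ field_basis F E b,
        forall i j, F (A i j),
        forall i, x * b 0 i = \sum_j A i j * b 0 j &
        t = \tr A]].

Definition basis_disc (F E : set algC) (n : nat) (b : 'rV[algC]_n) : algC :=
  \det (\matrix_(i < n, j < n) ext_trace F E (b 0 i * b 0 j)).

Definition ideal_in (O I : set algC) : Prop :=
  [/\ I `<=` O, I 0, forall x y, I x -> I y -> I (x + y) &
      forall a x, O a -> I x -> I (a * x)].

(* D_{E/F}: the ideal of O_F generated by the discriminants of all the
   F-bases of E that consist of elements of O_E. *)
Definition rel_disc (F E : set algC) : set algC :=
  smallest (ideal_in (ring_of_integers F))
    [set d | exists (n : nat) (b : 'rV[algC]_n),
      [/\ field_basis F E b, forall i, ring_of_integers E (b 0 i) &
          d = basis_disc F E b]].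

(* The absolute norm |O_F / I|: the quotient is the set of the cosets of I.
   [fset_set] is empty on infinite sets, which arise only for I = 0. *)
Definition ideal_norm (F I : set algC) : nat :=
  #|` fset_set [set [set (x + a)%R | a in I] | x in ring_of_integers F]|%N.

Definition gamma (R : realType) (K M : set algC) : \bar R :=
  ereal_sup
    [set (((ideal_norm F (rel_disc F (compositum M F)))%:R : R) `^
          (ext_degree QQ (compositum M F) *
           ext_degree F (compositum M F))%:R^-1)%:E
    | F in [set F | number_field F /\ K `<=` F]].

Definition padic_abs (R : realType) (p : nat) (q : rat) : R :=
  if q == 0 then 0
  else p%:R ^+ logn p `|denq q|%N / p%:R ^+ logn p `|numq q|%N.

(* A place of E is identified with the unique absolute value in its class that
   extends the usual archimedean absolute value or a p-adic one. An absolute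
   value on E is a function on [algC] with value 0 outside E, so that distinct
   functions satisfying [place E] are distinct places. *)
Definition place (R : realType) (E : set algC) (v : algC -> R) : Prop :=
  [/\ (forall x, E x -> 0 <= v x) /\ (forall x, E x -> (v x = 0 <-> x = 0)),
      forall x y, E x -> E y -> v (x * y) = v x * v y,
      forall x y, E x -> E y -> v (x + y) <= v x + v y,
      (forall q : rat, v (ratr q) = `|ratr q|) \/
      (exists2 p : nat, prime p &
         forall q : rat, v (ratr q) = padic_abs R p q) &
      forall x, ~ E x -> v x = 0].

(* The completion of (E, v) consists of the v-Cauchy sequences in E modulo the
   v-null sequences; for a subfield F of E, the completion of F for the
   restriction of v is represented by the v-Cauchy sequences in F. *)
Definition cauchy_in (R : realType) (E : set algC) (v : algC -> R)
    (u : nat -> algC) : Prop :=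
  (forall k, E (u k)) /\
  (forall e : R, 0 < e -> \forall k & l \near \oo, v (u k - u l) < e).

Definition null_seq (R : realType) (v : algC -> R) (u : nat -> algC) : Prop :=
  v (u k) @[k --> \oo] --> (0 : R).

(* (the classes of) x_1, ..., x_n form a basis of E_v over Q_v *)
Definition local_basis (R : realType) (E : set algC) (v : algC -> R) (n : nat)
    (x : 'I_n -> nat -> algC) : Prop :=
  [/\ forall i, cauchy_in E v (x i),
      forall y, cauchy_in E v y ->
        exists2 c : 'I_n -> nat -> algC, forall i, cauchy_in QQ v (c i) &
          null_seq v (fun k => y k - \sum_i c i k * x i k) &
      forall c : 'I_n -> nat -> algC, (forall i, cauchy_in QQ v (c i)) ->
        null_seq v (fun k => \sum_i c i k * x i k) ->
        forall i, null_seq v (c i)].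

(* d_v = [E_v : Q_v] *)
Definition local_degree (R : realType) (E : set algC) (v : algC -> R) : nat :=
  xget 0%N [set n | exists x : 'I_n -> nat -> algC, local_basis E v x].

(* All but finitely many factors are equal to 1. *)
Definition height_over (R : realType) (E : set algC) (a : algC) : R :=
  \big[*%R/1]_(v \in [set v : algC -> R | place E v])
    Num.max 1 (v a) `^ ((local_degree E v)%:R / (ext_degree QQ E)%:R).

(* [height_over R E a] is the same for all number fields E containing a;
   E = Q(a) is the smallest of them. *)
Definition weil_height (R : realType) (a : algC) : R :=
  height_over R (adjoin_rat a) a.

Definition northcott (R : realType) (L : set algC) : Prop :=
  forall X : R, 1 <= X -> finite_set [set a | L a /\ weil_height R a <= X].

(* Main.v *)
(** Let [H = H(a)], let [g] be the primitive integral minimal polynomial of [a] and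
    [M(g)] its Mahler measure. For every number field [F] containing [K], put
    [m = [F : Q]] and [d = [F(a) : F]]. A uniform form of Silverman's inequality,
      [N(D_{F(a)/F}) <= (4 H^2)^(m d^2)],
    gives [gamma(K(a)/K) <= 4 H^2]. So the elements of [L] of bounded height generate
    only finitely many fields over [K], and each of these fields has the Northcott
    property.

    Discriminant. Let [f] be the minimal polynomial of [a] over [F] and [psi = g / f].
    By Dedekind's Prague theorem, [u f] is integral for every coefficient [u] of [psi];
    hence [1, u_1 w_1, ..., u_(d-1) w_(d-1)], where the [w_j] are the coefficients of
    [f / (x - a)], is an integral basis of [F(a)/F], of discriminant
    [disc(f) prod_j u_j^2]. It follows that [D] contains all the coefficients of
    [phi = disc(f) psi^(2(d-1))]. Multiplication by [phi] on [O_F[x]] then factors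
    through a [Z]-basis of [D], so [|O_F/D|] divides the content of the norm of [phi],
    which is [N(disc f)] times a power of the leading coefficient of [g]; no unique
    factorization of ideals is needed.

    Height. [M(g) <= H^(deg a)]: extend each absolute value of [Q] to an absolute value
    [w] of the algebraic closure. The place [v] of [Q(a)] is induced by at most [d_v]
    of the embeddings [nu] through [w o nu = v], so the product of the factors of [H]
    above [w] is at least the product of [max(1, w(a_i))] over the conjugates of [a],
    which for [p]-adic [w] is at least the [p]-part of the leading coefficient of [g]
    by Gauss's lemma. *)

Require Import Defs.
From HB Require Import structures.
From mathcomp Require Import all_boot all_order all_algebra all_field finmap perm.
From mathcomp Require Import all_classical all_reals all_analysis.
From mathcomp Require Import zify ring lra.
Set Implicit Arguments.
Unset Strict Implicit.
Unset Printing Implicit Defensive.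
Import Order.TTheory GRing.Theory Num.Theory.
Import numFieldNormedType.Exports.
Local Open Scope classical_set_scope.
Local Open Scope ring_scope.

(** The exponent in [gamma] is the reciprocal of [m d * d], so a bound on the norm of the
    discriminant yields a constant independent of [F] exactly when it is exponential in [m d^2].
    This leaves room for crude estimates: the [d!] of the Leibniz formula is absorbed into
    [2^(d^2)], which is where the 4 comes from. Heights are defined by places and local degrees,
    Mahler measures by roots in [algC]. Absolute values on the whole of [algC] with values in [R]
    link the two. Only lower bounds of [H] enter, so it is enough that [d_v] is at least the number
    of embeddings inducing [v]. One obstacle is the product over all places: on an infinite support
    it has the default value 1. Hence even a lower bound of [H(a)] depends on there being finitely
    many places with [v a > 1]. Such places lie above finitely many absolute values of the
    rationals, and weak approximation bounds the number of places above each one by the degree. *)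

Local Notation pQtoC := (map_poly (ratr : rat -> algC)).
Local Notation pZtoC := (map_poly (intr : int -> algC)).

(** * Conjugates and algebraic integers *)

(** All the conjugates of [z] are put in one number field [Qs]. The map sending [z] to [z'] extends
    to [Qs], a splitting field, and from there to [algC]. *)
Lemma minCpoly_conj_aut (z z' : algC) :
  root (minCpoly z) z' -> exists nu : {rmorphism algC -> algC}, nu z = z'.
Proof.
move=> rz'; have [rs Drs] := closed_field_poly_normal (minCpoly z).
rewrite (monicP (minCpoly_monic z)) scale1r in Drs.
have [Qs [QsC [s1 Ds1 genQs]]] := num_field_exists rs.
have [q [Dq mon_q] dvq] := minCpolyP z.
have mem_rs y : root (minCpoly z) y -> exists2 y0, y0 \in s1 & QsC y0 = y.
  by rewrite Drs root_prod_XsubC -Ds1 => /mapP[y0 ? ->]; exists y0.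
have [z0 _ Dz] := mem_rs z (root_minCpoly z).
have [z0' _ Dz'] := mem_rs z' rz'.
(* The minimal polynomial of [z0] over the prime field is rational and kills [z], so [minCpoly z]
   divides it and [z'] is a root too. *)
have rootP_ : root (map_poly \1%VF (minPoly 1 z0)) z0'.
  rewrite -(fmorph_root QsC) -map_poly_comp.
  rewrite (@eq_map_poly _ _ _ QsC) => [|a]; last by rewrite /= id_lfunE.
  set p1 := map_poly _ _.
  have [q1 Dp1]: exists q1, p1 = pQtoC q1.
    have aP i: (minPoly 1 z0)`_i \in 1%VS.
      by apply/polyOverP; apply: minPolyOver.
    have{aP} a_ i := sig_eqW (vlineP _ _ (aP i)).
    exists (\poly_(i < size (minPoly 1 z0)) sval (a_ i)).
    apply/polyP=> i; rewrite coef_poly coef_map coef_poly /=.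
    case: ifP => _; rewrite ?rmorph0 //; case: (a_ i) => a /= ->.
    by rewrite alg_num_field fmorph_rat.
  have: root p1 z by rewrite -Dz fmorph_root root_minPoly.
  rewrite Dp1 dvq Dz' => /dvdpP[r ->].
  by rewrite rmorphM rootM /= -Dq rz' orbT.
pose f := kHomExtend 1 \1 z0 z0'.
have homf : kHom 1 <<1; z0>> f by apply: kHomExtendP; rewrite ?kHom1.
pose p : {poly Qs} := map_poly (in_alg Qs) q.
have p1 : p \is a polyOver 1%VS.
  by apply/polyOverP=> i; rewrite coef_map /= memvZ ?mem1v.
have split_p : splittingFieldFor 1 p {:Qs}.
  exists s1 => //; suffices -> : p = \prod_(y <- s1) ('X - y%:P) by exact: eqpxx.
  apply: (map_poly_inj QsC); rewrite rmorph_prod /= /p -map_poly_comp.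
  rewrite (@eq_map_poly _ _ _ ratr) => [|a]; last by rewrite /= alg_num_field fmorph_rat.
  rewrite -Dq Drs -Ds1 big_map.
  by apply: eq_bigr => y _; rewrite map_polyXsubC.
have split_p' : splittingFieldFor <<1; z0>> p {:Qs}.
  by apply: (splittingFieldForS (K := 1%AS) (M := <<1; z0>>%AS)) => //; rewrite ?subv_adjoin ?subvf.
have [g homg Dg] := kHom_extends (sub1v <<1; z0>>%AS) homf p1 split_p'.
have gm : monoid_morphism g by apply/kHom_monoid_morphism.
pose gM := GRing.isMonoidMorphism.Build _ _ (fun_of_lfun g) gm.
pose gRM : {rmorphism _ -> _} := HB.pack (fun_of_lfun g) gM.
have [nu Dnu] := extend_algC_subfield_aut QsC gRM.
exists nu; rewrite -Dz -Dnu /= -Dg ?memv_adjoin // /f.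
by rewrite (kHomExtend_val (kHom1 1 1)) ?Dz'.
Qed.

Lemma minCpoly_prod_uniq (z : algC) :
  {rs : seq algC | uniq rs & minCpoly z = \prod_(y <- rs) ('X - y%:P)}.
Proof.
have [rs Drs] := closed_field_poly_normal (minCpoly z).
rewrite (monicP (minCpoly_monic z)) scale1r in Drs.
exists rs => //; rewrite -separable_prod_XsubC -Drs.
have [q [Dq mon_q] dvq] := minCpolyP z.
rewrite Dq separable_map.
have sz1 : (1 < size q)%N by rewrite -(size_map_poly (ratr : {rmorphism rat -> algC})) -Dq size_minCpoly.
have irr_q : irreducible_poly q.
  split=> // r sz_r dvd_r.
  have nz_q := monic_neq0 mon_q.
  have [t Dt] := dvdpP _ _ dvd_r.
  have /orP[] : root (pQtoC r) z || root (pQtoC t) z.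
  - by rewrite orbC -rootM -rmorphM /= -Dt -Dq root_minCpoly.
  - by rewrite dvq => q_r; rewrite /eqp dvd_r q_r.
  rewrite dvq => q_t; move: nz_q; rewrite Dt mulf_eq0 negb_or => /andP[nt nr].
  have := dvdp_leq nt q_t; rewrite Dt size_mul //.
  by move: nt nr sz_r; rewrite -!size_poly_gt0; lia.
rewrite unlock coprimep_def; case: (boolP (size (gcdp q q^`()) == 1%N)) => // ne1.
have := irr_q.2 _ ne1 (dvdp_gcdl _ _).
move=> eqq; have : q %| q^`() by rewrite -(eqp_dvdl _ eqq) dvdp_gcdr.
have nz' : q^`() != 0.
  have sz' : (size q).-1 != 0%N by case: (size q) sz1 => [|[|]].
  apply/eqP => /polyP/(_ (size q).-2); rewrite coef_deriv coef0.
  have -> : ((size q).-2.+1 = (size q).-1)%N by case: (size q) sz1 => [|[|]].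
  move/eqP; rewrite -mulr_natr mulf_eq0 pnatr_eq0 (negPf sz') orbF.
  by rewrite -lead_coefE (monicP mon_q) oner_eq0.
move/(dvdp_leq nz'); rewrite leqNgt lt_size_deriv //; exact: monic_neq0.
Qed.

(** A number without other conjugates has a minimal polynomial with a single root, and this root is
    simple, so the degree is 1. *)
Lemma fixed_by_auts_rat (c : algC) :
  (forall mu : {rmorphism algC -> algC}, mu c = c) -> c \in Crat.
Proof.
move=> fix_c; have [rs urs Drs] := minCpoly_prod_uniq c.
have all_c y : y \in rs -> y = c.
  move=> rs_y; have [|nu <-] := @minCpoly_conj_aut c y; last by rewrite fix_c.
  by rewrite Drs root_prod_XsubC.
have rsE : rs = [:: c].
  have c_rs : c \in rs by rewrite -root_prod_XsubC -Drs root_minCpoly.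
  apply/perm_small_eq => //; apply: uniq_perm => // y; rewrite inE.
  by apply/idP/eqP => [/all_c|->].
have [q [Dq _] _] := minCpolyP c.
have : (minCpoly c)`_0 = - c by rewrite Drs rsE big_seq1 coefB coefX coefC sub0r.
by rewrite Dq coef_map -[X in X \in _]opprK => <-; rewrite rpredN Crat_rat.
Qed.

Lemma integralOver_int_Aint (x : algC) : integralOver (intr : int -> algC) x <-> x \in Aint.
Proof.
split=> [[p mon_p px] | Ax].
  apply: (root_monic_Aint px); first exact: monic_map.
  by apply/polyOverP=> i; rewrite coef_map intr_int.
have /floorpP[p Dp] := Ax; exists p; last by rewrite -Dp root_minCpoly.
apply/monicP/(@intr_inj algC); rewrite -lead_coef_map_inj //; last exact: intr_inj.
by rewrite -Dp (monicP (minCpoly_monic x)).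
Qed.

Lemma Aint_root_monic (p : {poly algC}) x :
  p \is monic -> root p x -> p \is a polyOver Aint -> x \in Aint.
Proof.
move=> mon_p px /polyOverP Ap; apply/integralOver_int_Aint.
apply: (integral_root_monic mon_p px); apply/integral_poly => i.
exact/integralOver_int_Aint.
Qed.

(** Multiplying [p.[x] = 0] by [c ^+ n], with [n.+1] the degree of [p], turns it into a monic
    equation [q] for [c * x]. *)
Lemma Aint_lead_coefM_root (p : {poly algC}) x :
  p \is a polyOver Aint -> root p x -> lead_coef p * x \in Aint.
Proof.
move=> /polyOverP Ap px; set c := lead_coef p.
have [p0|nz_p] := eqVneq p 0; first by rewrite /c p0 lead_coef0 mul0r.
have := root_size_gt1 nz_p px.
case sz_p: (size p) => [|[|n]] // _.
pose r : {poly algC} := \poly_(i < n.+1) (p`_i * c ^+ (n - i)).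
pose q : {poly algC} := 'X^(n.+1) + r.
have sz_r : (size r < size ('X^(n.+1) : {poly algC})%R)%N.
  by rewrite size_polyXn ltnS size_poly.
apply: (@Aint_root_monic q).
- by rewrite /q monicE lead_coefDl // lead_coefXn.
- rewrite /root /q hornerD hornerXn horner_poly.
  have : c ^+ n * p.[x] = 0 by rewrite (rootP px) mulr0.
  rewrite horner_coef sz_p big_ord_recr /= mulrDr => h.
  have cE : p`_n.+1 = c by rewrite /c lead_coefE sz_p.
  apply/eqP; rewrite addrC -[RHS]h cE !exprS; congr (_ + _); last by rewrite exprMn; ring.
  rewrite mulr_sumr; apply: eq_bigr => i _.
  have -> : c ^+ n = c ^+ (n - i) * c ^+ i by rewrite -exprD subnK // -ltnS.
  by rewrite exprMn; ring.
- apply/polyOverP=> i; rewrite coefD coefXn coef_poly.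
  by apply: rpredD; [case: eqP|case: ifP] => // _; rewrite rpredM ?rpredX ?Ap.
Qed.

(** Induction on the size: both [c] and [c * x] are integral for [c] the leading coefficient of [q],
    so removing the leading term of [q] keeps the product integral. *)
Lemma Aint_divXsubC (q : {poly algC}) x :
  q * ('X - x%:P) \is a polyOver Aint -> q \is a polyOver Aint.
Proof.
have [n] := ubnP (size q); elim: n q => // n IHn q sz_q Ap.
have [->|nz_q] := eqVneq q 0; first exact: rpred0.
set c := lead_coef q.
have cE : c = lead_coef (q * ('X - x%:P)) by rewrite lead_coefM lead_coefXsubC mulr1.
have Ac : c \in Aint by rewrite cE lead_coefE; move/polyOverP: Ap; apply.
have Acx : c * x \in Aint.
  by rewrite cE; apply: Aint_lead_coefM_root => //; rewrite rootM root_XsubC eqxx orbT.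
pose m := (size q).-1; pose q' := q - c *: 'X^m.
have sz_q' : (size q' < size q)%N.
  rewrite -[size q](@prednK _) ?size_poly_gt0 // ltnS; apply/leq_sizeP => j le_mj.
  rewrite coefB coefZ coefXn; move: le_mj; rewrite leq_eqVlt => /orP[/eqP<-|lt].
    by rewrite eqxx mulr1 /c lead_coefE subrr.
  rewrite (gtn_eqF lt) mulr0 subr0; apply: nth_default.
  by move: lt; rewrite -[size q](@prednK _) ?size_poly_gt0.
have Aq' : q' \is a polyOver Aint.
  apply: IHn; first exact: leq_trans sz_q' _.
  have -> : q' * ('X - x%:P) = q * ('X - x%:P) - (c *: 'X^(m.+1) - (c * x) *: 'X^m).
    by rewrite /q' mulrBl exprS -!mul_polyC polyCM; ring.
  by rewrite rpredB // rpredB // polyOverZ // polyOverXn.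
have -> : q = q' + c *: 'X^m by rewrite subrK.
by rewrite rpredD // polyOverZ // polyOverXn.
Qed.

(* Dedekind's Prague theorem, by dividing out the roots of [p] one at a time. *)
Lemma Aint_coefZ_factor (p q : {poly algC}) i :
  p * q \is a polyOver Aint -> p`_i *: q \is a polyOver Aint.
Proof.
have [n] := ubnP (size p); elim: n p i => // n IHn p i sz_p Apq.
have [->|nz_p] := eqVneq p 0; first by rewrite coef0 scale0r rpred0.
have [sz1|gt1] := leqP (size p) 1.
  move: Apq; rewrite (size1_polyC sz1) coefC mul_polyC.
  by case: eqP => // _ _; rewrite scale0r rpred0.
have [x px] : exists x, root p x by apply/closed_rootP; rewrite gtn_eqF.
have /factor_theorem[r Dr] := px.
have nz_r : r != 0 by apply: contraNneq nz_p => r0; rewrite Dr r0 mul0r.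
have sz_r : (size r < n)%N.
  by move: sz_p; rewrite Dr size_mul ?polyXsubC_eq0 // size_XsubC addnC.
have Arq : r * q \is a polyOver Aint.
  by apply: (@Aint_divXsubC _ x); rewrite -mulrA (mulrC q) mulrA -Dr.
(* The coefficients of [p = r * ('X - x)] are differences of coefficients of [r] and of [x *: r];
   both are shorter than [p] and have an integral product with [q]. *)
have Axrq : x *: r * q \is a polyOver Aint.
  have -> : x *: r * q = 'X * (r * q) - p * q by rewrite Dr -mul_polyC; ring.
  by rewrite rpredB // rpredM ?polyOverX.
have H1 j := IHn _ j sz_r Arq.
have H2 := IHn (x *: r) i _ Axrq.
have -> : p`_i *: q = (if i is j.+1 then r`_j *: q else 0) - (x *: r)`_i *: q.
  rewrite Dr mulrBr coefB coefMX coefMC coefZ scalerBl (mulrC x).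
  by case: i {H2} => //=; rewrite scale0r.
apply: rpredB; first by case: i {H2} => [|j]; [exact: rpred0 | exact: H1].
by apply: H2; apply: leq_ltn_trans sz_r; rewrite size_scale_leq.
Qed.

(** * Subfields of the algebraic numbers and their bases *)

(* Bundling a subfield with its carrier lets the [rpred] lemmas apply to it. *)
Record sfield := Sfield {scar : set algC; scarP : subfield scar}.
Definition in_sf (F : sfield) : {pred algC} := fun x => x \in scar F.
HB.instance Definition _ (F : sfield) :=
  GRing.isDivringClosed.Build algC (in_sf F) (scarP F).

Lemma in_sfE (F : sfield) x : (x \in in_sf F) = (x \in scar F).
Proof. by []. Qed.

Lemma sfP (F : sfield) x : scar F x <-> x \in in_sf F.
Proof. by split => [/mem_set|/set_mem]. Qed.

Lemma subfield_QQ : subfield QQ.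
Proof.
have QQE x : (x \in QQ) = (x \in Crat) by apply/idP/idP; rewrite in_setE.
have [h1 h2 h3] := Crat_divring_closed.
by split=> [|x y|x y]; rewrite ?QQE //; [exact: h2 | exact: h3].
Qed.
Definition Qsf := Sfield subfield_QQ.

Lemma in_Qsf x : (x \in in_sf Qsf) = (x \in Crat).
Proof. by apply/idP/idP; rewrite in_sfE in_setE. Qed.

Lemma rat_in_sf (F : sfield) x : x \in Crat -> x \in in_sf F.
Proof. exact: rpred_Crat. Qed.

Lemma polyOver_minCpoly (F : sfield) x : minCpoly x \is a polyOver (in_sf F).
Proof.
have [q [-> _] _] := minCpolyP x.
by apply/polyOverP => i; rewrite coef_map rat_in_sf ?Crat_rat.
Qed.

Lemma polyOver_modp (F : sfield) (p f : {poly algC}) :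
  p \is a polyOver (in_sf F) -> f \is a polyOver (in_sf F) ->
  p %% f \is a polyOver (in_sf F).
Proof.
move=> + Ff; have [n] := ubnP (size p); elim: n p => // n IHn p sz_p Fp.
have [->|nz_f] := eqVneq f 0; first by rewrite modp0.
have [lt|le] := ltnP (size p) (size f); first by rewrite modp_small.
have sz_f : (0 < size f)%N by rewrite size_poly_gt0.
pose c := lead_coef p / lead_coef f.
pose r := p - c *: 'X^(size p - size f) * f.
have Fc : c \in in_sf F.
  by rewrite rpred_div // lead_coefE; [move/polyOverP: Fp | move/polyOverP: Ff].
have -> : p %% f = r %% f by rewrite /r modpD modpN modp_mull subr0.
apply: IHn; last by rewrite rpredB // rpredM // polyOverZ // polyOverXn.
apply: leq_trans (_ : size p <= n)%N; last by [].
have sz_p0 : (0 < size p)%N by apply: leq_trans le.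
rewrite -[X in (_ < X)%N](prednK sz_p0) ltnS; apply/leq_sizeP => j le_j.
rewrite coefB -scalerAl coefZ coefXnM ltnNge.
have aux1 (u v w : nat) : (u.-1 <= w -> 0 < v -> 0 < u -> u - v <= w)%N by lia.
have aux2 (u v w : nat) : (u.-1 = w -> 0 < v -> v <= u -> w - (u - v) = v.-1)%N by lia.
have aux3 (u v w : nat) : (u.-1 < w -> 0 < v -> v <= u -> v <= w - (u - v))%N by lia.
have aux4 (u w : nat) : (u.-1 < w -> 0 < u -> u <= w)%N by lia.
rewrite (aux1 _ _ _ le_j sz_f sz_p0) /=.
move: le_j; rewrite leq_eqVlt => /orP[/eqP jE|lt_j].
  by rewrite (aux2 _ _ _ jE sz_f le) -jE -!lead_coefE /c divfK ?subrr // lead_coef_eq0.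
by rewrite !nth_default ?mulr0 ?subrr // ?aux3 // aux4.
Qed.

Lemma rel_minpoly (F : sfield) (a : algC) :
  exists f : {poly algC}, [/\ f \is monic, f \is a polyOver (in_sf F), root f a &
    forall p, p \is a polyOver (in_sf F) -> root p a -> f %| p].
Proof.
pose P n := `[< exists f : {poly algC}, [/\ f \is monic, f \is a polyOver (in_sf F),
  root f a & size f = n] >].
have exP : exists n, P n.
  exists (size (minCpoly a)); apply/asboolP; exists (minCpoly a).
  by rewrite minCpoly_monic polyOver_minCpoly root_minCpoly.
have [n /asboolP[f [mon_f Ff fa sz_f]] min_n] := ex_minnP exP.
exists f; split=> // p Fp pa; rewrite /dvdp; apply: contraT => nz_r.
set r := p %% f in nz_r.
have Fr : r \is a polyOver (in_sf F) by exact: polyOver_modp.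
have ra : root r a.
  by move: pa; rewrite {1}(divp_eq p f) /root hornerD hornerM (rootP fa) mulr0 add0r.
have /min_n : P (size r).
  apply/asboolP; exists ((lead_coef r)^-1 *: r); split.
  - by rewrite monicE lead_coefZ mulVf // lead_coef_eq0.
  - by rewrite polyOverZ // rpredV lead_coefE; move/polyOverP: Fr.
  - by rewrite rootZ // invr_eq0 lead_coef_eq0.
  - by rewrite size_scale // invr_eq0 lead_coef_eq0.
by rewrite -sz_f leqNgt ltn_modp monic_neq0.
Qed.

(* As [x] is algebraic, [x^-1] is a rational polynomial in [x]. *)
Lemma subring_closed_inv (S : subringClosed algC) x :
  {subset Crat <= S} -> x \in S -> x^-1 \in S.
Proof.
move=> QS Sx; have [->|nz_x] := eqVneq x 0; first by rewrite invr0 rpred0.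
have [q [Dq mon_q] dvq] := minCpolyP x.
have [c [h Dh]] : exists c (h : {poly rat}), q = h * 'X + c%:P.
  exists q`_0, (drop_poly 1 q); rewrite -{1}(poly_take_drop 1 q) addrC expr1.
  by congr (_ + _); apply/polyP=> i; rewrite coef_take_poly coefC; case: i.
have hx : (pQtoC h).[x] * x = - ratr c.
  apply/eqP; rewrite -addr_eq0.
  have : root (pQtoC q) x by rewrite -Dq root_minCpoly.
  by rewrite Dh rmorphD rmorphM /= map_polyX map_polyC /root hornerD hornerM hornerX hornerC.
have Shx : (pQtoC h).[x] \in S.
  by rewrite rpred_horner //; apply/polyOverP=> i; rewrite coef_map QS ?Crat_rat.
(* With a zero constant term, [x] would be a root of [h], of smaller degree than its minimal
   polynomial. *)
have nz_c : c != 0.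
  apply: contra_neq nz_x => c0.
  move/eqP: hx; rewrite c0 rmorph0 oppr0 mulf_eq0 => /orP[/eqP h0|/eqP//].
  have : root (pQtoC h) x by rewrite /root h0.
  rewrite dvq Dh c0 addr0 => /dvdp_leq.
  have nz_h : h != 0 by apply: contraTneq mon_q => h0'; rewrite Dh h0' c0 mul0r addr0 monicE lead_coef0 eq_sym oner_eq0.
  by rewrite nz_h size_mulX // ltnn => /(_ isT).
have -> : x^-1 = - (ratr c)^-1 * (pQtoC h).[x].
  apply: (mulIf nz_x); rewrite mulVf // -mulrA hx mulrNN mulVf //.
  by rewrite fmorph_eq0.
by rewrite rpredM // rpredN QS // -fmorphV Crat_rat.
Qed.

(** The ring [F[a]], which is the field [F(a)] since [a] is algebraic. *)
Definition adj_set (F : sfield) (a : algC) : set algC :=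
  [set x | exists2 p : {poly algC}, p \is a polyOver (in_sf F) & x = p.[a]].

Lemma adj_subfield F a : subfield (adj_set F a).
Proof.
pose S : {pred algC} := fun x => x \in adj_set F a.
have SP x : reflect (adj_set F a x) (x \in S).
  by apply: (iffP idP) => [/set_mem|/mem_set].
have Sring : subring_closed S.
  split=> [|x y /SP[p Fp ->] /SP[q Fq ->]|x y /SP[p Fp ->] /SP[q Fq ->]]; apply/SP.
  - by exists 1; rewrite ?rpred1 // hornerC.
  - by exists (p - q); rewrite ?rpredB // !hornerE.
  - by exists (p * q); rewrite ?rpredM // !hornerE.
pose SM := GRing.isSubringClosed.Build _ S Sring.
pose Sc : subringClosed algC := HB.pack S SM.
have Sinv x : x \in S -> x^-1 \in S.
  apply: (@subring_closed_inv Sc) => y Qy; apply/SP.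
  by exists y%:P; rewrite ?polyOverC ?rat_in_sf // hornerC.
have [S1 SB SMul] := Sring.
by split=> // x y Sx Sy; apply: SMul => //; exact: Sinv.
Qed.
Definition adj F a := Sfield (adj_subfield F a).

Lemma adjP F a x :
  reflect (exists2 p : {poly algC}, p \is a polyOver (in_sf F) & x = p.[a]) (x \in in_sf (adj F a)).
Proof. by apply: (iffP idP) => [/sfP|h] //; apply/sfP. Qed.

Lemma adj_gen F a : a \in in_sf (adj F a).
Proof. by apply/adjP; exists 'X; rewrite ?polyOverX // hornerX. Qed.

Lemma adj_sub F a : {subset in_sf F <= in_sf (adj F a)}.
Proof. by move=> x Fx; apply/adjP; exists x%:P; rewrite ?polyOverC // hornerC. Qed.

Lemma adj_min F a (E : sfield) : {subset in_sf F <= in_sf E} -> a \in in_sf E ->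
  {subset in_sf (adj F a) <= in_sf E}.
Proof.
move=> sFE Ea x /adjP[p /polyOverP Fp ->].
by rewrite rpred_horner //; apply/polyOverP => i; exact: sFE.
Qed.

Lemma sfieldP (E : set algC) : subfield E -> exists F : sfield, scar F = E.
Proof. by move=> h; exists (Sfield h). Qed.

(** Each term of [gamma] for [K(a)] thus concerns a simple extension [F(a)/F], generated by the same
    [a]. *)
Lemma compositum_adj (K F : sfield) a : {subset in_sf K <= in_sf F} ->
  compositum (scar (adj K a)) (scar F) = scar (adj F a).
Proof.
move=> sKF; apply/seteqP; split=> x.
  apply; split; first exact: scarP.
  move=> y [] /sfP; last by move=> ?; apply/sfP/adj_sub.
  move=> Ky; apply/sfP; apply: (@adj_min K a (adj F a)) Ky => [z Kz|].
    exact/adj_sub/sKF.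
  exact: adj_gen.
move=> /sfP Ex A [hA sub]; have [E DE] := sfieldP hA.
move: sub; rewrite -DE => sub.
apply/sfP; apply: (@adj_min F a E) Ex => [y Fy|].
  by apply/sfP; apply: sub; right; apply/sfP.
by apply/sfP; apply: sub; left; apply/sfP/adj_gen.
Qed.

(** Matrix form of [field_basis]: freeness replaces uniqueness of the coordinates, so that changes
    of basis become matrix products. *)
Definition sf_basis (F E : sfield) n (b : 'rV[algC]_n) : Prop :=
  [/\ {subset in_sf F <= in_sf E},
      b \is a mxOver (in_sf E),
      forall x, x \in in_sf E -> exists2 c : 'rV[algC]_n,
        c \is a mxOver (in_sf F) & x%:M = c *m b^T :> 'M[algC]_1 &
      forall c : 'rV[algC]_n, c \is a mxOver (in_sf F) -> c *m b^T = 0 -> c = 0].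

Lemma mulmx_rowT n (c b : 'rV[algC]_n) :
  c *m b^T = (\sum_i c 0 i * b 0 i)%:M.
Proof.
by apply/matrixP=> i j; rewrite !ord1 !mxE mulr1n; apply: eq_bigr => k _; rewrite mxE.
Qed.

Lemma mxOver_rowP (F : sfield) n (c : 'rV[algC]_n) :
  reflect (forall i, scar F (c 0 i)) (c \is a mxOver (in_sf F)).
Proof.
apply: (iffP mxOverP) => [h i|h i j]; first exact/sfP.
by rewrite ord1; apply/sfP.
Qed.

Lemma scalar1_inj (x y : algC) : x%:M = y%:M :> 'M[algC]_1 -> x = y.
Proof. by move/matrixP/(_ 0 0); rewrite !mxE !mulr1n. Qed.

Lemma field_basisP (F E : sfield) n (b : 'rV[algC]_n) :
  {subset in_sf F <= in_sf E} ->
  field_basis (scar F) (scar E) b <-> sf_basis F E b.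
Proof.
move=> sFE; split=> [[Eb uniq_b]|[_ /mxOver_rowP Eb span_b free_b]].
  split=> //; first exact/mxOver_rowP.
  - move=> x /sfP/uniq_b[c [[/mxOver_rowP Fc Dx] _]]; exists c => //.
    by rewrite mulmx_rowT Dx.
  - move=> c Fc; rewrite mulmx_rowT => /matrixP/(_ 0 0); rewrite !mxE mulr1n => c0.
    have E0 : scar E 0 by apply/sfP/rpred0.
    have [c' [_ uc']] := uniq_b _ E0.
    rewrite -(uc' c) ?c0; last by split=> //; exact/mxOver_rowP.
    apply: uc'; split=> [i|]; first by rewrite mxE; apply/sfP/rpred0.
    by rewrite big1 // => i _; rewrite mxE mul0r.
split=> // x /sfP Ex; have [c Fc Dx] := span_b _ Ex.
exists c; split; first split; first exact/mxOver_rowP.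
  by apply: scalar1_inj; rewrite -mulmx_rowT.
move=> c' [/mxOver_rowP Fc' Dx']; apply/eqP; rewrite -subr_eq0; apply/eqP/free_b.
  by rewrite rpredB.
by rewrite mulmxBl -Dx mulmx_rowT -Dx' subrr.
Qed.

Lemma sf_basis_free (F E : sfield) n (b : 'rV[algC]_n) k (c : 'M[algC]_(k, n)) :
  sf_basis F E b -> c \is a mxOver (in_sf F) -> c *m b^T = 0 -> c = 0.
Proof.
case=> _ _ _ free_b /mxOverP Fc c0; apply/row_matrixP=> i; rewrite row0.
apply: free_b; first by apply/mxOverP=> j l; rewrite mxE.
by rewrite -row_mul c0 row0.
Qed.

Lemma sf_basis_span (F E : sfield) n (b : 'rV[algC]_n) k (b' : 'rV[algC]_k) :
  sf_basis F E b -> b' \is a mxOver (in_sf E) ->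
  exists2 C : 'M[algC]_(k, n), C \is a mxOver (in_sf F) & b'^T = C *m b^T.
Proof.
case=> _ _ span_b _ /mxOverP Eb'.
have /choice[c Hc] : forall i, exists c : 'rV[algC]_n, c \is a mxOver (in_sf F) /\
    (b' 0 i)%:M = c *m b^T :> 'M[algC]_1.
  by move=> i; have [c ? ?] := span_b _ (Eb' 0 i); exists c.
exists (\matrix_i c i).
  by apply/mxOverP=> i j; rewrite mxE; case: (Hc i) => /mxOverP + _; apply.
apply/row_matrixP => i; rewrite row_mul rowK; have [_ <-] := Hc i.
by apply/matrixP=> j l; rewrite !ord1 !mxE mulr1n.
Qed.

Lemma sf_basis_leq (F E : sfield) n (b : 'rV[algC]_n) k (b' : 'rV[algC]_k) :
  sf_basis F E b -> sf_basis F E b' -> (n <= k)%N.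
Proof.
move=> hb hb'; have [_ Eb _ _] := hb; have [_ Eb' _ _] := hb'.
have [C FC DC] := sf_basis_span hb Eb'; have [D FD DD] := sf_basis_span hb' Eb.
have : D *m C = 1%:M.
  apply/eqP; rewrite -subr_eq0; apply/eqP; apply: (sf_basis_free hb).
    by rewrite rpredB ?mxOverM // mxOver_scalar ?rpred0 ?rpred1.
  by rewrite mulmxBl -mulmxA -DC -DD mul1mx subrr.
exact: mulmx1_min.
Qed.

Lemma sf_basis_size (F E : sfield) n (b : 'rV[algC]_n) k (b' : 'rV[algC]_k) :
  sf_basis F E b -> sf_basis F E b' -> n = k.
Proof.
by move=> hb hb'; apply/eqP; rewrite eqn_leq (sf_basis_leq hb hb') (sf_basis_leq hb' hb).
Qed.

Lemma sf_basis_transition (F E : sfield) n (b b' : 'rV[algC]_n) :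
  sf_basis F E b -> sf_basis F E b' ->
  exists C : 'M[algC]_n, [/\ C \is a mxOver (in_sf F), C \in unitmx & b'^T = C *m b^T].
Proof.
move=> hb hb'; have [_ Eb _ _] := hb; have [_ Eb' _ _] := hb'.
have [C FC DC] := sf_basis_span hb Eb'; have [D FD DD] := sf_basis_span hb' Eb.
exists C; split=> //; have : D *m C = 1%:M.
  apply/eqP; rewrite -subr_eq0; apply/eqP; apply: (sf_basis_free hb).
    by rewrite rpredB ?mxOverM // mxOver_scalar ?rpred0 ?rpred1.
  by rewrite mulmxBl -mulmxA -DC -DD mul1mx subrr.
by case/mulmx1_unit.
Qed.

Lemma det_in_sf (F : sfield) n (A : 'M[algC]_n) :
  A \is a mxOver (in_sf F) -> \det A \in in_sf F.
Proof.
move/mxOverP=> FA; rewrite /determinant rpred_sum // => s _.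
by rewrite rpredMsign rpred_prod.
Qed.

Lemma invmx_in_sf (F : sfield) n (A : 'M[algC]_n) :
  A \is a mxOver (in_sf F) -> invmx A \is a mxOver (in_sf F).
Proof.
move=> FA; rewrite /invmx; case: ifP => // _.
apply/mxOverP=> i j; rewrite !mxE rpredM ?rpredV ?det_in_sf //.
rewrite /cofactor rpredMsign det_in_sf //; apply/mxOverP=> k l; rewrite !mxE.
by move/mxOverP: FA; apply.
Qed.

Lemma sf_basis_change (F E : sfield) n (b : 'rV[algC]_n) (C : 'M[algC]_n) :
  sf_basis F E b -> C \is a mxOver (in_sf F) -> C \in unitmx ->
  sf_basis F E (b *m C^T).
Proof.
move=> [sFE Eb span_b free_b] FC uC; split=> //.
- rewrite mxOverM //; apply/mxOverP=> i j; rewrite mxE.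
  by apply: sFE; move/mxOverP: FC; apply.
- move=> x /span_b[c Fc Dx]; exists (c *m invmx C); first by rewrite mxOverM ?invmx_in_sf.
  by rewrite trmx_mul trmxK -mulmxA mulKmx.
- move=> c Fc; rewrite trmx_mul trmxK mulmxA => /free_b.
  move=> /(_ (mxOverM Fc FC)) cC0; by rewrite -(mulmxK uC c) cC0 mul0mx.
Qed.

Lemma ext_degreeE (F E : sfield) n (b : 'rV[algC]_n) :
  sf_basis F E b -> ext_degree (scar F) (scar E) = n.
Proof.
move=> hb; have [sFE _ _ _] := hb; rewrite /ext_degree; case: xgetP => [k _ [b' /(field_basisP _ sFE) hb']|].
  exact: sf_basis_size hb' hb.
by move=> /(_ n) []; exists b; apply/field_basisP.
Qed.

Definition is_minpoly (F : sfield) (a : algC) (f : {poly algC}) : Prop :=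
  [/\ f \is monic, f \is a polyOver (in_sf F), root f a &
    forall p, p \is a polyOver (in_sf F) -> root p a -> f %| p].

Lemma power_row_poly n (a : algC) (c : 'rV[algC]_n) :
  c *m (\row_(j < n) a ^+ j)^T = (rVpoly c).[a]%:M :> 'M[algC]_1.
Proof.
rewrite mulmx_rowT horner_poly; congr (_%:M); apply: eq_bigr => i _.
by rewrite mxE; case: insubP => [j _ /ord_inj ->|]; rewrite ?ltn_ord.
Qed.

Lemma rVpoly_over (F : sfield) n (c : 'rV[algC]_n) :
  (rVpoly c \is a polyOver (in_sf F)) = (c \is a mxOver (in_sf F)).
Proof.
apply/polyOverP/mxOverP => [Fc i j|Fc i]; first by rewrite ord1 -coef_rVpoly_ord.
by rewrite coef_rVpoly; case: insubP => // _; rewrite rpred0.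
Qed.

Lemma power_basis (F : sfield) a f : is_minpoly F a f ->
  sf_basis F (adj F a) (\row_(j < (size f).-1) a ^+ j).
Proof.
move=> [mon_f Ff fa min_f]; set d := (size f).-1.
have nz_f := monic_neq0 mon_f.
have sz_f : size f = d.+1 by rewrite /d prednK // size_poly_gt0.
split; first exact: adj_sub.
- by apply/mxOverP=> i j; rewrite mxE rpredX // adj_gen.
- move=> _ /adjP[p Fp ->]; exists (poly_rV (p %% f)).
    rewrite -rVpoly_over poly_rV_K ?polyOver_modp //.
    by rewrite -ltnS -sz_f ltn_modp.
  rewrite power_row_poly poly_rV_K; last by rewrite -ltnS -sz_f ltn_modp.
  by rewrite [in LHS](divp_eq p f) hornerD hornerM (rootP fa) mulr0 add0r.
- move=> c Fc; rewrite power_row_poly => /matrixP/(_ 0 0); rewrite !mxE mulr1n => /rootP ca.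
  rewrite -(rVpolyK c).
  have [->|nz_c] := eqVneq (rVpoly c) 0; first by rewrite raddf0.
  have := dvdp_leq nz_c (min_f _ _ ca); rewrite rVpoly_over => /(_ Fc).
  by rewrite sz_f ltnNge size_poly.
Qed.

Lemma tower_basis (K F E : sfield) m n (b : 'rV[algC]_m) (c : 'rV[algC]_n) :
  sf_basis K F b -> sf_basis F E c -> exists e : 'rV[algC]_(m * n), sf_basis K E e.
Proof.
move=> hb hc; have [sKF /mxOverP Fb span_b free_b] := hb.
have [sFE /mxOverP Ec span_c free_c] := hc.
pose e := mxvec (\matrix_(i < m, j < n) (b 0 i * c 0 j)).
(* A row of [m * n] coefficients is read as an [m] by [n] matrix whose columns hold the
   [K]-coordinates of the coefficients over [F]. *)
have eE (x : 'rV[algC]_(m * n)) : x *m e^T = (b *m vec_mx x) *m c^T.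
  rewrite mulmx_rowT; apply/matrixP=> i j; rewrite !ord1 !mxE mulr1n.
  rewrite (reindex _ (curry_mxvec_bij _ _)) /=.
  transitivity (\sum_(p : 'I_m * 'I_n) b 0 p.1 * x 0 (mxvec_index p.1 p.2) * c 0 p.2).
    apply: eq_bigr => [[p q]] _ /=; rewrite mxE /e mxvecE mxE; ring.
  rewrite -(pair_bigA _ (fun p q => b 0 p * x 0 (mxvec_index p q) * c 0 q)) exchange_big /=.
  apply: eq_bigr => q _; rewrite !mxE mulr_suml; apply: eq_bigr => p _.
  by rewrite mxE.
exists e; split.
- by move=> x /sKF/sFE.
- apply/mxOverP=> i j; rewrite ord1; case/mxvec_indexP: j => p q.
  by rewrite /e mxvecE mxE rpredM // ?Ec // sFE // Fb.
- move=> x /span_c[y Fy Dx].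
  have [C KC DC] := sf_basis_span hb Fy.
  exists (mxvec C^T); first by apply/mxOverP=> i j; rewrite ord1; case/mxvec_indexP: j => p q; rewrite mxvecE mxE; move/mxOverP: KC; apply.
  by rewrite eE mxvecK Dx -[y in LHS]trmxK DC trmx_mul trmxK.
- move=> x /mxOverP Kx; rewrite eE => x0.
  have Kv : vec_mx x \is a mxOver (in_sf K) by apply/mxOverP => i j; rewrite mxE.
  have bv0 : b *m vec_mx x = 0.
    apply: free_c => //; rewrite mxOverM //; first by apply/mxOverP.
    by apply/mxOverP => i j; rewrite sKF //; move/mxOverP: Kv; apply.
  rewrite -(vec_mxK x); suff -> : vec_mx x = 0 by rewrite raddf0.
  apply: trmx_inj; rewrite trmx0; apply: (sf_basis_free hb).
    by apply/mxOverP => i j; rewrite mxE; move/mxOverP: Kv; apply.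
  by rewrite -trmx_mul bv0 trmx0.
Qed.

Lemma number_field_prim (E : sfield) : number_field (scar E) ->
  exists z, in_sf E =i in_sf (adj Qsf z).
Proof.
case=> _ [sQE [n [b hb]]].
have sQE' : {subset in_sf Qsf <= in_sf E} by move=> x /sfP Qx; apply/sfP/sQE.
have [_ /mxOverP Eb span_b _] := (field_basisP b sQE').1 hb.
have [z [c Dz] [ps Dps]] := algC_PET (codom (b 0)).
have szc : size (codom (b 0)) = n by rewrite size_codom card_ord.
exists z => x; apply/idP/idP => [Ex|].
  have [cx Qc Dx] := span_b _ Ex.
  have -> : x = \sum_i cx 0 i * b 0 i by apply: scalar1_inj; rewrite -mulmx_rowT.
  rewrite rpred_sum // => i _; rewrite rpredM //.
    by apply: adj_sub; move/mxOverP: Qc; apply.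
  have := codom_f (b 0) i; rewrite Dps => /mapP[p _ ->].
  apply/adjP; exists (pQtoC p) => //; apply/polyOverP => k.
  by rewrite coef_map in_Qsf Crat_rat.
apply: adj_min => //; rewrite Dz rpred_sum // => i _; rewrite rpredMn //.
have /codomP[j ->] : (codom (b 0))`_i \in codom (b 0) by rewrite mem_nth.
exact: Eb.
Qed.

Lemma eq_sfield (E F : sfield) : in_sf E =i in_sf F -> E = F.
Proof.
case: E F => [A hA] [B hB] EF; have eAB : A = B.
  apply/seteqP; split=> x /mem_set xX; apply/set_mem; move: xX.
    by rewrite -[x \in A]/(x \in in_sf (Sfield hA)) EF.
  by rewrite -[x \in B]/(x \in in_sf (Sfield hB)) -EF.
by case: B / eAB hB EF => hB _; rewrite (Prop_irrelevance hA hB).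
Qed.

Lemma minpoly_Q z : is_minpoly Qsf z (minCpoly z).
Proof.
have [q [Dq _] dvq] := minCpolyP z.
split; rewrite ?minCpoly_monic ?polyOver_minCpoly ?root_minCpoly //.
move=> p /polyOverP Qp pz.
have /choice[r Dr] : forall i, exists r : rat, p`_i = ratr r.
  by move=> i; apply/CratP; rewrite -in_Qsf.
have Dp : p = pQtoC (\poly_(i < size p) r i).
  apply/polyP=> i; rewrite coef_map coef_poly Dr; case: ltnP => // le.
  by rewrite -Dr nth_default // raddf0.
by rewrite Dp Dq dvdp_map -dvq -Dp.
Qed.

Lemma number_field_adj (F : sfield) a : number_field (scar F) -> number_field (scar (adj F a)).
Proof.
move=> nfF; split; first exact: scarP; split.
  by move=> x Qx; apply/sfP/adj_sub; apply: rat_in_sf; rewrite -in_Qsf; apply/sfP.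
have [z /eq_sfield Ez] := number_field_prim nfF.
have hb := power_basis (minpoly_Q z).
have [f /power_basis hc] := rel_minpoly F a.
rewrite -Ez in hb; have [e he] := tower_basis hb hc.
eexists; exists e; apply: (proj2 (@field_basisP Qsf (adj F a) _ e _)) => //.
by case: he.
Qed.

(** * Lattices, integral bases and ideal norms *)

Lemma int_subgroup_gen (A : set int) :
  A 0 -> (forall x y, A x -> A y -> A (x - y)) ->
  exists2 t : int, A t & forall x, A x -> exists q, x = q * t.
Proof.
move=> A0 AB; have AN x : A x -> A (- x) by rewrite -sub0r; apply: AB.
have AM x (n : int) : A x -> A (n * x).
  move=> Ax; have AMn k : A (x *+ k).
    elim: k => [|k IH]; first by rewrite mulr0n.
    by rewrite mulrS -[x *+ k]opprK; apply: AB => //; apply: AN.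
  case: n => k; first by rewrite mulrC -natz mulr_natr; apply: AMn.
  by rewrite NegzE mulNr; apply: AN; rewrite mulrC -natz mulr_natr; apply: AMn.
have [[x [Ax nz_x]]|no] := pselect (exists x, A x /\ x != 0); last first.
  exists 0 => // x Ax; exists 0; rewrite mulr0; apply/eqP/contraT => nz_x.
  by case: no; exists x.
pose P n := `[< exists y, [/\ A y, y != 0 & `|y|%N = n] >].
have exP : exists n, P n by exists `|x|%N; apply/asboolP; exists x.
have [n /asboolP[t [At nz_t Dn]] min_n] := ex_minnP exP.
exists t => // y Ay; exists (y %/ t)%Z.
apply/eqP; rewrite -subr_eq0 [X in X - _](divz_eq y t) addrC addKr; apply/contraT => nz_r.
have /min_n : P `|(y %% t)%Z|%N.
  apply/asboolP; exists (y %% t)%Z; split=> //.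
  by rewrite /modz; apply: AB => //; apply: AM.
by rewrite -Dn leqNgt -ltz_nat !abszE ger0_norm ?modz_ge0 // ltz_mod.
Qed.

(* By induction on [m], splitting off the first coordinate: [T] is triangular. *)
Lemma int_sublattice m (D : set 'rV[int]_m) :
  D 0 -> (forall x y, D x -> D y -> D (x - y)) ->
  exists T : 'M[int]_m, (forall x, D x <-> exists y, x = y *m T) /\
    (\det T != 0 -> exists s : seq 'rV[int]_m, (size s <= `|\det T|)%N /\
       forall x, exists2 r, r \in s & D (x - r)).
Proof.
elim: m D => [|m IHm].
  move=> D D0 DB.
  exists 1%:M; split=> [x|_]; first by split=> _; [exists 0; rewrite !thinmx0 | rewrite thinmx0].
  by exists [:: 0]; rewrite det1; split=> // x; exists 0; rewrite ?mem_seq1 // thinmx0.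
change (forall D : set 'rV[int]_(1 + m), D 0 -> (forall x y, D x -> D y -> D (x - y)) ->
  exists T : 'M[int]_(1 + m), (forall x, D x <-> exists y, x = y *m T) /\
    (\det T != 0 -> exists s : seq 'rV[int]_(1 + m), (size s <= `|\det T|)%N /\
       forall x, exists2 r, r \in s & D (x - r))) => D D0 DB.
pose D' : set 'rV[int]_m := [set y | D (row_mx (0 : 'rV_1) y)].
have [|x y D'x D'y|T' [T'P T's]] := IHm D'; rewrite /D' /=; first by rewrite row_mx0.
  by have := DB _ _ D'x D'y; rewrite opp_row_mx add_row_mx subr0.
pose A : set int := [set t | exists y, D (row_mx (t%:M : 'rV_1) y)].
have [||t [d Dd] genA] := @int_subgroup_gen A.
- by exists 0; rewrite (raddf0 (@scalar_mx _ 1)) row_mx0.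
- move=> x y [a Da] [b Db]; exists (a - b); have := DB _ _ Da Db.
  by rewrite opp_row_mx add_row_mx raddfB.
(* The row [(t, d)] belongs to [D], and [t] generates the first coordinates of [D]; so it spans [D]
   modulo the vectors of [D] with first coordinate 0, which [T'] describes. *)
pose T : 'M[int]_(1 + m) := block_mx t%:M d 0 T'.
have DN x : D x -> D (- x) by rewrite -sub0r; apply: DB.
have DD x y : D x -> D y -> D (x + y) by move=> Dx /DN Dy; rewrite -[y]opprK; apply: DB.
have DM x (n : int) : D x -> D (n *: x).
  move=> Dx; have DMn k : D (x *+ k).
    by elim: k => [|k IH]; rewrite ?mulr0n // mulrS; apply: DD.
  case: n => k; first by rewrite -natz scaler_nat; apply: DMn.
  by rewrite NegzE scaleNr; apply: DN; rewrite -natz scaler_nat; apply: DMn.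
have row1 (v : 'rV[int]_1) : v = (v 0 0)%:M.
  by apply/matrixP=> i j; rewrite !ord1 !mxE mulr1n.
have mulT (y : 'rV[int]_(1 + m)) : y *m T =
    (lsubmx y 0 0) *: row_mx t%:M d + row_mx (0 : 'rV_1) (rsubmx y *m T').
  rewrite -{1}(hsubmxK y) /T mul_row_block mulmx0 addr0 [in LHS](row1 (lsubmx y)).
  by rewrite !mul_scalar_mx scale_row_mx add_row_mx addr0.
have TP x : D x <-> exists y, x = y *m T.
  split=> [Dx|[y ->]].
    have [|q Dq] := genA (lsubmx x 0 0).
      by exists (rsubmx x); rewrite -row1 hsubmxK.
    have /T'P[y Dy] : D' (rsubmx x - q *: d).
      rewrite /D' /=; have := DB _ _ Dx (DM _ q Dd); congr D.
      rewrite -{1}(hsubmxK x) scale_row_mx opp_row_mx add_row_mx (row1 (lsubmx x)) Dq.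
      by rewrite scale_scalar_mx subrr.
    exists (row_mx q%:M y); rewrite mulT row_mxKl row_mxKr -Dy mxE mulr1n.
    rewrite -{1}(hsubmxK x) (row1 (lsubmx x)) Dq scale_row_mx add_row_mx addr0 scale_scalar_mx.
    by rewrite addrC subrK.
  rewrite mulT; apply: DD; first exact: DM.
  by have /T'P : exists y', rsubmx y *m T' = y' *m T' by exists (rsubmx y).
exists T; split=> // .
rewrite /T det_ublock det_scalar expr1 mulf_eq0 negb_or => /andP[nz_t nz_T'].
have [s' [sz_s' s'P]] := T's nz_T'.
(* Representatives: a residue modulo [t] in the first coordinate, then a representative modulo
   [D']. *)
exists [seq row_mx (Posz k)%:M r | k <- iota 0 `|t|%N, r <- s']; split.
  by rewrite size_allpairs size_iota abszM leq_mul2l sz_s' orbT.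
move=> x; pose l := lsubmx x 0 0; pose q := (l %/ t)%Z; pose k := (l %% t)%Z.
have [k' Dk] : exists k', k = Posz k' by have := modz_ge0 l nz_t; rewrite -/k; case: (k) => // k' _; exists k'.
have [r s'r D'r] := s'P (rsubmx x - q *: d).
exists (row_mx (Posz k')%:M r).
  apply/allpairsP; exists (k', r); split=> //=.
  by rewrite mem_iota /= add0n -ltz_nat abszE -Dk ltz_mod.
have -> : x - row_mx (Posz k')%:M r = q *: row_mx t%:M d + row_mx (0 : 'rV_1) (rsubmx x - q *: d - r).
  rewrite -{1}(hsubmxK x) (row1 (lsubmx x)) -/l [in LHS](divz_eq l t) -/q -/k Dk.
  rewrite opp_row_mx !scale_row_mx !add_row_mx scale_scalar_mx raddfD /= addrK addr0.
  by rewrite [q *: d + _]addrC addrAC subrK.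
by apply: DD; [exact: DM|].
Qed.

Lemma primitive_intpoly (a : algC) :
  exists g : {poly int}, [/\ zcontents g = 1, 0 < lead_coef g &
    pZtoC g = (lead_coef g)%:~R *: minCpoly a].
Proof.
have [q [Dq mon_q] _] := minCpolyP a; have [q0 [b nz_b Dq0]] := rat_poly_scale q.
have pZtoQtoC (p : {poly int}) : pQtoC (map_poly intr p) = pZtoC p.
  by rewrite -map_poly_comp; apply: eq_map_poly => c; rewrite /= rmorph_int.
have Dq0' : pZtoC q0 = b%:~R *: minCpoly a.
  rewrite Dq Dq0 map_polyZ /= pZtoQtoC fmorphV rmorph_int scalerA divff ?scale1r //.
  by rewrite intr_eq0.
have nz_q0 : q0 != 0.
  apply: contra_neq nz_b => q00; move: Dq0'; rewrite q00 rmorph0 => /eqP.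
  by rewrite eq_sym scaler_eq0 minCpoly_eq0 orbF intr_eq0 => /eqP.
have cg : zcontents (zprimitive q0) = 1 by rewrite zcontents_primitive nz_q0.
exists (zprimitive q0); split=> //.
  by rewrite -sgz_gt0 -sgz_contents cg.
have Dg : pZtoC (zprimitive q0) = (b%:~R / (zcontents q0)%:~R) *: minCpoly a.
  have Eq : pZtoC q0 = (zcontents q0)%:~R *: pZtoC (zprimitive q0).
    by rewrite {1}(zpolyEprim q0) map_polyZ.
  rewrite [_ / _]mulrC -scalerA -Dq0' Eq scalerA mulVf ?scale1r //.
  by rewrite intr_eq0 zcontents_eq0.
rewrite Dg; congr (_ *: _); rewrite -[RHS]lead_coef_map_inj //; last exact: intr_inj.
by rewrite Dg lead_coefZ (monicP (minCpoly_monic a)) mulr1.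
Qed.

Lemma Aint_int_multiple (x : algC) : exists2 n : int, n != 0 & n%:~R * x \in Aint.
Proof.
have [g [_ g_gt0 Dg]] := primitive_intpoly x.
exists (lead_coef g); first by rewrite gt_eqF.
have -> : (lead_coef g)%:~R = lead_coef (pZtoC g).
  by rewrite Dg lead_coefZ (monicP (minCpoly_monic x)) mulr1.
apply: Aint_lead_coefM_root; first by apply/polyOverP=> i; rewrite coef_map Aint_int.
by rewrite Dg rootZ ?root_minCpoly // intr_eq0 gt_eqF.
Qed.

Lemma Aint_dvd_int (d : algC) : d \in Aint -> d != 0 ->
  exists2 n : int, n != 0 & exists2 d', d' \in Aint & n%:~R = d * d'.
Proof.
move=> Ad nz_d; have [n nz_n Ad'] := Aint_int_multiple d^-1.
by exists n => //; exists (n%:~R * d^-1) => //; rewrite mulrC divfK.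
Qed.

(** The [m = [F : Q]] embeddings of [F], each extended to [algC] and told apart by its value at an
    integral primitive element [z]. *)
Definition embeddings (F : sfield) m (nu : 'I_m -> {rmorphism algC -> algC}) (z : algC) :=
  [/\ F = adj Qsf z, z \in Aint, minCpoly z = \prod_k ('X - (nu k z)%:P) &
      injective (fun k => nu k z)].

Lemma number_field_embeddings (F : sfield) : number_field (scar F) ->
  exists m (nu : 'I_m -> {rmorphism algC -> algC}) z, embeddings F nu z.
Proof.
move=> nfF; have [z0 /eq_sfield Dz0] := number_field_prim nfF.
have [n nz_n Az] := Aint_int_multiple z0; set z := n%:~R * z0 in Az.
have Dz : F = adj Qsf z.
  apply: eq_sfield => x; rewrite Dz0; apply/idP/idP.
    apply: adj_min => [y|]; first exact: adj_sub.
    have -> : z0 = n%:~R^-1 * z by rewrite /z mulKf // intr_eq0.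
    by rewrite rpredM ?adj_gen // rpredV rpred_int.
  apply: adj_min => [y|]; first exact: adj_sub.
  by rewrite /z rpredM ?adj_gen // rpred_int.
have [rs urs Drs] := minCpoly_prod_uniq z.
have /choice[nu Dnu] : forall k : 'I_(size rs), exists nu : {rmorphism algC -> algC}, nu z = rs`_k.
  by move=> k; apply: minCpoly_conj_aut; rewrite Drs root_prod_XsubC mem_nth.
exists (size rs), nu, z; split=> //.
  rewrite Drs (big_nth 0) big_mkord; apply: eq_bigr => k _; by rewrite Dnu.
by move=> k l; rewrite !Dnu => /eqP; rewrite nth_uniq // => /eqP/val_inj.
Qed.

Lemma power_basis_size (F : sfield) a f n : is_minpoly F a f -> size f = n.+1 ->
  sf_basis F (adj F a) (\row_(j < n) a ^+ j).
Proof. by move=> /power_basis + sz_f; rewrite sz_f. Qed.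

Lemma vandermonde_unit n (x : 'I_n -> algC) : injective x ->
  (\matrix_(k < n, j < n) x k ^+ j) \in unitmx.
Proof.
move=> inj_x; have -> : (\matrix_(k < n, j < n) x k ^+ j) = (Vandermonde n (\row_k x k))^T.
  by apply/matrixP=> k j; rewrite !mxE.
rewrite unitmx_tr unitmxE det_Vandermonde unitfE.
apply/prodf_neq0 => i _; apply/prodf_neq0 => j lt_ij.
by rewrite !mxE subr_eq0 (inj_eq inj_x) -val_eqE /= gtn_eqF.
Qed.

Section Embeddings.
Variables (F : sfield) (m : nat) (nu : 'I_m -> {rmorphism algC -> algC}) (z : algC).
Hypothesis emb : embeddings F nu z.

Lemma embeddings_size : size (minCpoly z) = m.+1.
Proof. by have [_ _ -> _] := emb; rewrite size_prod_XsubC /index_enum -enumT size_enum_ord. Qed.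

Lemma embeddings_basis : sf_basis Qsf F (\row_(j < m) z ^+ j).
Proof.
have [DF _ _ _] := emb; rewrite [in X in sf_basis _ X]DF.
exact: power_basis_size (minpoly_Q z) embeddings_size.
Qed.

Lemma aut_Qsf (mu : {rmorphism algC -> algC}) x : x \in in_sf Qsf -> mu x = x.
Proof. by rewrite in_Qsf; exact: aut_Crat. Qed.

Definition emb_mx (e : 'rV[algC]_m) : 'M[algC]_m := \matrix_(k, j) nu k (e 0 j).

Lemma emb_mx_change (e : 'rV[algC]_m) (C : 'M[algC]_m) : C \is a mxOver (in_sf Qsf) ->
  emb_mx (e *m C^T) = emb_mx e *m C^T.
Proof.
move=> /mxOverP QC; apply/matrixP=> k j; rewrite !mxE rmorph_sum; apply: eq_bigr => i _.
by rewrite rmorphM !mxE; congr (_ * _); apply/aut_Qsf.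
Qed.

Lemma emb_mx_unit (e : 'rV[algC]_m) : sf_basis Qsf F e -> emb_mx e \in unitmx.
Proof.
move=> he; have [C [QC uC De]] := sf_basis_transition embeddings_basis he.
have -> : e = (\row_(j < m) z ^+ j) *m C^T by rewrite -[e]trmxK De trmx_mul trmxK.
rewrite emb_mx_change // unitmx_mul unitmx_tr uC andbT.
have -> : emb_mx (\row_(j < m) z ^+ j) = \matrix_(k < m, j < m) nu k z ^+ j.
  by apply/matrixP=> k j; rewrite !mxE rmorphXn.
by apply: vandermonde_unit; case: emb.
Qed.

Lemma integral_basis : exists e : 'rV[algC]_m, sf_basis Qsf F e /\
  forall x, (x \in in_sf F /\ x \in Aint) <->
    exists c : 'rV[int]_m, x = \sum_i (c 0 i)%:~R * e 0 i.
Proof.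
have hb := embeddings_basis; set b := (\row_(j < m) z ^+ j) in hb.
have [_ Az _ _] := emb.
have Ab i : b 0 i \in Aint by rewrite mxE rpredX.
have Fb i : b 0 i \in in_sf F by case: hb => _ /mxOverP.
have AW k j : emb_mx b k j \in Aint by rewrite mxE Aint_aut.
have uW := emb_mx_unit hb; set W := emb_mx b in AW uW.
have nzW : \det W != 0 by rewrite -unitfE -unitmxE.
have AdetW (n : nat) (A : 'M[algC]_n) : (forall i j, A i j \in Aint) -> \det A \in Aint.
  by move=> AA; rewrite rpred_sum // => s _; rewrite rpredMsign rpred_prod.
(* By Cramer's rule applied to the conjugates of [x], the coordinates of an integral [x] have
   denominator dividing [\det W], hence any integer multiple of it. *)
have [N nzN [d' Ad' DN]] := Aint_dvd_int (AdetW _ W AW) nzW.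
pose D : set 'rV[int]_m := [set y | exists x, [/\ x \in in_sf F, x \in Aint &
   N%:~R * x = \sum_i (y 0 i)%:~R * b 0 i]].
have DF x : x \in in_sf F -> x \in Aint ->
   exists2 y, D y & N%:~R * x = \sum_i (y 0 i)%:~R * b 0 i.
  move=> Fx Ax; have [_ _ span_b _] := hb; have [c Qc Dx] := span_b _ Fx.
  have {}Dx : x = \sum_i c 0 i * b 0 i by apply: scalar1_inj; rewrite -mulmx_rowT.
  have Nc i : exists n : int, n%:~R = N%:~R * c 0 i.
    suff : N%:~R * c 0 i \in Num.int by case/intrP=> n ->; exists n.
    have Qci : c 0 i \in Crat by rewrite -in_Qsf; move/mxOverP: Qc; apply.
    apply: Cint_rat_Aint; first by rewrite rpredM // -(ratr_int algC) Crat_rat.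
    have Wc : W *m c^T = \col_k nu k x.
      apply/matrixP=> k j; rewrite !mxE Dx rmorph_sum; apply: eq_bigr => l _.
      rewrite !mxE ord1 rmorphM mulrC; congr (_ * _); apply/esym/aut_Qsf.
      by move/mxOverP: Qc; apply.
    have -> : N%:~R * c 0 i = d' * ((\adj W) *m \col_k nu k x) i 0.
      rewrite -Wc mulmxA mul_adj_mx mul_scalar_mx DN !mxE; ring.
    rewrite rpredM // mxE rpred_sum // => k _; rewrite rpredM //.
      by rewrite mxE rpredMsign; apply: AdetW => p q; rewrite 2!mxE.
    by rewrite mxE Aint_aut.
  have /choice[y Dy] := Nc.
  exists (\row_i y i).
    exists x; split=> //; rewrite Dx mulr_sumr; apply: eq_bigr => i _.
    by rewrite mxE Dy mulrA.
  by rewrite Dx mulr_sumr; apply: eq_bigr => i _; rewrite mxE Dy mulrA.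
have [||T [TP _]] := @int_sublattice m D.
- exists 0; rewrite !rpred0 mulr0; split=> //.
  by rewrite big1 // => i _; rewrite mxE mul0r.
- move=> x y [x' [Fx Ax Dx]] [y' [Fy Ay Dy]]; exists (x' - y').
  rewrite !rpredB //; split=> //; rewrite mulrBr Dx Dy -sumrB.
  by apply: eq_bigr => i _; rewrite !mxE rmorphB mulrBl.
have nzNC : (N%:~R : algC) != 0 by rewrite intr_eq0.
pose C : 'M[algC]_m := N%:~R^-1 *: map_mx intr T.
pose e := b *m C^T.
have QC : C \is a mxOver (in_sf Qsf).
  by apply/mxOverP=> i j; rewrite !mxE rpredM ?rpredV ?rpred_int.
have coef_inj (c c' : 'rV[int]_m) : \sum_i (c 0 i)%:~R * b 0 i = \sum_i (c' 0 i)%:~R * b 0 i -> c = c'.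
  move=> cc'; have [_ _ _ free_b] := hb.
  have : map_mx (intr : int -> algC) c - map_mx intr c' = 0.
    apply: free_b.
      by apply/mxOverP=> i j; rewrite !mxE rpredB ?rpred_int.
    rewrite mulmxBl !mulmx_rowT; apply/matrixP=> i j; rewrite !ord1 !mxE !mulr1n.
    apply/eqP; rewrite subr_eq0; apply/eqP; transitivity (\sum_i (c 0 i)%:~R * b 0 i).
      by apply: eq_bigr => k _; rewrite !mxE.
    by rewrite cc'; apply: eq_bigr => k _; rewrite !mxE.
  move/matrixP=> h; apply/matrixP=> i j; have := h i j; rewrite !mxE => /eqP.
  by rewrite subr_eq0 eqr_int => /eqP.
(* The powers of [z] are themselves in [O_F], so [D] contains [N] times each unit vector. *)
have uC : C \in unitmx.
  have /choice[y Hy] : forall i : 'I_m, exists y : 'rV[int]_m, y *m T = N *: delta_mx 0 i.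
    move=> i; have [y /TP[y' ->] Dy] := DF _ (Fb i) (Ab i); exists y'.
    apply: coef_inj; rewrite -Dy (bigD1 i) //= big1 ?addr0 => [|j ne]; rewrite !mxE eqxx.
      by rewrite eqxx mulr1.
    by rewrite (negPf ne) mulr0 mul0r.
  have YT : (map_mx intr (\matrix_i y i) : 'M[algC]_m) *m C = 1%:M.
    rewrite /C -scalemxAr -map_mxM; apply/matrixP=> i j; rewrite !mxE.
    have /matrixP/(_ 0 j) := Hy i; rewrite !mxE eqxx /= => hy.
    under eq_bigr do rewrite mxE; rewrite hy rmorphM mulKf // eq_sym.
    by case: eqP.
  by case/mulmx1_unit: YT.
have he : sf_basis Qsf F e by apply: sf_basis_change.
have eE (c : 'rV[int]_m) : N%:~R * (\sum_i (c 0 i)%:~R * e 0 i) = \sum_j ((c *m T) 0 j)%:~R * b 0 j.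
  rewrite mulr_sumr; transitivity (\sum_i \sum_j (c 0 i)%:~R * (T i j)%:~R * b 0 j).
    apply: eq_bigr => i _; rewrite mxE !mulr_sumr; apply: eq_bigr => j _.
    rewrite !mxE; transitivity (N%:~R * N%:~R^-1 * ((c 0 i)%:~R * (T i j)%:~R * z ^+ j)); first by ring.
    by rewrite divff // mul1r.
  rewrite exchange_big; apply: eq_bigr => j _; rewrite [(c *m T) 0 j]mxE rmorph_sum mulr_suml.
  by apply: eq_bigr => i _; rewrite rmorphM.
exists e; split=> // x; split=> [[Fx Ax]|[c Dx]].
  have [y /TP[c ->] Dy] := DF _ Fx Ax; exists c.
  by apply: (mulfI nzNC); rewrite eE.
have /TP[x' [Fx' Ax' Dx']] : exists c', c *m T = c' *m T by exists c.
suff -> : x = x' by [].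
by apply: (mulfI nzNC); rewrite Dx' Dx eE.
Qed.

End Embeddings.

Lemma fset_set_card_le (T : choiceType) (A : set T) (s : seq T) :
  (forall x, A x -> x \in s) -> (#|` fset_set A| <= size s)%N.
Proof.
move=> sAs; have finA : finite_set A.
  by apply: sub_finite_set (finite_seq s) => x /sAs.
by apply: uniq_leq_size (fset_uniq _) _ => x; rewrite in_fset_set // => /set_mem/sAs.
Qed.

(** * The index of an ideal, bounded through a polynomial with coefficients in it *)

Section IdealNorm.
Variables (F : sfield) (m : nat) (nu : 'I_m -> {rmorphism algC -> algC}) (z : algC).
Hypothesis emb : embeddings F nu z.
Variable (D : set algC).
Hypothesis idD : ideal_in (ring_of_integers (scar F)) D.

Lemma ring_of_integersP x : ring_of_integers (scar F) x <-> (x \in in_sf F /\ x \in Aint).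
Proof. by split=> [[/sfP]|[/sfP]]. Qed.

(** Here [n] is the determinant of a [Z]-basis of [D] with respect to an integral basis of [O_F],
    and [B] is what remains of the norm of [phi] after taking it out. *)
Lemma ideal_norm_le (phi : {poly algC}) : (forall i, D phi`_i) -> phi != 0 ->
  exists (n : int) (B : {poly int}), [/\ n != 0,
    \prod_k map_poly (nu k) phi = n%:~R *: pZtoC B &
    (ideal_norm (scar F) D <= `|n|)%N].
Proof.
move=> Dphi nz_phi; have [sDO D0 DD DM] := idD.
have [e [he eP]] := integral_basis emb.
pose comb (y : 'rV[int]_m) := \sum_i (y 0 i)%:~R * e 0 i.
have combB x y : comb (x - y) = comb x - comb y.
  by rewrite /comb -sumrB; apply: eq_bigr => i _; rewrite !mxE rmorphB mulrBl.
have DN x : D x -> D (- x).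
  move=> Dx; rewrite -mulN1r; apply: DM => //; apply/ring_of_integersP.
  by rewrite !rpredN !rpred1.
have e_int i : e 0 i \in in_sf F /\ e 0 i \in Aint.
  apply/eP; exists (delta_mx 0 i); rewrite (bigD1 i) //= big1 ?addr0 => [|j ne]; rewrite !mxE eqxx.
    by rewrite eqxx mul1r.
  by rewrite (negPf ne) mul0r.
have [||T [TP Ts]] := @int_sublattice m [set y | D (comb y)].
- by rewrite /= /comb big1 // => i _; rewrite mxE mul0r.
- by move=> x y Dx Dy; rewrite /= combB; apply: DD => //; exact: DN.
have /choice[y Hy] : forall p : nat * 'I_m, exists y : 'rV[int]_m,
    phi`_p.1 * e 0 p.2 = comb (y *m T).
  move=> [l i] /=; have Dle : D (phi`_l * e 0 i).
    by rewrite mulrC; apply: DM => //; apply/ring_of_integersP.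
  have [c Dc] : exists c : 'rV[int]_m, phi`_l * e 0 i = comb c.
    by apply/eP/ring_of_integersP; exact: sDO.
  have /TP[y Dy] : D (comb c) by rewrite -Dc.
  by exists y; rewrite -Dy.
(* [A'] holds the coordinates of the products [phi * e_i] on the basis [T] of [D], and [A] their
   coordinates on the basis [e] of [O_F]. *)
pose A' : 'M[{poly int}]_m := \matrix_(i, j) \poly_(l < size phi) (y (l : nat, i) 0 j).
have [A DA] : exists A, A = A' *m map_mx polyC T by eexists.
have AE i j l : (A i j)`_l = if (l < size phi)%N then (y (l, i) *m T) 0 j else 0.
  rewrite DA mxE coef_sum; case: ifP => sz.
    by rewrite mxE; apply: eq_bigr => h _; rewrite !mxE coefMC coef_poly sz.
  by rewrite big1 // => h _; rewrite !mxE coefMC coef_poly sz mul0r.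
pose U : 'M[{poly algC}]_m := map_mx polyC (emb_mx nu e).
pose Dg : 'M[{poly algC}]_m := diag_mx (\row_k map_poly (nu k) phi).
have AT i j : (map_mx pZtoC A)^T j i = pZtoC (A i j) by rewrite 2!mxE.
have UE k j : U k j = (nu k (e 0 j))%:P by rewrite 2!mxE.
(* The matrix of conjugates of [e] diagonalizes multiplication by [phi], so the determinant of [A]
   is the norm of [phi]. *)
have DUA : Dg *m U = U *m (map_mx pZtoC A)^T.
  rewrite mul_diag_mx; apply/matrixP=> k i; rewrite [LHS]mxE [RHS]mxE UE [(\row__ _) _ _]mxE; apply/polyP=> l.
  rewrite coefMC coef_map -rmorphM coef_sum; have [lt|ge] := ltnP l (size phi); last first.
    rewrite nth_default // mul0r rmorph0 big1 // => j _.
    by rewrite UE AT coefCM coef_map AE ltnNge ge /= rmorph0 mulr0.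
  rewrite (Hy (l, i)) rmorph_sum; apply: eq_bigr => j _.
  by rewrite UE AT coefCM coef_map AE lt /= rmorphM rmorph_int mulrC.
have uU : \det U != 0.
  rewrite det_map_mx polyC_eq0 -unitfE -unitmxE. exact (emb_mx_unit emb he).
have prodE : \prod_k map_poly (nu k) phi = (\det T)%:~R *: pZtoC (\det A').
  have := congr1 determinant DUA; rewrite !det_mulmx det_diag det_tr mulrC => /(mulfI uU).
  have -> : \prod_i (\row_k map_poly (nu k) phi) 0 i = \prod_k map_poly (nu k) phi.
    by apply: eq_bigr => k _; rewrite mxE.
  move=> ->; rewrite det_map_mx DA det_mulmx det_map_mx rmorphM /= map_polyC /=.
  by rewrite mulrC mul_polyC.
have nz : \prod_k map_poly (nu k) phi != 0.
  by apply/prodf_neq0 => k _; rewrite map_poly_eq0.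
(* A nonzero [phi] forces [D] to have finite index. *)
have nz_T : \det T != 0.
  by apply: contraNneq nz => T0; rewrite prodE T0 scale0r.
exists (\det T), (\det A'); split=> //.
have [s [sz_s sP]] := Ts nz_T.
apply: leq_trans sz_s.
pose coset (x : algC) : set algC := [set (x + a)%R | a in D].
rewrite -(size_map (fun r => coset (comb r)) s); apply: fset_set_card_le => _ [x /ring_of_integersP/eP[c Dx] <-].
have [r s_r Dr] := sP c.
apply/mapP; exists r => //; apply/seteqP; split=> w [a Da <-] /=.
  exists (comb (c - r) + a); first exact: DD.
  by rewrite combB Dx -/(comb c); ring.
exists (a - comb (c - r)); first by apply: DD => //; exact: DN.
by rewrite combB Dx -/(comb c); ring.
Qed.

(** As [G] is primitive, comparing contents in [c G = n B] shows that [c] is [n] times the content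
    of [B]: an integer, and a nonzero multiple of [n]. *)
Lemma ideal_norm_le_content (phi : {poly algC}) (c : algC) (G : {poly int}) :
  (forall i, D phi`_i) -> zcontents G = 1 -> phi != 0 ->
  \prod_k map_poly (nu k) phi = c *: pZtoC G ->
  exists n : int, c = n%:~R /\ (ideal_norm (scar F) D <= `|n|)%N.
Proof.
move=> Dphi cG nz_phi DG.
have [n [B [nz_n DB leN]]] := ideal_norm_le Dphi nz_phi.
have /CratP[r Dr] : c \in Crat.
  have nz_G : lead_coef G != 0 by rewrite lead_coef_eq0 -zcontents_eq0 cG.
  have := congr1 (fun p : {poly algC} => p`_(size G).-1) (etrans (esym DG) DB).
  rewrite !coefZ !coef_map -lead_coefE /= => e.
  have -> : c = n%:~R * (B`_(size G).-1)%:~R / (lead_coef G)%:~R.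
    by rewrite -e mulfK // intr_eq0.
  by rewrite rpred_div ?rpredM // -(ratr_int algC) Crat_rat.
have nz_c : c != 0.
  apply/eqP => c0; move: DG; rewrite c0 scale0r => /eqP; apply/negP.
  by apply/prodf_neq0 => k _; rewrite map_poly_eq0.
pose nr := numq r; pose dr := denq r.
have nz_d : (dr%:~R : algC) != 0 by rewrite intr_eq0 denq_neq0.
have cE : c = nr%:~R / dr%:~R.
  by rewrite Dr -{1}(divq_num_den r) fmorph_div /= !rmorph_int.
have eqP : nr *: G = (n * dr) *: B.
  apply: (map_inj_poly (@intr_inj algC)) => //; rewrite ?rmorph0 // !map_polyZ /=.
  have := congr1 (fun p => dr%:~R *: p) (etrans (esym DG) DB).
  by rewrite !scalerA cE mulrC divfK // => ->; rewrite rmorphM mulrC.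
have := congr1 zcontents eqP; rewrite !zcontentsZ cG mulr1 => nrE.
exists (n * zcontents B); split.
  by apply: (mulIf nz_d); rewrite cE divfK // nrE !rmorphM /= mulrAC.
apply: leq_trans leN _; rewrite abszM leq_pmulr // absz_gt0.
by apply: contraNneq nz_c => cB0; rewrite cE nrE cB0 mulr0 mul0r.
Qed.
End IdealNorm.

(** * Relative discriminants *)

Lemma minpoly_roots (F : sfield) a f : is_minpoly F a f ->
  exists d (r : 'I_d -> algC), f = \prod_k ('X - (r k)%:P) /\ injective r.
Proof.
move=> [mon_f Ff fa min_f].
have [rs Drs] := closed_field_poly_normal f.
rewrite (monicP mon_f) scale1r in Drs.
have urs : uniq rs.
  rewrite -separable_prod_XsubC -Drs.
  apply: (@dvdp_separable _ (minCpoly a)).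
    by apply: min_f; rewrite ?polyOver_minCpoly ?root_minCpoly.
  by have [s us ->] := minCpoly_prod_uniq a; rewrite separable_prod_XsubC.
exists (size rs), (fun k => rs`_k); split.
  by rewrite Drs (big_nth 0) big_mkord.
by move=> k l /eqP; rewrite nth_uniq // => /eqP/val_inj.
Qed.

Section RelDisc.
Variables (F : sfield) (a : algC) (f : {poly algC}) (d : nat) (r : 'I_d -> algC).
Hypotheses (min_f : is_minpoly F a f) (fE : f = \prod_k ('X - (r k)%:P))
  (inj_r : injective r).

Let E := adj F a.

Lemma size_minpoly_roots : size f = d.+1.
Proof. by rewrite fE size_prod_XsubC /index_enum -enumT size_enum_ord. Qed.

Lemma minpoly_degree_gt0 : (0 < d)%N.
Proof.
have [mon_f _ fa _] := min_f.
by have := root_size_gt1 (monic_neq0 mon_f) fa; rewrite size_minpoly_roots.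
Qed.

Lemma minpoly_conj (P : {poly algC}) k :
  P \is a polyOver (in_sf F) -> P.[a] = 0 -> P.[r k] = 0.
Proof.
move=> FP /rootP Pa; have [_ _ _ /(_ _ FP Pa)/dvdpP[q ->]] := min_f.
rewrite hornerM fE horner_prod (bigD1 k) //= hornerXsubC subrr mul0r mulr0 //.
Qed.

Definition vdm : 'M[algC]_d := \matrix_(k, j) r k ^+ j.

Lemma vdm_unit : vdm \in unitmx.
Proof. exact: vandermonde_unit. Qed.

Lemma minpoly_power_basis : sf_basis F E (\row_(j < d) a ^+ j).
Proof. exact: power_basis_size min_f size_minpoly_roots. Qed.

(** An element of [F(a)] is represented by a polynomial [P] over [F]; evaluation at [r k] plays the
    role of the [k]-th embedding over [F]. *)
Definition conj_mx (P : 'I_d -> {poly algC}) : 'M[algC]_d := \matrix_(k, j) (P j).[r k].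

Lemma conj_mx_vdm (P : 'I_d -> {poly algC}) (C : 'M[algC]_d) :
  (forall j, P j \is a polyOver (in_sf F)) -> C \is a mxOver (in_sf F) ->
  (forall j, (P j).[a] = \sum_l C j l * a ^+ l) ->
  conj_mx P = vdm *m C^T.
Proof.
move=> FP /mxOverP FC DP; apply/matrixP=> k j; rewrite !mxE.
pose Q := P j - \sum_l (C j l)%:P * 'X^l.
have : Q.[r k] = 0.
  apply: minpoly_conj.
    rewrite rpredB // rpred_sum // => l _.
    by rewrite rpredM ?polyOverC ?polyOverXn.
  rewrite /Q hornerD hornerN horner_sum DP; apply/eqP; rewrite subr_eq0; apply/eqP.
  by apply: eq_bigr => l _; rewrite !hornerE.
rewrite /Q hornerD hornerN horner_sum => /eqP; rewrite subr_eq0 => /eqP ->.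
by apply: eq_bigr => l _; rewrite !mxE !hornerE mulrC.
Qed.

Lemma basis_reps n (b : 'rV[algC]_n) : b \is a mxOver (in_sf E) ->
  exists P : 'I_n -> {poly algC}, forall j, P j \is a polyOver (in_sf F) /\ b 0 j = (P j).[a].
Proof.
move=> /mxOverP Eb.
have /choice[P HP] : forall j, exists P : {poly algC},
    P \is a polyOver (in_sf F) /\ b 0 j = P.[a].
  by move=> j; have /adjP[P FP DP] := Eb 0 j; exists P.
by exists P.
Qed.

Lemma conj_mx_unit (b : 'rV[algC]_d) (P : 'I_d -> {poly algC}) :
  sf_basis F E b -> (forall j, P j \is a polyOver (in_sf F)) ->
  (forall j, b 0 j = (P j).[a]) -> conj_mx P \in unitmx.
Proof.
move=> hb FP DP; have [C [FC uC DC]] := sf_basis_transition minpoly_power_basis hb.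
rewrite (conj_mx_vdm FP FC) ?unitmx_mul ?vdm_unit ?unitmx_tr // => j.
rewrite -DP; have /matrixP/(_ j 0) := DC; rewrite !mxE => ->.
by apply: eq_bigr => l _; rewrite !mxE.
Qed.

(** The conjugates of the basis form an invertible matrix [W] that diagonalizes multiplication by
    [Q.[a]], with eigenvalues [Q.[r k]]. *)
Lemma trace_conj n (b : 'rV[algC]_n) (A : 'M[algC]_n) (Q : {poly algC}) :
  sf_basis F E b -> A \is a mxOver (in_sf F) -> Q \is a polyOver (in_sf F) ->
  (forall i, Q.[a] * b 0 i = \sum_j A i j * b 0 j) ->
  \tr A = \sum_k Q.[r k].
Proof.
move=> hb; have nd : n = d by exact: sf_basis_size hb minpoly_power_basis.
subst n; move=> /mxOverP FA FQ DA.
have [_ Eb _ _] := hb; have [P HP] := basis_reps Eb.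
have FP j : P j \is a polyOver (in_sf F) by case: (HP j).
have DP j : b 0 j = (P j).[a] by case: (HP j).
have uW := conj_mx_unit hb FP DP; set W := conj_mx P in uW.
have QW : diag_mx (\row_k Q.[r k]) *m W = W *m A^T.
  rewrite mul_diag_mx; apply/matrixP=> k i; rewrite !mxE.
  pose R := Q * P i - \sum_j (A i j)%:P * P j.
  have : R.[r k] = 0.
    apply: minpoly_conj.
      rewrite rpredB ?rpredM // rpred_sum // => j _.
      by rewrite rpredM ?polyOverC.
    rewrite /R hornerD hornerN horner_sum hornerM -DP DA; apply/eqP; rewrite subr_eq0; apply/eqP.
    by apply: eq_bigr => l _; rewrite DP !hornerE.
  rewrite /R hornerD hornerN horner_sum hornerM => /eqP; rewrite subr_eq0 => /eqP ->.
  by apply: eq_bigr => l _; rewrite !mxE !hornerE mulrC.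
rewrite -mxtrace_tr.
have -> : A^T = invmx W *m (diag_mx (\row_k Q.[r k]) *m W) by rewrite QW mulKmx.
rewrite mxtrace_mulC -mulmxA mulmxV // mulmx1 mxtrace_diag.
by apply: eq_bigr => k _; rewrite mxE.
Qed.

Lemma ext_trace_conj (Q : {poly algC}) : Q \is a polyOver (in_sf F) ->
  ext_trace (scar F) (scar E) Q.[a] = \sum_k Q.[r k] /\
  ext_trace (scar F) (scar E) Q.[a] \in in_sf F.
Proof.
move=> FQ; have sFE : {subset in_sf F <= in_sf E} := @adj_sub F a.
rewrite /ext_trace; case: xgetP => [t _ [n [b [A [hb FA DA ->]]]]|].
  have FA' : A \is a mxOver (in_sf F) by apply/mxOverP => i j; apply/sfP.
  split; first by apply: trace_conj DA => //; exact/field_basisP.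
  by rewrite rpred_sum // => i _; move/mxOverP: FA'; apply.
(* The remaining case is that of an empty set of traces, where [xget] would return its default; the
   power basis rules it out. *)
have hb := minpoly_power_basis; set b := \row_(j < d) a ^+ j in hb.
have EQ : Q.[a] \in in_sf E by apply/adjP; exists Q.
have [|A FA DA] := sf_basis_span (b' := Q.[a] *: b) hb.
  apply/mxOverP=> i j; rewrite mxE rpredM // ord1.
  by case: hb => _ /mxOverP.
move=> /(_ (\tr A)) []; exists d, b, A; split=> //.
- exact/field_basisP.
- by move=> i j; apply/sfP; move/mxOverP: FA; apply.
- move=> i; have /matrixP/(_ i 0) := DA; rewrite [LHS]mxE [LHS]mxE [RHS]mxE => ->.
  by apply: eq_bigr => j _; rewrite [b^T _ _]mxE.
Qed.

Lemma basis_disc_conj (b : 'rV[algC]_d) (P : 'I_d -> {poly algC}) :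
  (forall j, P j \is a polyOver (in_sf F)) -> (forall j, b 0 j = (P j).[a]) ->
  basis_disc (scar F) (scar E) b = (\det (conj_mx P)) ^+ 2.
Proof.
move=> FP DP; rewrite /basis_disc expr2 -[X in X * _]det_tr -det_mulmx; congr (\det _).
apply/matrixP=> i j; rewrite !mxE !DP -hornerM.
have FPij : P i * P j \is a polyOver (in_sf F) by rewrite rpredM.
rewrite (ext_trace_conj FPij).1.
by apply: eq_bigr => k _; rewrite !mxE hornerM.
Qed.

Lemma conj_Aint (P : {poly algC}) k :
  P \is a polyOver (in_sf F) -> P.[a] \in Aint -> P.[r k] \in Aint.
Proof.
move=> FP AP.
have : root (minCpoly P.[a]) P.[r k].
  rewrite /root -horner_comp; apply/eqP/minpoly_conj.
    by rewrite polyOver_comp // polyOver_minCpoly.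
  by rewrite horner_comp; apply/rootP/root_minCpoly.
by move/root_monic_Aint; apply; rewrite ?minCpoly_monic.
Qed.

(** [smallest] is an intersection. It lies in [O_F] because [O_F] is one of the intersected ideals:
    discriminants of integral bases are sums of products of algebraic integers, and lie in [F] as
    determinants of traces. *)
Lemma rel_disc_ideal :
  ideal_in (ring_of_integers (scar F)) (rel_disc (scar F) (scar E)).
Proof.
pose O := ring_of_integers (scar F).
have OP x : O x <-> x \in in_sf F /\ x \in Aint by exact: ring_of_integersP.
have idO : ideal_in O O.
  split=> // [|x y /OP[? ?] /OP[? ?]|x y /OP[? ?] /OP[? ?]]; apply/OP.
  - by rewrite !rpred0.
  - by rewrite !rpredD.
  - by rewrite !rpredM.
have sFE : {subset in_sf F <= in_sf E} := @adj_sub F a.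
have sub : rel_disc (scar F) (scar E) `<=` O.
  move=> x; apply; split=> // _ [n [b [hb Ob ->]]].
  have {}hb : sf_basis F E b by exact/field_basisP.
  have nd : n = d by exact: sf_basis_size hb minpoly_power_basis.
  subst n.
  have [_ Eb _ _] := hb; have [P HP] := basis_reps Eb.
  have FP j : P j \is a polyOver (in_sf F) by case: (HP j).
  have DP j : b 0 j = (P j).[a] by case: (HP j).
  have AO j : b 0 j \in Aint by case: (Ob j).
  apply/OP; split.
    apply: det_in_sf; apply/mxOverP=> i j; rewrite mxE !DP -hornerM.
    have FPij : P i * P j \is a polyOver (in_sf F) by rewrite rpredM.
    exact: (ext_trace_conj FPij).2.
  rewrite (basis_disc_conj FP DP) rpredX // rpred_sum // => s _.
  rewrite rpredMsign rpred_prod // => k _; by rewrite mxE conj_Aint // -DP AO.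
split=> //.
- by move=> A [[_ A0 _ _] _].
- move=> x y Dx Dy A hA; have [[_ _ AD _] _] := hA.
  by apply: AD; [exact: Dx | exact: Dy].
- move=> x y Ox Dy A hA; have [[_ _ _ AM] _] := hA.
  by apply: AM => //; exact: Dy.
Qed.

Lemma drop_poly_over n : drop_poly n f \is a polyOver (in_sf F).
Proof.
have [_ /polyOverP Ff _ _] := min_f.
by apply/polyOverP => i; rewrite coef_drop_poly.
Qed.

(* The coefficients of [f / ('X - a)] are the values at [a] of the truncations of [f]. *)
Lemma Aint_drop_poly_root (u : algC) n : (0 < n)%N ->
  u *: f \is a polyOver Aint -> u * (drop_poly n f).[a] \in Aint.
Proof.
case: n => // n _ Auf; have [mon_f _ fa _] := min_f.
pose h := \poly_(j < d) (drop_poly j.+1 f).[a].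
have dropS j : drop_poly j f = (f`_j)%:P + drop_poly j.+1 f * 'X.
  apply/polyP=> i; rewrite coefD coefC coefMX !coef_drop_poly.
  by case: i => [|i]; rewrite /= ?addr0 ?add0r // addnS addSn.
have hE j : h`_j = (drop_poly j.+1 f).[a].
  rewrite coef_poly; case: ltnP => // le_dj.
  by rewrite drop_poly_eq0 ?horner0 // size_minpoly_roots.
have Dh : h * ('X - a%:P) = f.
  apply/polyP=> j; rewrite mulrBr coefB coefMX coefMC !hE.
  case: j => [|j] /=.
    have := rootP fa; rewrite -[f in f.[a]](drop_poly0l) dropS hornerD hornerC hornerMX.
    by move/eqP; rewrite addr_eq0 sub0r => /eqP ->.
  by rewrite (dropS j.+1) hornerD hornerC hornerMX addrK.
have : (u *: h) * ('X - a%:P) \is a polyOver Aint by rewrite -scalerAl Dh.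
by move/Aint_divXsubC/polyOverP/(_ n); rewrite coefZ hE.
Qed.

Lemma disc_in_rel_disc (u : 'I_d -> algC) :
  (forall j, u j \in in_sf F) ->
  (forall j : 'I_d, j != 0%N :> nat -> u j *: f \is a polyOver Aint) ->
  (forall j : 'I_d, j = 0%N :> nat -> u j = 1) ->
  rel_disc (scar F) (scar E) ((\prod_j u j) ^+ 2 * (\det vdm) ^+ 2).
Proof.
(* If some [u j] vanishes, the family below is not a basis, but the element in question is 0. *)
move=> Fu Auf u0; have [/eqP p0|nz_u] := boolP (\prod_j u j == 0).
  by rewrite p0 expr0n mul0r; case: rel_disc_ideal.
have [mon_f Ff fa _] := min_f.
(* Since [drop_poly (d - j) f] is monic of degree [j], the matrix [C] of coordinates is lower
   triangular with diagonal [u]. *)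
pose P j := u j *: drop_poly (d - j) f.
pose C : 'M[algC]_d := \matrix_(j, l) (u j * f`_(l + (d - j))).
have FP j : P j \is a polyOver (in_sf F) by rewrite polyOverZ // drop_poly_over.
have FC : C \is a mxOver (in_sf F).
  by apply/mxOverP=> j l; rewrite mxE rpredM //; move/polyOverP: Ff; apply.
have DC : \det C = \prod_j u j.
  rewrite det_trig; last first.
    apply/is_trig_mxP => j l lt_jl; rewrite mxE nth_default ?mulr0 // size_minpoly_roots.
    by have := ltn_ord j; lia.
  apply: eq_bigr => j _; rewrite mxE subnKC; last exact: ltnW.
  suff -> : f`_d = 1 by rewrite mulr1.
  by move/monicP: mon_f; rewrite lead_coefE size_minpoly_roots.
have uC : C \in unitmx by rewrite unitmxE unitfE DC.
pose b := (\row_(j < d) a ^+ j) *m C^T.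
have hb : sf_basis F E b by exact: sf_basis_change minpoly_power_basis FC uC.
have Pa j : (P j).[a] = \sum_l C j l * a ^+ l.
  rewrite /P hornerZ (@horner_coef_wide _ d).
    rewrite mulr_sumr; apply: eq_bigr => l _.
    by rewrite coef_drop_poly mxE mulrA.
  by rewrite size_drop_poly size_minpoly_roots; have := ltn_ord j; lia.
have DP j : b 0 j = (P j).[a].
  by rewrite Pa mxE; apply: eq_bigr => l _; rewrite !mxE mulrC.
move=> A [_]; apply; exists d, b; split.
- by apply: (proj2 (field_basisP _ _)) hb; exact: adj_sub.
- have [_ /mxOverP Eb _ _] := hb.
  move=> j; apply/(@ring_of_integersP E); split; first exact: Eb.
  have [j0|nz_j] := eqVneq (j : nat) 0%N.
    rewrite DP /P u0 // scale1r j0 subn0.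
    suff -> : drop_poly d f = 1 by rewrite hornerC.
    apply/polyP=> i; rewrite coef_drop_poly coef1; case: i => [|i].
      by move/monicP: mon_f; rewrite lead_coefE size_minpoly_roots.
    by rewrite nth_default // size_minpoly_roots; lia.
  by rewrite DP /P hornerZ Aint_drop_poly_root ?Auf // subn_gt0.
- by rewrite (basis_disc_conj FP DP) (conj_mx_vdm FP FC Pa) det_mulmx det_tr DC exprMn mulrC.
Qed.

End RelDisc.

(* [2 u v = (u + v)^2 - u^2 - v^2], and the off-diagonal terms of a coefficient of
   [p^2] come in equal pairs. *)
Lemma coef_sqr_subgroup (R : comNzRingType) (A U : set R) (p : {poly R}) n :
  A 0 -> (forall x y, A x -> A y -> A (x - y)) ->
  (forall x y, U x -> U y -> U (x + y)) -> (forall x, U x -> A (x ^+ 2)) ->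
  (forall i, U p`_i) -> A (p ^+ 2)`_n.
Proof.
move=> A0 AB UD AU Up.
have AD x y : A x -> A y -> A (x + y).
  by move=> Ax Ay; rewrite -[y]opprK -[- y]sub0r; apply: (AB) => //; exact: AB.
have A2 x y : U x -> U y -> A (x * y *+ 2).
  move=> Ux Uy; have -> : x * y *+ 2 = (x + y) ^+ 2 - x ^+ 2 - y ^+ 2 by ring.
  by apply: (AB); [apply: (AB)|]; apply: AU => //; exact: UD.
suff : forall N (u : nat -> R), (forall i, U (u i)) -> A (\sum_(i < N) u i * u (N.-1 - i)%N).
  by move=> /(_ n.+1 (fun i => p`_i) Up); rewrite expr2 coefM.
move=> N; have [k] := ubnP N; elim: k N => // k IH [|[|N]] lt u Uu.
- by rewrite big_ord0.
- by rewrite big_ord1 -expr2; exact: AU.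
(* The two extreme terms are equal, so together they are twice a product; what is left is a sum of
   the same form with two terms fewer. *)
rewrite big_ord_recl big_ord_recr /= subnn addrCA.
have -> : bump 0 N = N.+1 by [].
rewrite subn0 [u N.+1 * _]mulrC -mulr2n addrC; apply: AD; first exact: A2.
have -> : \sum_(i < N) u (bump 0 (widen_ord (leqnSn N) i)) * u (N.+1 - bump 0 (widen_ord (leqnSn N) i))%N
   = \sum_(i < N) u i.+1 * u (N.-1 - i).+1.
  apply: eq_bigr => i _ /=; congr (_ * u _); rewrite /bump /=; have := ltn_ord i; lia.
by apply: (IH N _ (fun i => u i.+1)) => //; lia.
Qed.

Section RelDiscPoly.
Variables (F : sfield) (a : algC) (f : {poly algC}) (d : nat) (r : 'I_d -> algC).
Hypotheses (min_f : is_minpoly F a f) (fE : f = \prod_k ('X - (r k)%:P))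
  (inj_r : injective r).

Let D := rel_disc (scar F) (scar (adj F a)).
(** The inverse of the content ideal of [f], as a fractional ideal of [F]. *)
Let U : set algC := [set u | u \in in_sf F /\ u *: f \is a polyOver Aint].
Let disc := \det (vdm r) ^+ 2.

Lemma rel_disc_prod_sqr (s : seq algC) : size s = d.-1 -> (forall x, x \in s -> U x) ->
  D (disc * \prod_(x <- s) x ^+ 2).
Proof.
move=> sz_s Us; have d_gt0 := minpoly_degree_gt0 min_f fE.
pose u (j : 'I_d) := nth 0 (1 :: s) j.
have prodE : \prod_j u j = \prod_(x <- s) x.
  rewrite -(big_mkord xpredT (fun j => nth 0 (1 :: s) j)).
  have -> : d = size (1 :: s) by rewrite /= sz_s prednK.
  by rewrite -(big_nth 0 xpredT (fun x => x)) big_cons mul1r.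
have Us' j : (0 < j < d)%N -> U (nth 0 (1 :: s) j).
  case: j => // j /= lt; apply: Us; apply: mem_nth.
  by rewrite sz_s; move: lt; lia.
have := @disc_in_rel_disc F a f d r min_f fE inj_r u.
rewrite prodE -prodrXl mulrC; apply.
- move=> j; rewrite /u; have := ltn_ord j; case: (nat_of_ord j) => [|i] lt; first exact: rpred1.
  by case: (Us' i.+1).
- by move=> j nz_j; case: (Us' j) => //; rewrite lt0n nz_j ltn_ord.
- by move=> j; rewrite /u => ->.
Qed.

(** Integral bases only yield multiples of [disc] by products of [d - 1] squares from [U]. The
    factors [psi ^+ 2] are removed one at a time: a coefficient of [psi ^+ 2] is in the additive
    group generated by squares of [U], so it can be replaced by such a square, recorded in [s]. *)
Lemma coef_disc_psi (psi : {poly algC}) j : (forall i, U psi`_i) ->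
  D (disc *: psi ^+ (2 * d.-1))`_j.
Proof.
move=> Upsi; have [DO D0 DD DM] := rel_disc_ideal min_f fE inj_r; rewrite -/D in DO D0 DD DM.
have DN x : D x -> D (- x).
  move=> Dx; rewrite -mulN1r; apply: DM => //; apply/ring_of_integersP.
  by rewrite !rpredN !rpred1.
suff H n : forall s j, (size s + n = d.-1)%N -> (forall x, x \in s -> U x) ->
    D (disc * \prod_(x <- s) x ^+ 2 * (psi ^+ (2 * n))`_j).
  by have := H d.-1 [::] j erefl; rewrite big_nil mulr1 coefZ; apply.
elim: n => [|n IH] s i sz_s Us.
  rewrite coef1; case: eqP => _; last by rewrite mulr0.
  by rewrite mulr1; apply: rel_disc_prod_sqr => //; rewrite -sz_s addn0.
rewrite mulnS exprD coefM mulr_sumr.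
apply: (big_ind D) => // l _; rewrite mulrA.
set t := (psi ^+ (2 * n))`_ _.
pose A : set algC := [set x | D (disc * \prod_(x <- s) x ^+ 2 * x * t)].
apply: (@coef_sqr_subgroup _ A U) => //.
- by rewrite /A /= mulr0 mul0r.
- by move=> x y Ax Ay; rewrite /A /= mulrBr mulrBl; apply: DD => //; exact: DN.
- by move=> x y [Fx Ax] [Fy Ay]; split; rewrite ?rpredD // scalerDl rpredD.
- move=> x Ux; rewrite /A /=.
  have := IH (x :: s) (i - l)%N; rewrite big_cons /= addSn -addnS => /(_ sz_s).
  have -> : disc * (x ^+ 2 * \prod_(j0 <- s) j0 ^+ 2) = disc * \prod_(x0 <- s) x0 ^+ 2 * x ^+ 2 by ring.
  by apply=> y; rewrite inE => /orP[/eqP->|/Us].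
Qed.
End RelDiscPoly.

(** * Absolute values *)

Definition is_absval (R : realType) (w : algC -> R) : Prop :=
  [/\ forall x, 0 <= w x, forall x, w x = 0 <-> x = 0,
      {morph w : x y / x * y} & forall x y, w (x + y) <= w x + w y].

Section AbsVal.
Variables (R : realType) (w : algC -> R).
Hypothesis abs_w : is_absval w.

Lemma absval_ge0 x : 0 <= w x. Proof. by case: abs_w. Qed.
Lemma absval0 : w 0 = 0. Proof. by case: abs_w => _ h _ _; apply/h. Qed.
Lemma absval_eq0 x : (w x == 0) = (x == 0).
Proof. by case: abs_w => _ h _ _; apply/eqP/eqP => /h. Qed.
Lemma absvalM : {morph w : x y / x * y}. Proof. by case: abs_w. Qed.
Lemma absvalD x y : w (x + y) <= w x + w y. Proof. by case: abs_w. Qed.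

Lemma absval1 : w 1 = 1.
Proof.
have nz : w 1 != 0 by rewrite absval_eq0 oner_eq0.
by apply: (mulfI nz); rewrite -absvalM !mulr1.
Qed.

Lemma absvalX x n : w (x ^+ n) = w x ^+ n.
Proof. by elim: n => [|n IH]; rewrite ?expr0 ?absval1 // !exprS absvalM IH. Qed.

Lemma absvalN x : w (- x) = w x.
Proof.
apply/eqP; rewrite -(@eqrXn2 _ 2) ?absval_ge0 //.
by rewrite -!absvalX sqrrN.
Qed.

Lemma absval_prod (I : Type) (s : seq I) (P : pred I) (F : I -> algC) :
  w (\prod_(i <- s | P i) F i) = \prod_(i <- s | P i) w (F i).
Proof. exact: (big_morph w absvalM absval1). Qed.

Lemma absval_sum (I : Type) (s : seq I) (P : pred I) (F : I -> algC) :
  w (\sum_(i <- s | P i) F i) <= \sum_(i <- s | P i) w (F i).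
Proof.
apply: (big_ind2 (fun x y => w x <= y)) => // [|x y x' y' h h'].
  by rewrite absval0.
by apply: le_trans (absvalD _ _) _; rewrite lerD.
Qed.

Lemma le1_max1 (x : R) : 1 <= Num.max 1 x.
Proof. by rewrite le_max lexx. Qed.

Lemma max1_gt0 (x : R) : 0 < Num.max 1 x.
Proof. exact: lt_le_trans (le1_max1 x). Qed.

(** Leibniz expansion: each of the [d!] terms contains each [x k] to a power at most [d - 1]. The
    estimate holds for any absolute value. *)
Lemma absval_det_vdm d (x : 'I_d -> algC) :
  w (\det (\matrix_(k < d, j < d) x k ^+ j)) <=
    (d`!)%:R * (\prod_k Num.max 1 (w (x k))) ^+ d.-1.
Proof.
apply: le_trans (absval_sum _ _ _) _.
apply: (@le_trans _ _ (\sum_(s : 'S_d) (\prod_k Num.max 1 (w (x k))) ^+ d.-1)); last first.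
  by rewrite big_const card_Sn iter_addr addr0 mulr_natl.
apply: ler_sum => s _; rewrite absvalM absvalX absvalN absval1 expr1n mul1r.
rewrite absval_prod -prodrXl; apply: ler_prod => k _; rewrite mxE absvalX.
rewrite exprn_ge0 ?absval_ge0 //=.
apply: (@le_trans _ _ (Num.max 1 (w (x k)) ^+ s k)).
  by apply: lerXn2r; rewrite ?nnegrE ?absval_ge0 ?(ltW (max1_gt0 _)) // le_max lexx orbT.
apply: ler_weXn2l; first exact: le1_max1.
by rewrite -ltnS prednK // (leq_ltn_trans _ (ltn_ord k)).
Qed.

End AbsVal.

(** * The discriminant bound *)

Lemma polyOver_monic_factor (F : sfield) (q f : {poly algC}) : f \is monic ->
  f \is a polyOver (in_sf F) -> q * f \is a polyOver (in_sf F) ->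
  q \is a polyOver (in_sf F).
Proof.
move=> mon_f Ff; have [n] := ubnP (size q); elim: n q => // n IHn q sz_q Fqf.
have [->|nz_q] := eqVneq q 0; first exact: rpred0.
pose m := (size q).-1; pose q' := q - lead_coef q *: 'X^m.
have Fc : lead_coef q \in in_sf F.
  by rewrite -(lead_coef_Mmonic q mon_f) lead_coefE; move/polyOverP: Fqf.
have FcX : lead_coef q *: 'X^m \is a polyOver (in_sf F).
  by rewrite polyOverZ // polyOverXn.
have sz_q' : (size q' < size q)%N.
  have sz_gt0 : (0 < size q)%N by rewrite size_poly_gt0.
  rewrite -[X in (_ < X)%N](prednK sz_gt0) ltnS; apply/leq_sizeP => j le_mj.
  rewrite coefB coefZ coefXn; move: le_mj; rewrite leq_eqVlt => /orP[/eqP<-|lt].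
    by rewrite eqxx mulr1 lead_coefE subrr.
  rewrite (gtn_eqF lt) mulr0 subr0; apply: nth_default.
  by move: lt; rewrite prednK.
have Fq' : q' \is a polyOver (in_sf F).
  apply: IHn; first exact: leq_trans sz_q' _.
  by rewrite /q' mulrBl rpredB // rpredM.
by rewrite -[q](subrK (lead_coef q *: 'X^m)) rpredD.
Qed.

Lemma rat_poly (p : {poly algC}) : p \is a polyOver Crat -> exists q, p = pQtoC q.
Proof.
move=> /polyOverP Qp; have /choice[r Dr] : forall i, exists r : rat, p`_i = ratr r.
  by move=> i; apply/CratP.
exists (\poly_(i < size p) r i).
apply/polyP=> i; rewrite coef_map coef_poly Dr; case: ltnP => // le.
by rewrite -Dr nth_default // raddf0.
Qed.

(** Each root of [p] is conjugate to [a] and has the same minimal polynomial, which therefore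
    divides [p]; dividing it out gives the induction. *)
Lemma monic_power_minCpoly (a : algC) (p : {poly algC}) :
  p \is monic -> p \is a polyOver Crat ->
  (forall y, root p y -> root (minCpoly a) y) -> exists k, p = minCpoly a ^+ k.
Proof.
move=> + /rat_poly[q Dq]; rewrite {p}Dq; have [n] := ubnP (size q).
have [qa [Dqa mon_qa] dvqa] := minCpolyP a.
elim: n q => // n IHn q sz_q; rewrite map_monic => mon_q roots_q.
have [sz1|gt1] := leqP (size q) 1.
  exists 0%N; rewrite expr0; have : lead_coef q = 1 by exact/monicP.
  by rewrite (size1_polyC sz1) lead_coefC => ->; rewrite map_polyC /= rmorph1.
have [y qy] : exists y, root (pQtoC q) y.
  by apply/closed_rootP; rewrite size_map_poly gtn_eqF.
have [nu Dnu] := minCpoly_conj_aut (roots_q y qy).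
have : qa %| q.
  have [qy' [Dqy _] dvqy] := minCpolyP y.
  have <- : qy' = qa by apply: (map_poly_inj (ratr : {rmorphism rat -> algC})); rewrite /= -Dqa -Dqy -Dnu minCpoly_aut.
  by rewrite -dvqy.
case/dvdpP => t Dt.
have mon_t : t \is monic by rewrite -(monicMr _ mon_qa) -Dt.
have sz_qa : (1 < size qa)%N by rewrite -(size_map_poly (ratr : {rmorphism rat -> algC})) -Dqa size_minCpoly.
have [|||k Dk] := IHn t.
- have aux (u v w : nat) : ((u + v).-1 < w.+1 -> 1 < v -> 0 < u -> u < w)%N by lia.
  move: sz_q; rewrite Dt size_Mmonic // ?monic_neq0 // => /aux; apply=> //.
  by rewrite size_poly_gt0 monic_neq0.
- by rewrite map_monic.
- by move=> x tx; apply: roots_q; rewrite Dt rmorphM rootM tx.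
by exists k.+1; rewrite Dt rmorphM /= Dk exprSr Dqa.
Qed.

Section Norm.
Variables (F : sfield) (m : nat) (nu : 'I_m -> {rmorphism algC -> algC}) (z : algC).
Hypothesis emb : embeddings F nu z.

Lemma aut_ext_eq (mu mu' : {rmorphism algC -> algC}) x :
  mu z = mu' z -> x \in in_sf F -> mu x = mu' x.
Proof.
have [DF _ _ _] := emb; move=> muz; rewrite DF => /adjP[p /polyOverP Qp ->].
rewrite -!horner_map muz; congr _.[_]; apply/polyP=> i; rewrite !coef_map /=.
by rewrite !aut_Qsf.
Qed.

Lemma norm_poly_rat (p : {poly algC}) : p \is a polyOver (in_sf F) ->
  \prod_k map_poly (nu k) p \is a polyOver Crat.
Proof.
move=> /polyOverP Fp; have [DF _ Dz inj_nu] := emb.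
apply/polyOverP => i; apply: fixed_by_auts_rat => mu.
suff HP : map_poly mu (\prod_k map_poly (nu k) p) = \prod_k map_poly (nu k) p.
  by rewrite -[in RHS]HP coef_map.
rewrite rmorph_prod /=.
have /choice[pi Dpi] : forall k : 'I_m, exists l, mu (nu k z) = nu l z.
  move=> k; have : root (minCpoly z) (mu (nu k z)).
    by rewrite -(minCpoly_aut (nu k)) -(minCpoly_aut mu) root_minCpoly.
  rewrite Dz; rewrite /root horner_prod prodf_seq_eq0 => /hasP[l _].
  by rewrite hornerXsubC subr_eq0 => /eqP; exists l.
(* An automorphism of [algC] permutes the embeddings of [F], hence fixes the norm. *)
have inj_pi : injective pi.
  move=> k l e; apply: inj_nu; apply: (fmorph_inj mu).
  by rewrite !Dpi e.
rewrite [RHS](reindex_inj inj_pi); apply: eq_bigr => k _.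
rewrite -map_poly_comp; apply/polyP=> j; rewrite !coef_map_id0 ?raddf0 //.
by apply: (@aut_ext_eq (mu \o nu k) (nu (pi k))); rewrite //= Dpi.
Qed.

End Norm.

Section Bound.
Variables (F : sfield) (m : nat) (nu : 'I_m -> {rmorphism algC -> algC}) (z : algC).
Hypothesis emb : embeddings F nu z.
Variables (a : algC) (f : {poly algC}) (d : nat) (r : 'I_d -> algC).
Hypotheses (min_f : is_minpoly F a f) (fE : f = \prod_k ('X - (r k)%:P))
  (inj_r : injective r).

Lemma norm_minpoly : exists k, \prod_l map_poly (nu l) f = minCpoly a ^+ k.
Proof.
have [mon_f Ff fa min] := min_f.
apply: monic_power_minCpoly.
- by rewrite monic_prod // => l _; rewrite map_monic.
- exact: norm_poly_rat emb _ Ff.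
- move=> y; rewrite /root horner_prod prodf_seq_eq0 => /hasP[l _].
  rewrite fE rmorph_prod horner_prod prodf_seq_eq0 => /hasP[i _] /=.
  rewrite map_polyXsubC hornerXsubC subr_eq0 => /eqP ->.
  have : root (minCpoly a) (r i).
    have [t ->] := dvdpP _ _ (min _ (polyOver_minCpoly F a) (root_minCpoly a)).
    by rewrite rootM fE /root horner_prod [X in _ || (X == 0)](bigD1 i) //= hornerXsubC subrr mul0r eqxx orbT.
  rewrite -(fmorph_root (nu l)).
  have [q [-> _] _] := minCpolyP a.
  by rewrite -map_poly_comp (eq_map_poly (fmorph_rat (nu l))).
Qed.

Variables (R : realType) (w : algC -> R).
Hypotheses (abs_w : is_absval w) (w_int : forall n : int, w n%:~R = `|n|%:~R).

Lemma rel_disc_norm_bound (g : {poly int}) (rs : seq algC) (X : R) :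
  zcontents g = 1 -> pZtoC g = (lead_coef g)%:~R *: minCpoly a ->
  minCpoly a = \prod_(y <- rs) ('X - y%:P) ->
  `|lead_coef g|%:~R * \prod_(y <- rs) Num.max 1 (w y) <= X ^+ size rs ->
  1 <= X ->
  (ideal_norm (scar F) (rel_disc (scar F) (scar (adj F a))))%:R <=
    (4 * X ^+ 2) ^+ (m * d * d).
Proof.
move=> cg Dg Drs leX X1; have [mon_f Ff fa min] := min_f.
have [k Dk] := norm_minpoly.
have nz_lg : lead_coef g != 0 by rewrite lead_coef_eq0 -zcontents_eq0 cg.
have sz_ma : size (minCpoly a) = (size rs).+1 by rewrite Drs size_prod_XsubC.
(* Degrees in the equality of the norm of [f] with [minCpoly a ^+ k]. This identity later trades the
   exponent [deg a] of the height for [m d]. *)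
have kE : (k * size rs = m * d)%N.
  have := congr1 (fun p : {poly algC} => (size p).-1) Dk.
  rewrite [in RHS]size_exp sz_ma size_prod; last first.
    by move=> l _; rewrite map_poly_eq0 monic_neq0.
  under eq_bigr do rewrite size_map_poly (size_minpoly_roots fE).
  rewrite sum_nat_const card_ord /=; nia.
have d_gt0 := minpoly_degree_gt0 min_f fE.
have le_d : (d <= size rs)%N.
  have := dvdp_leq _ (min _ (polyOver_minCpoly F a) (root_minCpoly a)).
  by rewrite minCpoly_eq0 sz_ma (size_minpoly_roots fE) ltnS; apply.
have le_km : (k <= m)%N by move: kE le_d d_gt0; clear; nia.
pose G := pZtoC g.
have f_dv_G : f %| G.
  by rewrite /G Dg dvdpZr ?intr_eq0 //; apply: min; rewrite ?polyOver_minCpoly ?root_minCpoly.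
have [psi Dpsi] := dvdpP _ _ f_dv_G.
have FG : G \is a polyOver (in_sf F) by apply/polyOverP => i; rewrite coef_map rpred_int.
have Fpsi : psi \is a polyOver (in_sf F).
  by apply: polyOver_monic_factor mon_f Ff _; rewrite -Dpsi.
have AG : psi * f \is a polyOver Aint.
  by rewrite -Dpsi; apply/polyOverP => i; rewrite coef_map Aint_int.
pose disc := \det (vdm r) ^+ 2.
pose phi := disc *: psi ^+ (2 * d.-1).
have Dphi i : rel_disc (scar F) (scar (adj F a)) phi`_i.
  apply: (coef_disc_psi min_f fE inj_r) => j; split.
    by move/polyOverP: Fpsi.
  exact: Aint_coefZ_factor.
have nz_G : G != 0 by rewrite /G map_poly_eq0_id0 ?intr_eq0 // -lead_coef_eq0.
have nz_psi : psi != 0 by apply: contraNneq nz_G => p0; rewrite Dpsi p0 mul0r.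
have nz_phi : phi != 0.
  rewrite scaler_eq0 negb_or expf_neq0 // -?unitfE -?unitmxE ?vdm_unit //.
  by rewrite expf_neq0.
(* The norms of [psi] and [f] multiply to [G ^+ m], and the norm of [f] is [minCpoly a ^+ k], where
   [minCpoly a] is [G] up to its leading coefficient. *)
have norm_psi : \prod_l map_poly (nu l) psi = (lead_coef g)%:~R ^+ k *: G ^+ (m - k).
  have nz_ma : minCpoly a ^+ k != 0 by rewrite expf_neq0 // minCpoly_eq0.
  apply: (mulIf nz_ma); rewrite -{1}Dk -big_split /=.
  under eq_bigr => l _.
    rewrite -rmorphM /= -Dpsi /G -map_poly_comp (@eq_map_poly _ _ _ intr); last first.
      by move=> n; rewrite /= rmorph_int.
    over.
  rewrite prodr_const card_ord -/G -{1}(subnK le_km) exprD -scalerAl scalerAr; congr (_ * _).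
  by rewrite [in LHS]/G Dg exprZn.
pose N := \prod_l nu l disc.
pose c := N * (lead_coef g)%:~R ^+ (k * (2 * d.-1)).
have norm_phi : \prod_l map_poly (nu l) phi = c *: pZtoC (g ^+ ((m - k) * (2 * d.-1))).
  rewrite rmorphXn /= -/G.
  transitivity (\prod_l ((nu l disc)%:P * map_poly (nu l) psi ^+ (2 * d.-1))).
    apply: eq_bigr => l _; rewrite /phi map_polyZ /= mul_polyC; congr (_ *: _).
    exact: rmorphXn.
  rewrite big_split /= prodrXl norm_psi -rmorph_prod /= exprZn -!exprM mul_polyC.
  by rewrite scalerA.
have [|n [Dn le_n]] := ideal_norm_le_content emb (rel_disc_ideal min_f fE inj_r) Dphi _ nz_phi norm_phi.
  elim: (_ * _)%N => [|i IH]; first by rewrite expr0 zcontents_monic // monic1.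
  by rewrite exprS zcontentsM cg IH mul1r.
have le1 : (ideal_norm (scar F) (rel_disc (scar F) (scar (adj F a))))%:R <= w c.
  by rewrite Dn w_int -abszE -pmulrn ler_nat.
apply: le_trans le1 _.
pose M := \prod_(y <- rs) Num.max 1 (w y).
have M1 : 1 <= M by rewrite /M; elim/big_ind: _ => // [x y|y _]; [exact: mulr_ege1 | exact: le1_max1].
(* By factorization of the norm of [f], the numbers [nu l (r i)] are the conjugates of [a], each
   taken [k] times. *)
have prodM : \prod_l \prod_i Num.max 1 (w (nu l (r i))) = M ^+ k.
  pose L := [seq nu l (r i) | l <- enum 'I_m, i <- enum 'I_d].
  have pL : perm_eq L (flatten (nseq k rs)).
    apply: prod_XsubC_eq; rewrite [RHS]big_flatten big_nseq /L big_allpairs_dep.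
    rewrite big_enum /=; under eq_bigr do rewrite big_enum /=.
    rewrite -Drs iter_mulr mulr1 -Dk; apply: eq_bigr => l _.
    by rewrite fE rmorph_prod; apply: eq_bigr => i _; rewrite /= map_polyXsubC.
  transitivity (\prod_(y <- L) Num.max 1 (w y)).
    by rewrite /L big_allpairs_dep big_enum /=; apply: eq_bigr => l _; rewrite big_enum.
  by rewrite (perm_big _ pL) big_flatten big_nseq iter_mulr mulr1.
have wN : w N <= (d`!)%:R ^+ (2 * m) * M ^+ (k * (2 * d.-1)).
  rewrite /N (absval_prod abs_w).
  apply: (@le_trans _ _ (\prod_l ((d`!)%:R * (\prod_i Num.max 1 (w (nu l (r i)))) ^+ d.-1) ^+ 2)).
    apply: ler_prod => l _; rewrite (absval_ge0 abs_w) /= rmorphXn (absvalX abs_w) /=.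
    have <- : \det (\matrix_(k0 < d, j < d) nu l (r k0) ^+ j) = nu l (\det (vdm r)).
      rewrite -det_map_mx; congr (\det _); apply/matrixP=> i j.
      by rewrite !mxE rmorphXn.
    apply: lerXn2r; rewrite ?nnegrE ?(absval_ge0 abs_w) //; last exact: absval_det_vdm.
    by rewrite mulr_ge0 // exprn_ge0 // prodr_ge0 // => i _; apply: ltW; exact: max1_gt0.
  rewrite prodrXl big_split /= prodr_const card_ord prodrXl prodM exprMn -!exprM.
  by rewrite [(m * 2)%N]mulnC [(d.-1 * 2)%N]mulnC.
have wc : w c <= (d`!)%:R ^+ (2 * m) * (X ^+ size rs) ^+ (k * (2 * d.-1)).
  rewrite /c absvalM // (absvalX abs_w) w_int.
  apply: (@le_trans _ _ ((d`!)%:R ^+ (2 * m) * M ^+ (k * (2 * d.-1)) * `|lead_coef g|%:~R ^+ (k * (2 * d.-1)))).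
    by rewrite ler_wpM2r // exprn_ge0 // ler0z.
  rewrite -mulrA ler_wpM2l ?exprn_ge0 // -exprMn.
  apply: lerXn2r; rewrite ?nnegrE //; last by rewrite mulrC.
    by rewrite mulr_ge0 ?ler0z // (le_trans _ M1).
  by rewrite exprn_ge0 // (le_trans _ X1).
apply: le_trans wc _; rewrite -exprM mulnA [(size rs * k)%N]mulnC kE.
rewrite exprMn -[X in _ <= _ * X]exprM ler_pM ?exprn_ge0 //.
- by rewrite (le_trans _ X1).
(* From [d! <= d^d] and [d < 2^d]; the power [2 * m] then gives [4^(m d^2)]. *)
- have le_fact : (d`! <= 2 ^ (d * d))%N.
    have h : (d`! <= d ^ d)%N.
      rewrite -ffactnn ffact_prod -[X in (_ <= _ ^ X)%N]card_ord -prod_nat_const.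
      by apply: leq_prod => i _; rewrite leq_subr.
    apply: leq_trans h _; rewrite expnM leq_exp2r // ltnW // ltn_expl //.
  have -> : (4 : R) = 2 ^+ 2 by ring.
  rewrite -exprM.
  apply: (@le_trans _ _ ((2 ^ (d * d))%:R ^+ (2 * m))).
    by apply: lerXn2r; rewrite ?nnegrE // ler_nat.
  rewrite natrX -exprM; apply: ler_weXn2l; first by rewrite ler1n.
  by have -> : (d * d * (2 * m) = 2 * (m * d * d))%N by ring.
- apply: ler_weXn2l => //.
  have -> : (m * d * (2 * d.-1) = 2 * (m * d * d.-1))%N by ring.
  by rewrite !leq_mul // leq_pred.
Qed.
End Bound.

(** * Extending the absolute values of the rationals *)

Lemma maximal_subring (c : algC) : (forall n : int, n%:~R <> c) ->
  exists V : subringClosed algC, c \notin V /\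
    forall W : subringClosed algC, {subset V <= W} -> c \notin W -> {subset W <= V}.
Proof.
move=> nint_c.
(* The ring laws are asked of nonempty sets only, because the union of the empty chain is empty. A
   maximal [A] is nonempty since the integers avoid [c]. *)
pose P (A : set algC) := ~ A c /\ (A !=set0 ->
  [/\ A 1, forall x y, A x -> A y -> A (x - y) & forall x y, A x -> A y -> A (x * y)]).
have [F FP totF|A [[Ac Asub] maxA]] := @Zorn_bigcup algC P.
  split=> [[X FX Xc]|[x0 [X0 FX0 X0x0]]]; first by have [] := FP X FX.
  have big X Y : F X -> F Y -> exists Z, [/\ F Z, X `<=` Z & Y `<=` Z].
    move=> FX FY; have [XY|YX] := totF X Y FX FY; first by exists Y; split.
    by exists X; split.
  have sub X x : F X -> X x -> [/\ X 1, forall x y, X x -> X y -> X (x - y) &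
      forall x y, X x -> X y -> X (x * y)].
    by move=> FX Xx; case: (FP X FX) => _; apply; exists x.
  split.
  - by exists X0 => //; case: (sub _ _ FX0 X0x0).
  - move=> x y [X FX Xx] [Y FY Yy]; have [Z [FZ XZ YZ]] := big X Y FX FY.
    by exists Z => //; case: (sub _ _ FZ (XZ _ Xx)) => _ h _; apply: h; [exact: XZ | exact: YZ].
  - move=> x y [X FX Xx] [Y FY Yy]; have [Z [FZ XZ YZ]] := big X Y FX FY.
    by exists Z => //; case: (sub _ _ FZ (XZ _ Xx)) => _ _ h; apply: h; [exact: XZ | exact: YZ].
have ne_A : A !=set0.
  apply: contrapT => /nonemptyPn A0.
  apply: (maxA [set x | exists n : int, n%:~R = x]).
    by rewrite A0; split=> // /(_ 0); apply; exists 0.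
  split=> [[n /nint_c]|_] //; split; first by exists 1.
  - by move=> x y [n <-] [k <-]; exists (n - k); rewrite rmorphB.
  - by move=> x y [n <-] [k <-]; exists (n * k); rewrite rmorphM.
have {Asub} [A1 AB AM] := Asub ne_A.
pose S : {pred algC} := fun x => x \in A.
have SP x : reflect (A x) (x \in S) by apply: (iffP idP) => [/set_mem|/mem_set].
have Sring : subring_closed S.
  by split=> [|x y /SP Ax /SP Ay|x y /SP Ax /SP Ay]; apply/SP; [|exact: AB|exact: AM].
pose SM := GRing.isSubringClosed.Build _ S Sring.
pose V : subringClosed algC := HB.pack S SM.
exists V; split; first by apply/SP.
move=> W VW Wc x Wx; apply: contraT => nVx; exfalso.
apply: (maxA [set y | y \in W]).
  split=> [y /SP/VW|] //.
  by move=> /(_ x Wx) Ax; move/SP: nVx; exact.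
split=> /=; first exact/negP.
by move=> _; split=> [|y t Wy Wt|y t Wy Wt] /=; rewrite ?rpred1 ?rpredB ?rpredM.
Qed.

Lemma expf_subn (K : fieldType) (x : K) i n : x != 0 -> (i <= n)%N ->
  x ^+ (n - i) = x ^+ n * x^-1 ^+ i.
Proof.
move=> nz le; rewrite -[in RHS](subnK le) exprD -mulrA -exprMn divff //.
by rewrite expr1n mulr1.
Qed.

(* Any ring maximal among those that do not contain [p^-1] is a valuation ring. *)
Lemma padic_valuation_ring (p : nat) : prime p ->
  exists V : subringClosed algC, [/\ p%:R^-1 \notin V,
    forall x, x \in V \/ x^-1 \in V & forall x, exists k, p%:R ^+ k * x \in V].
Proof.
move=> pr_p; have p_gt1 := prime_gt1 pr_p.
have nz_p : (p%:R : algC) != 0 by rewrite pnatr_eq0 -lt0n prime_gt0.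
have [n en|V [Vp maxV]] := @maximal_subring p%:R^-1.
  have : (n * p%:Z)%:~R = 1 :> algC by rewrite rmorphM /= en -pmulrn mulVf.
  move/eqP; rewrite -(rmorph1 intr) eqr_int => /eqP/(congr1 absz).
  by rewrite abszM => /eqP; rewrite muln_eq1 => /andP[_]; rewrite absz_nat => /eqP p1; rewrite p1 in p_gt1.
have Vp1 : (p%:R : algC) \in V by rewrite rpred_nat.
(* By maximality [V[x]] contains [p^-1]. *)
have adjV x : x \notin V -> exists2 P, P \is a polyOver V & p%:R * P.[x] = 1.
  move=> nVx.
  pose W : {pred algC} := fun y => `[< exists2 P, P \is a polyOver V & y = P.[x] >].
  have WP y : reflect (exists2 P, P \is a polyOver V & y = P.[x]) (y \in W) by exact: asboolP.
  have Wring : subring_closed W.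
    split=> [|y t /WP[P VP ->] /WP[Q VQ ->]|y t /WP[P VP ->] /WP[Q VQ ->]]; apply/WP.
    - by exists 1; rewrite ?rpred1 // hornerC.
    - by exists (P - Q); rewrite ?rpredB // !hornerE.
    - by exists (P * Q); rewrite ?rpredM // !hornerE.
  pose WM := GRing.isSubringClosed.Build _ W Wring.
  pose Wc : subringClosed algC := HB.pack W WM.
  have VW : {subset V <= Wc} by move=> y Vy; apply/WP; exists y%:P; rewrite ?polyOverC ?hornerC.
  have /WP[P VP DP] : p%:R^-1 \in W.
    apply: contraT => nWp; have := maxV Wc VW nWp x; rewrite (negPf nVx).
    by move=> -> //; apply/WP; exists 'X; rewrite ?polyOverX ?hornerX.
  by exists P => //; rewrite -DP divff.
(* Otherwise [p P(u^-1) = 1] for some [P] over [V]. Multiplying by a power of [u], which is 1 modulo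
   [p], puts [p^-1] in [V]. *)
have Vunit t : t \in V -> (1 + p%:R * t)^-1 \in V.
  move=> Vt; apply: contraT => nVu; set u := 1 + p%:R * t in nVu.
  have Vu : u \in V by rewrite rpredD ?rpred1 ?rpredM.
  have nz_u : u != 0.
    apply: contraNneq Vp => u0; suff -> : p%:R^-1 = - t by rewrite rpredN.
    apply: (mulfI nz_p); rewrite divff // mulrN; apply/eqP.
    by rewrite -addr_eq0; apply/eqP.
  have [P VP DP] := adjV _ nVu.
  have [s Vs Ds] : exists2 s, s \in V & u ^+ (size P) = 1 + p%:R * s.
    elim: (size P) => [|n [s Vs Ds]]; first by exists 0; rewrite ?rpred0 // mulr0 addr0.
    exists (s + t + p%:R * t * s); first by rewrite !rpredD ?rpredM.
    by rewrite exprS Ds /u; ring.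
  suff : p%:R^-1 \in V by rewrite (negPf Vp).
  have -> : p%:R^-1 = u ^+ size P * P.[u^-1] - s.
    apply: (mulfI nz_p); rewrite divff // mulrBr mulrCA DP mulr1 Ds; ring.
  rewrite rpredB // horner_coef mulr_sumr rpred_sum // => i _.
  have -> : u ^+ size P * (P`_i * u^-1 ^+ i) = P`_i * u ^+ (size P - i).
    by rewrite mulrCA expf_subn // ltnW.
  by rewrite rpredM ?rpredX //; move/polyOverP: VP.
have Vval x : x \in V \/ x^-1 \in V.
  pose good x n := `[< exists P, [/\ P \is a polyOver V, (size P <= n.+1)%N & p%:R * P.[x] = 1] >].
  have ex_good y : y \notin V -> exists n, good y n.
    move=> /adjV[P VP DP]; exists (size P); apply/asboolP; exists P; split=> //; exact: leqnSn.
  (* The relation for [y^-1], multiplied by [y^n], expresses a unit times [y^n] by lower powers of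
     [y]; this eliminates the top term of the relation for [y]. Minimal degrees for [x] and [x^-1]
     are thereby contradictory. *)
  have key y n m : good y n -> good y^-1 m -> (m <= n)%N -> (0 < n)%N /\ good y n.-1.
    move=> /asboolP[P [VP szP DP]] /asboolP[Q [VQ szQ DQ]] le_mn.
    have n_gt0 : (0 < n)%N.
      rewrite lt0n; apply: contraNneq Vp => n0; move: szP DP; rewrite n0 => /size1_polyC ->.
      rewrite hornerC => e; have -> : p%:R^-1 = P`_0 by apply: (mulfI nz_p); rewrite divff.
      by move/polyOverP: VP.
    split=> //; have nz_y : y != 0.
      have m_gt0 : (0 < m)%N.
        rewrite lt0n; apply: contraNneq Vp => n0; move: szQ DQ; rewrite n0 => /size1_polyC ->.
        rewrite hornerC => e; have -> : p%:R^-1 = Q`_0 by apply: (mulfI nz_p); rewrite divff.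
        by move/polyOverP: VQ.
      apply: contraNneq Vp => y0; move: DP; rewrite y0 horner_coef0 => e.
      have -> : p%:R^-1 = P`_0 by apply: (mulfI nz_p); rewrite divff.
      by move/polyOverP: VP.
    pose R := \poly_(i < n) Q`_(n - i).
    have VR : R \is a polyOver V.
      apply/polyOverP=> i; rewrite coef_poly; case: ifP => _; rewrite ?rpred0 //.
      by move/polyOverP: VQ.
    have RE : (1 - p%:R * Q`_0) * y ^+ n = p%:R * R.[y].
      have DQ' : 1 = p%:R * Q`_0 + p%:R * \sum_(j < n) Q`_j.+1 * y^-1 ^+ j.+1.
        rewrite -{1}DQ (@horner_coef_wide _ n.+1); last by apply: leq_trans szQ _; rewrite ltnS.
        by rewrite big_ord_recl mulrDr expr0 mulr1.
      rewrite [X in (X - _) * _]DQ' addrAC subrr add0r -mulrA; congr (_ * _).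
      rewrite /R horner_poly [RHS](reindex_inj rev_ord_inj) /= mulr_suml; apply: eq_bigr => j _.
      have -> : (n - (n - j.+1) = j.+1)%N by have := ltn_ord j; lia.
      by rewrite -mulrA expf_subn // [_ * y ^+ n]mulrC.
    have Vu : (1 - p%:R * Q`_0)^-1 \in V.
      by rewrite -mulrN; apply: Vunit; rewrite rpredN; move/polyOverP: VQ.
    have nz_u : 1 - p%:R * Q`_0 != 0.
      apply: contraNneq Vp => /eqP; rewrite subr_eq0 => /eqP u0.
      have -> : p%:R^-1 = Q`_0 by apply: (mulfI nz_p); rewrite divff.
      by move/polyOverP: VQ.
    set u := (1 - _)^-1 in Vu.
    have yn : y ^+ n = u * (p%:R * R.[y]) by rewrite -RE mulKf.
    apply/asboolP; exists (take_poly n P + (P`_n * u * p%:R) *: R); split.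
    - rewrite rpredD //; last first.
        by rewrite polyOverZ // !rpredM //; move/polyOverP: VP.
      apply/polyOverP=> i; rewrite coef_take_poly; case: ifP => _; rewrite ?rpred0 //.
      by move/polyOverP: VP.
    - rewrite prednK // (leq_trans (size_polyD _ _)) // geq_max size_take_poly /=.
      by rewrite (leq_trans (size_scale_leq _ _)) // size_poly.
    - rewrite -[RHS]DP hornerD hornerZ; congr (_ * _).
      rewrite -!mulrA -yn (@horner_coef_wide _ n.+1 P) // big_ord_recr /=; congr (_ + _).
      rewrite (@horner_coef_wide _ n (take_poly n P)) ?size_take_poly //.
      by apply: eq_bigr => i _; rewrite coef_take_poly ltn_ord.
  apply: contrapT => /not_orP[/negP nVx /negP nVx'].
  have [n gn minn] := ex_minnP (ex_good _ nVx).
  have [m gm minm] := ex_minnP (ex_good _ nVx').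
  have [le|lt] := leqP m n.
    have [n_gt0 /minn] := key _ _ _ gn gm le.
    by rewrite leqNgt prednK // leqnn.
  rewrite -[x]invrK in gn.
  have [m_gt0 /minm] := key _ _ _ gm gn (ltnW lt).
  by rewrite leqNgt prednK // leqnn.
exists V; split=> // x.
(* A valuation ring is integrally closed: if [b^-1] is in [V], dividing the monic equation of [b] by
   a power of [b] writes [b] over [V]. *)
have AV b : b \in Aint -> b \in V.
  move=> Ab; have [//|Vb'] := Vval b.
  have [->|nz_b] := eqVneq b 0; first by rewrite rpred0.
  have /polyOverP Am : minCpoly b \is a polyOver Num.int by [].
  have VZ i : (minCpoly b)`_i \in V by have /intrP[n ->] := Am i; rewrite rpred_int.
  have mon := minCpoly_monic b; have := root_minCpoly b.
  have := size_minCpoly b; case Dn: (size (minCpoly b)) => [|[|n]] // _.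
  have lead1 : (minCpoly b)`_n.+1 = 1 by move/monicP: mon; rewrite lead_coefE Dn.
  rewrite /root horner_coef Dn big_ord_recr /= lead1 mul1r addrC addr_eq0 => /eqP bn.
  have -> : b = b ^+ n.+1 * b^-1 ^+ n by rewrite exprS -mulrA -exprMn divff // expr1n mulr1.
  rewrite bn mulNr rpredN mulr_suml rpred_sum // => i _.
  rewrite -mulrA rpredM //.
  have -> : b ^+ i * b^-1 ^+ n = b^-1 ^+ (n - i).
    by rewrite expf_subn ?invr_eq0 ?invrK 1?mulrC // -ltnS.
  by rewrite rpredX.
have [N nz_N ANx] := Aint_int_multiple x.
have [k [N' [co DN]]] : exists k N', coprime p N' /\ `|N|%N = (p ^ k * N')%N.
  have N_gt0 : (0 < `|N|)%N by rewrite absz_gt0.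
  by have [N' co DN] := pfactor_coprime pr_p N_gt0; exists (logn p `|N|), N'; rewrite mulnC.
exists k.
have Vabs : `|N|%N%:R * x \in V.
  have [->|->] : (`|N|%N%:R = N%:~R :> algC) \/ (`|N|%N%:R = - N%:~R :> algC).
    have [le|lt] := leP 0 N; [left|right]; rewrite -[_%:R]/(`|N|%N%:~R) abszE.
      by rewrite ger0_norm.
    by rewrite ltr0_norm // rmorphN.
  - exact: AV.
  - by rewrite mulNr rpredN; apply: AV.
have N'_gt0 : (0 < N')%N.
  by move: DN nz_N; rewrite -absz_eq0 => ->; rewrite muln_eq0 negb_or => /andP[_]; rewrite lt0n.
have nz_N' : (N'%:R : algC) != 0 by rewrite pnatr_eq0 -lt0n.
(* By Bezout, some multiple of [N'] is of the form [1 + p v], a unit of [V]. *)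
have VN' : N'%:R^-1 \in V.
  have [u v Duv _] := egcdnP p N'_gt0.
  rewrite coprime_sym /coprime in co; rewrite (eqP co) in Duv.
  have e : N'%:R * u%:R = 1 + p%:R * v%:R :> algC.
    by rewrite -!natrM -[1]/(1%:R) -natrD mulnC Duv addnC mulnC.
  have -> : N'%:R^-1 = u%:R * (1 + p%:R * v%:R)^-1 :> algC.
    rewrite -e invfM mulrCA divff ?mulr1 //.
    apply: contraNneq Vp => u0; move: e; rewrite u0 mulr0 => /esym/eqP.
    rewrite addr_eq0 => /eqP e; have -> : p%:R^-1 = - v%:R :> algC.
      by apply: (mulfI nz_p); rewrite divff // mulrN -e.
    by rewrite rpredN rpred_nat.
  by rewrite rpredM ?rpred_nat // Vunit ?rpred_nat.
have -> : p%:R ^+ k * x = N'%:R^-1 * (`|N|%N%:R * x).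
  by rewrite DN natrM natrX [p%:R ^+ k * N'%:R]mulrC -mulrA mulKf.
by rewrite rpredM.
Qed.

(** * The archimedean absolute value with values in [R] *)

Section Archimedean.
Variable R : realType.

(** The image in [R] of a nonnegative real algebraic number, given by its Dedekind cut; it is
    applied to the values of the norm on [algC]. *)
Let iota (y : algC) : R := sup [set ratr q | q in [set q : rat | (ratr q : algC) <= y]].

Let iota_lb y q : (ratr q : algC) <= y -> ratr q <= iota y.
Proof.
move=> le_qy; apply: ub_le_sup; last by exists q.
have [N leN] : exists N : nat, y <= N%:R.
  have y_real : y \is Num.real by rewrite -(ler_real le_qy) Creal_Crat // Crat_rat.
  exists (Num.bound `|y|); apply: le_trans (real_ler_norm y_real) _.
  by apply/ltW/archi_boundP.
exists N%:R => _ [q' /= le_q'y <-].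
have : (ratr q' : algC) <= ratr N%:R by rewrite ratr_nat (le_trans le_q'y).
by rewrite ler_rat => le; rewrite -(ratr_nat R) ler_rat.
Qed.

Let iota_ub y q : 0 <= y -> y <= (ratr q : algC) -> iota y <= ratr q.
Proof.
move=> y_ge0 le_yq; apply: ge_sup; first by exists (ratr 0); exists 0 => //=; rewrite rmorph0.
move=> _ [q' /= le_q'y <-]; rewrite ler_rat -(ler_rat algC).
exact: le_trans le_yq.
Qed.

Let approx (y : algC) (e : rat) : 0 <= y -> 0 < e ->
  exists q : rat, [/\ 0 <= q, ratr q <= y & y <= ratr (q + e)].
Proof.
move=> y_ge0 e_gt0; have nz_e : (ratr e : algC) != 0 by rewrite fmorph_eq0 gt_eqF.
have e_gt0' : 0 < (ratr e : algC) by rewrite ltr0q.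
have ye_real : y / ratr e \is Num.real by rewrite ger0_real // divr_ge0 // ltW.
pose n := Num.floor (y / ratr e); exists (n%:~R * e); split.
- rewrite mulr_ge0 ?(ltW e_gt0) // ler0z real_floor_ge_int //.
  by rewrite divr_ge0 // ltW.
- rewrite rmorphM /= ratr_int -ler_pdivlMr //; exact: real_floor_le.
- rewrite -[e in _ + e]mul1r -mulrDl rmorphM rmorphD /= ratr_int rmorph1.
  rewrite -ler_pdivrMr // -intrD1; apply/ltW; exact: real_floorD1_gt.
Qed.

Let iota_eq (y : algC) (x : R) : 0 <= y ->
  (forall e : rat, 0 < e -> exists q1 q2 : rat, [/\ ratr q1 <= y, y <= ratr q2,
     ratr q1 <= x, x <= ratr q2 & q2 - q1 <= e]) -> iota y = x.
Proof.
move=> y_ge0 H; apply/eqP; rewrite -subr_eq0 -normr_le0; apply/ler_addgt0Pl => e e_gt0.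
rewrite addr0; have [q] := rat_in_itvoo e_gt0; rewrite in_itv /= => /andP[q_gt0 lt_qe].
have {}q_gt0 : 0 < q by rewrite -(ltr0q R).
have [q1 [q2 [h1 h2 h3 h4 h5]]] := H q q_gt0.
have := iota_lb h1; have := iota_ub y_ge0 h2; move=> i2 i1.
have h6 : (ratr q2 : R) - ratr q1 <= ratr q by rewrite -rmorphB ler_rat.
by rewrite ler_norml; apply/andP; split; lra.
Qed.

Lemma archimedean_absval : exists w : algC -> R,
  is_absval w /\ forall q : rat, w (ratr q) = `|ratr q|.
Proof.
have iota_rat q : 0 <= q -> iota (ratr q) = ratr q.
  move=> q_ge0; apply: iota_eq; first by rewrite ler0q.
  by move=> e e_gt0; exists q, q; rewrite !lexx subrr ltW.
have iota_ge0 y : 0 <= y -> 0 <= iota y.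
  by move=> y_ge0; rewrite -(rmorph0 (ratr : {rmorphism rat -> R})); apply: iota_lb; rewrite rmorph0.
have iotaD x y : 0 <= x -> 0 <= y -> iota (x + y) = iota x + iota y.
  move=> x0 y0; apply: iota_eq; first exact: addr_ge0.
  move=> e e_gt0; have e2_gt0 : 0 < e / 2 by rewrite divr_gt0.
  have [q [q0 qx xq]] := approx x0 e2_gt0; have [t [t0 ty yt]] := approx y0 e2_gt0.
  exists (q + t), ((q + e / 2) + (t + e / 2)); rewrite !(rmorphD _ (_ + _)) !(rmorphD _ q t).
  rewrite !lerD ?iota_lb ?iota_ub //; split=> //; lra.
have iotaM x y : 0 <= x -> 0 <= y -> iota (x * y) = iota x * iota y.
  move=> x0 y0; apply: iota_eq; first exact: mulr_ge0.
  move=> e e_gt0.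
  have [b [b0 _ xb]] := approx x0 ltr01; have [c [c0 _ yc]] := approx y0 ltr01.
  (* [B] bounds [q + t + h], as [q <= b + 1], [t <= c + 1] and [h <= 1]; the error of the product is
     [h * (q + t + h)], at most [e]. *)
  pose B := b + c + 3; pose h := Num.min 1 (e / B).
  have B_gt0 : 0 < B by rewrite /B; lra.
  have h_gt0 : 0 < h by rewrite lt_min ltr01 divr_gt0.
  have [q [q0 qx xq]] := approx x0 h_gt0; have [t [t0 ty yt]] := approx y0 h_gt0.
  exists (q * t), ((q + h) * (t + h)); rewrite !(rmorphM _ _ _).
  have le_qb : q <= b + 1 by rewrite -(ler_rat algC) (le_trans qx).
  have le_tc : t <= c + 1 by rewrite -(ler_rat algC) (le_trans ty).
  split.
  - by rewrite ler_pM // ler0q.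
  - by rewrite ler_pM.
  - by rewrite ler_pM ?ler0q ?iota_lb.
  - by rewrite ler_pM ?iota_ge0 ?iota_ub.
  - have -> : (q + h) * (t + h) - q * t = h * (q + t + h) by ring.
    apply: (@le_trans _ _ (h * B)).
      rewrite ler_wpM2l ?(ltW h_gt0) // /B.
      have : h <= 1 by rewrite ge_min lexx.
      lra.
    by rewrite -ler_pdivlMr // ge_min lexx orbT.
have iota_mono x y : 0 <= x -> x <= y -> iota x <= iota y.
  move=> x0 xy; have yx : 0 <= y - x by rewrite subr_ge0.
  by rewrite -[y](subrK x) addrC iotaD // lerDl iota_ge0.
exists (fun x => iota `|x|); split; last first.
  move=> q; rewrite -!ratr_norm iota_rat //.
split=> [x|x|x y|x y].
- exact: iota_ge0.
- split=> [x0|->]; last by rewrite normr0 -(rmorph0 (ratr : {rmorphism rat -> algC})) iota_rat // rmorph0.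
  apply/eqP/contraT => nz_x; have nx : `|x| != 0 by rewrite normr_eq0.
  have := iotaM `|x| `|x|^-1 (normr_ge0 _); rewrite invr_ge0 normr_ge0 x0 mul0r divff // => /(_ isT).
  rewrite -(rmorph1 (ratr : {rmorphism rat -> algC})) iota_rat // rmorph1 => /eqP.
  by rewrite oner_eq0.
- by rewrite normrM iotaM.
- by rewrite -iotaD //; apply: iota_mono => //; exact: ler_normD.
Qed.

End Archimedean.

(** * The absolute value of a valuation ring *)

Section Padic.
Variables (R : realType) (p : nat) (V : subringClosed algC).
Hypotheses (pr_p : prime p) (Vp : p%:R^-1 \notin V)
  (Vval : forall x, x \in V \/ x^-1 \in V)
  (Vpow : forall x, exists k, p%:R ^+ k * x \in V).

Let P : algC := p%:R.
Let nzP : P != 0. Proof. by rewrite pnatr_eq0 -lt0n prime_gt0. Qed.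

Let Pexp (r : int) (s : nat) : (P ^ r) ^+ s = P ^ (r * s%:Z).
Proof. by rewrite exprnP exprz_exp. Qed.

Let VPz (n : int) : P ^ n \in V -> 0 <= n.
Proof.
case: n => // n; rewrite NegzE -invr_expz => VPn; exfalso; move/negP: Vp; apply.
have -> : p%:R^-1 = P ^+ n * (P ^ n.+1)^-1.
  by rewrite -exprnP exprS invfM mulrCA divff ?mulr1 // expf_neq0.
by rewrite rpredM // rpredX // rpred_nat.
Qed.

(** [r / s] is in [S x] when the valuation of [x], normalized to be 1 at [p], is at least [r / s].
    The valuation [e] is recovered as the supremum. *)
Let S (x : algC) : set R :=
  [set t | exists (r : int) (s : nat), [/\ (0 < s)%N, t = r%:~R / s%:R & x ^+ s * P ^ (- r) \in V]].

Let S_neq0 x : S x !=set0.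
Proof.
have [k Vk] := Vpow x; exists ((- k%:Z)%:~R / 1%:R), (- k%:Z), 1%N; split=> //.
by rewrite opprK expr1 mulrC.
Qed.

(** Combining the two memberships cancels [x] and leaves a power of [p] in [V], whose exponent
    cannot be negative. *)
Let S_opp x t t' : x != 0 -> S x t -> S x^-1 t' -> t + t' <= 0.
Proof.
move=> nz_x [r [s [s0 -> Vr]]] [r' [s' [s'0 -> Vr']]].
have : P ^ (- (r * s'%:Z + r' * s%:Z)) \in V.
  have -> : P ^ (- (r * s'%:Z + r' * s%:Z)) =
      (x ^+ s * P ^ (- r)) ^+ s' * (x^-1 ^+ s' * P ^ (- r')) ^+ s.
    rewrite !exprMn -!exprM mulrACA [(s' * s)%N]mulnC -exprMn divff // expr1n mul1r.
    rewrite !Pexp -expfzDr //; congr (_ ^ _); ring.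
  by rewrite rpredM // rpredX.
move/VPz; rewrite oppr_ge0 => le.
rewrite addf_div ?pnatr_eq0 -?lt0n // ler_pdivrMr ?mulr_gt0 ?ltr0n // mul0r.
by rewrite -[s%:R]/(s%:Z%:~R) -[s'%:R]/(s'%:Z%:~R) -!rmorphM -rmorphD lerz0.
Qed.

Let S_bound x : x != 0 -> has_sup (S x).
Proof.
move=> nz_x; split; first exact: S_neq0.
have [t' St'] := S_neq0 x^-1; exists (- t') => t St.
by rewrite -subr_le0 opprK; apply: S_opp nz_x St St'.
Qed.

Let e (x : algC) : R := sup (S x).

Let e_ge x t : x != 0 -> S x t -> t <= e x.
Proof. by move=> /S_bound[_ ub] Sx; exact: ub_le_sup ub _ Sx. Qed.

Let e_le x b : (forall t, S x t -> t <= b) -> e x <= b.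
Proof. by move=> h; apply: ge_sup => //; exact: S_neq0. Qed.

Let S_mul x y t t' : S x t -> S y t' -> S (x * y) (t + t').
Proof.
move=> [r [s [s0 -> Vr]]] [r' [s' [s'0 -> Vr']]].
exists (r * s'%:Z + r' * s%:Z), (s * s')%N; split; first by rewrite muln_gt0 s0.
  by rewrite addf_div ?pnatr_eq0 -?lt0n // natrM rmorphD !rmorphM.
have -> : (x * y) ^+ (s * s') * P ^ (- (r * s'%:Z + r' * s%:Z)) =
      (x ^+ s * P ^ (- r)) ^+ s' * (y ^+ s' * P ^ (- r')) ^+ s.
  rewrite !exprMn -!exprM mulrACA [in y ^+ (s' * s)]mulnC; congr (_ * _).
  rewrite !Pexp -expfzDr //; congr (_ ^ _); ring.
by rewrite rpredM // rpredX.
Qed.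

Let eM_ge x y : x != 0 -> y != 0 -> e x + e y <= e (x * y).
Proof.
move=> nx ny; rewrite -lerBrDr; apply: e_le => t St; rewrite lerBrDr addrC -lerBrDr.
apply: e_le => t' St'; rewrite lerBrDr addrC; apply: e_ge; first by rewrite mulf_neq0.
exact: S_mul.
Qed.

Let eV x : x != 0 -> e x^-1 = - e x.
Proof.
move=> nx; have nx' : x^-1 != 0 by rewrite invr_eq0.
apply/eqP; rewrite eq_le; apply/andP; split.
  apply: e_le => t' St'; rewrite lerNr; apply: e_le => t St.
  by rewrite -subr_le0 opprK; apply: S_opp nx St St'.
(* A rational [q] strictly between would be comparable with the valuation: [x^(-s) p^(-r)] or its
   inverse lies in [V], where [q = r / s]. *)
rewrite leNgt; apply/negP => lt; have [q] := rat_in_itvoo lt.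
rewrite in_itv /= => /andP[lt1 lt2].
have qE : ratr q = (numq q)%:~R / (`|denq q|%N)%:R :> R.
  rewrite -[q in LHS]divq_num_den fmorph_div /= !ratr_int; congr (_ / _).
  by rewrite -[RHS]/((`|denq q|%N)%:Z%:~R) abszE gtr0_norm ?denq_gt0.
have d_gt0 : (0 < `|denq q|)%N by rewrite absz_gt0 denq_neq0.
have [Vx|Vx] := Vval (x^-1 ^+ `|denq q| * P ^ (- numq q)).
  have /(e_ge nx') : S x^-1 (ratr q) by exists (numq q), `|denq q|%N.
  by rewrite leNgt lt1.
have /(e_ge nx) : S x (- ratr q).
  exists (- numq q), `|denq q|%N; split=> //; first by rewrite qE rmorphN mulNr.
  by move: Vx; rewrite opprK invfM exprVn invrK invr_expz opprK.
by rewrite leNgt ltrNr lt2.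
Qed.

Let eM x y : x != 0 -> y != 0 -> e (x * y) = e x + e y.
Proof.
move=> nx ny; apply/eqP; rewrite eq_le eM_ge // andbT.
have nxy : x * y != 0 by rewrite mulf_neq0.
have ny' : y^-1 != 0 by rewrite invr_eq0.
by have := eM_ge nxy ny'; rewrite mulfK // eV // lerBlDr.
Qed.

Let e_ge0 x : x != 0 -> x \in V -> 0 <= e x.
Proof.
move=> nx Vx; apply: e_ge => //; exists 0, 1%N.
by rewrite mul0r oppr0 expr0z mulr1 expr1.
Qed.

Let eP : e P = 1.
Proof.
apply/eqP; rewrite eq_le; apply/andP; split.
  rewrite -[e P]opprK -eV // lerNl; apply: e_ge; first by rewrite invr_eq0.
  by exists (-1), 1%N; rewrite opprK expr1 expr1z mulVf // rpred1 divr1.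
apply: e_ge => //; exists 1, 1%N.
by split; rewrite ?divr1 ?expr1 ?exprN1 ?divff ?rpred1.
Qed.

Let add_self (t : R) : t = t + t -> t = 0.
Proof. by move=> h; lra. Qed.

Let eX x n : x != 0 -> e (x ^+ n) = n%:R * e x.
Proof.
move=> nx; elim: n => [|n IH].
  have := eM (oner_neq0 algC) (oner_neq0 algC); rewrite mulr1 expr0 mul0r; exact: add_self.
by rewrite exprS eM ?expf_neq0 // IH -natr1 mulrDl mul1r addrC.
Qed.

Let e1 : e 1 = 0.
Proof. by have := eX 0 (oner_neq0 algC); rewrite expr0 mul0r. Qed.

Let e_min x y : x != 0 -> y != 0 -> x + y != 0 -> Num.min (e x) (e y) <= e (x + y).
Proof.
have H u v : u != 0 -> v != 0 -> u + v != 0 -> v / u \in V -> e u <= e (u + v).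
  move=> nu nv nuv Vvu; have -> : u + v = u * (1 + v / u) by rewrite mulrDr mulr1 mulrC divfK.
  have nz : 1 + v / u != 0.
    by apply: contraNneq nuv => h; rewrite -[v](divfK nu) -[X in X + _]mul1r -mulrDl h mul0r.
  by rewrite eM // lerDl e_ge0 // rpredD ?rpred1.
move=> nx ny nxy; have [Vyx|] := Vval (y / x).
  by rewrite (le_trans _ (H _ _ nx ny nxy Vyx)) // ge_min lexx.
rewrite invfM invrK mulrC => Vxy; rewrite addrC in nxy *.
by rewrite (le_trans _ (H _ _ ny nx nxy Vxy)) // ge_min lexx orbT.
Qed.

Let eN x : x != 0 -> e (- x) = e x.
Proof.
move=> nx; have nN : (-1 : algC) != 0 by rewrite oppr_eq0 oner_neq0.
have : e (-1) = 0.
  by have := eM nN nN; rewrite mulrNN mulr1 e1 => /esym/eqP; rewrite -mulr2n mulrn_eq0 /= => /eqP.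
by rewrite -[- x]mulN1r eM // => h; rewrite h add0r.
Qed.

Let e_nat_ge0 (n : nat) : (0 < n)%N -> 0 <= e n%:R.
Proof. by move=> n_gt0; rewrite e_ge0 ?rpred_nat // pnatr_eq0 -lt0n. Qed.

(** In a Bezout relation [1 = u n - v p], a positive valuation of [n] would make that of 1
    positive. *)
Let e_coprime (n : nat) : coprime p n -> (0 < n)%N -> e n%:R = 0.
Proof.
move=> co n_gt0; have nz_n : (n%:R : algC) != 0 by rewrite pnatr_eq0 -lt0n.
have en_ge0 := e_nat_ge0 n_gt0.
apply/eqP; rewrite eq_le en_ge0 andbT leNgt; apply/negP => en_gt0.
have [u v Duv _] := egcdnP p n_gt0; rewrite coprime_sym /coprime in co.
rewrite (eqP co) in Duv.
have E : 1 = u%:R * n%:R + - (v%:R * P) :> algC.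
  by rewrite -natrM Duv natrD natrM; rewrite addrAC subrr add0r.
have u_gt0 : (0 < u)%N by case: u Duv {E} => //; rewrite mul0n addn1.
have nz_u : (u%:R : algC) != 0 by rewrite pnatr_eq0 -lt0n.
have eu := e_nat_ge0 u_gt0.
have [v0|v_gt0] := posnP v.
  by move: E; rewrite v0 mul0r subr0 => /(congr1 e); rewrite e1 eM // => /eqP; rewrite eq_sym gt_eqF // ltr_wpDl.
have nz_v : (v%:R : algC) != 0 by rewrite pnatr_eq0 -lt0n.
have ev := e_nat_ge0 v_gt0.
have nz1 : u%:R * n%:R != 0 :> algC by rewrite mulf_neq0.
have nz2 : - (v%:R * P) != 0 by rewrite oppr_eq0 mulf_neq0.
have := e_min nz1 nz2; rewrite -E oner_eq0 => /(_ isT).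
rewrite e1 ge_min eN ?mulf_neq0 // !eM // eP => /orP[]; rewrite leNgt.
  by rewrite ltr_wpDl.
by rewrite ltr_wpDl.
Qed.

Let w (x : algC) : R := if x == 0 then 0 else expR (- (ln p%:R * e x)).

Let w_neq0 x : x != 0 -> w x = expR (- (ln p%:R * e x)).
Proof. by rewrite /w => /negPf ->. Qed.

Let lnp_ge0 : 0 <= ln p%:R :> R.
Proof. by rewrite ln_ge0 // ler1n prime_gt0. Qed.

Let wM x y : w (x * y) = w x * w y.
Proof.
have [->|nx] := eqVneq x 0; first by rewrite /w mul0r eqxx mul0r.
have [->|ny] := eqVneq y 0; first by rewrite /w mulr0 eqxx mulr0.
by rewrite !w_neq0 ?mulf_neq0 // eM // mulrDr opprD expRD.
Qed.

Let w_max x y : w (x + y) <= Num.max (w x) (w y).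
Proof.
have w_ge0 t : 0 <= w t by rewrite /w; case: ifP => // _; exact: expR_ge0.
have [->|nx] := eqVneq x 0; first by rewrite add0r le_max lexx orbT.
have [->|ny] := eqVneq y 0; first by rewrite addr0 le_max lexx.
have [->|nxy] := eqVneq (x + y) 0; first by rewrite {1}/w eqxx le_max w_ge0.
rewrite !w_neq0 // le_max !ler_expR !lerN2; have := e_min nx ny nxy; rewrite ge_min.
by case/orP=> h; apply/orP; [left|right]; exact: ler_wpM2l.
Qed.

Let w_nat (n : nat) : (0 < n)%N -> w n%:R = (p%:R ^+ logn p n)^-1.
Proof.
move=> n_gt0; have [n' co Dn] := pfactor_coprime pr_p n_gt0.
have n'_gt0 : (0 < n')%N by move: n_gt0; rewrite Dn muln_gt0 => /andP[].
have nz_n' : (n'%:R : algC) != 0 by rewrite pnatr_eq0 -lt0n.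
rewrite [in LHS]Dn natrM natrX w_neq0 ?mulf_neq0 ?expf_neq0 //.
rewrite eM ?expf_neq0 // e_coprime // add0r -/P eX // eP mulr1 mulrC -mulr_natl.
rewrite expRN -mulr_natl mulr1 mulr_natl expRM_natl lnK //.
by rewrite posrE ltr0n prime_gt0.
Qed.

Lemma valuation_absval : exists w : algC -> R,
  [/\ is_absval w, forall x y, w (x + y) <= Num.max (w x) (w y) &
      forall q : rat, w (ratr q) = padic_abs R p q].
Proof.
exists w; split=> //; last first.
  have wN x : w (- x) = w x.
    by rewrite /w oppr_eq0; case: eqVneq => // nx; rewrite eN.
  have w_int (n : int) : n != 0 -> w n%:~R = (p%:R ^+ logn p `|n|)^-1.
    by case: n => [[|n]|n] // _; rewrite ?NegzE ?rmorphN ?wN ?abszN -?pmulrn w_nat.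
  move=> q; rewrite /padic_abs; case: eqVneq => [->|nz_q]; first by rewrite rmorph0 /w eqxx.
  have nzd : (denq q)%:~R != 0 :> algC by rewrite intr_eq0 denq_neq0.
  apply: (mulIf (x := w (denq q)%:~R)).
    by rewrite w_neq0 // gt_eqF // expR_gt0.
  rewrite -wM -{1}[q]divq_num_den fmorph_div /= !ratr_int divfK //.
  rewrite !w_int ?denq_neq0 ?numq_eq0 // mulrAC divff ?mul1r //.
  by rewrite expf_neq0 // pnatr_eq0 -lt0n prime_gt0.
split=> //.
- by move=> x; rewrite /w; case: ifP => // _; exact: expR_ge0.
- move=> x; split=> [|->]; last by rewrite /w eqxx.
  by rewrite /w; case: eqP => // _ /eqP; rewrite gt_eqF ?expR_gt0.
- move=> x y; apply: le_trans (w_max x y) _; rewrite ge_max lerDl lerDr.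
  by rewrite /w; case: ifP => _; case: ifP => _; rewrite ?expR_ge0 ?lexx.
Qed.
End Padic.

Lemma padic_absval (R : realType) (p : nat) : prime p -> exists w : algC -> R,
  [/\ is_absval w, forall x y, w (x + y) <= Num.max (w x) (w y) &
      forall q : rat, w (ratr q) = padic_abs R p q].
Proof.
by move=> pr_p; have [V [h1 h2 h3]] := padic_valuation_ring pr_p; exact: valuation_absval pr_p h1 h2 h3.
Qed.

(** * Places and local degrees *)

Lemma null_seqP (R : realType) (v : algC -> R) (u : nat -> algC) : (forall x, 0 <= v x) ->
  null_seq v u <-> forall e : R, 0 < e -> exists N, forall k, (N <= k)%N -> v (u k) < e.
Proof.
move=> v_ge0; split=> [/cvgrPdist_lt H e e_gt0|H].
  have [N _ HN] := H e e_gt0; exists N => k le_Nk; have := HN k le_Nk.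
  by rewrite /= sub0r normrN ger0_norm.
apply/cvgrPdist_lt => e e_gt0; have [N HN] := H e e_gt0; exists N => // k le_Nk.
by rewrite /= sub0r normrN ger0_norm // HN.
Qed.

Lemma cauchy_inP (R : realType) (E : set algC) (v : algC -> R) (u : nat -> algC) :
  cauchy_in E v u <-> (forall k, E (u k)) /\
    forall e : R, 0 < e -> exists N, forall k l, (N <= k)%N -> (N <= l)%N -> v (u k - u l) < e.
Proof.
split=> [[Eu H]|[Eu H]]; split=> // e e_gt0.
  have [[A B] /= [[N1 _ H1] [N2 _ H2]] sub] := H e e_gt0.
  exists (maxn N1 N2) => k l; rewrite !geq_max => /andP[k1 _] /andP[_ l2].
  by apply: (sub (k, l)); split; [exact: H1 | exact: H2].
have [N HN] := H e e_gt0; exists ([set k | N <= k]%N, [set k | N <= k]%N).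
  by split; exists N.
by move=> [k l] [/= ? ?]; exact: HN.
Qed.

Section Place.
Variables (R : realType) (E : sfield) (v : algC -> R).
Hypothesis pl_v : place (scar E) v.

Lemma place_ge0 x : 0 <= v x.
Proof.
have [[h _] _ _ _ out] := pl_v; have [/h//|/out ->] := pselect (scar E x).
by rewrite lexx.
Qed.

Lemma place_eq0 x : x \in in_sf E -> (v x == 0) = (x == 0).
Proof. by move=> /sfP Ex; have [[_ h] _ _ _ _] := pl_v; apply/eqP/eqP => /(h _ Ex). Qed.

Lemma place0 : v 0 = 0.
Proof. by apply/eqP; rewrite place_eq0 ?rpred0. Qed.

Lemma placeM x y : x \in in_sf E -> y \in in_sf E -> v (x * y) = v x * v y.
Proof. by move=> /sfP Ex /sfP Ey; have [_ h _ _ _] := pl_v; exact: h. Qed.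

Lemma placeD x y : x \in in_sf E -> y \in in_sf E -> v (x + y) <= v x + v y.
Proof. by move=> /sfP Ex /sfP Ey; have [_ _ h _ _] := pl_v; exact: h. Qed.

Lemma place_out x : x \notin in_sf E -> v x = 0.
Proof. by move=> /negP Ex; have [_ _ _ _ h] := pl_v; apply: h => /sfP. Qed.

Lemma place1 : v 1 = 1.
Proof.
have nz : v 1 != 0 by rewrite place_eq0 ?rpred1 // oner_eq0.
by apply: (mulfI nz); rewrite -placeM ?rpred1 // !mulr1.
Qed.

Lemma placeX x n : x \in in_sf E -> v (x ^+ n) = v x ^+ n.
Proof.
move=> Ex; elim: n => [|n IH]; rewrite ?expr0 ?place1 // !exprS placeM ?rpredX //.
by rewrite IH.
Qed.

Lemma placeN x : v (- x) = v x.
Proof.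
have [Ex|nEx] := boolP (x \in in_sf E); last first.
  by rewrite !place_out // rpredN.
apply/eqP; rewrite -(@eqrXn2 _ 2) ?place_ge0 //.
by rewrite -!placeX ?rpredN // sqrrN.
Qed.

Lemma placeV x : x \in in_sf E -> v x^-1 = (v x)^-1.
Proof.
move=> Ex; have [->|nz] := eqVneq x 0; first by rewrite invr0 place0 invr0.
have nzv : v x != 0 by rewrite place_eq0.
by apply: (mulfI nzv); rewrite -placeM ?rpredV // !divff // place1.
Qed.

Lemma place_sum (I : Type) (s : seq I) (P : pred I) (F : I -> algC) :
  (forall i, F i \in in_sf E) ->
  v (\sum_(i <- s | P i) F i) <= \sum_(i <- s | P i) v (F i).
Proof.
move=> EF; suff : (\sum_(i <- s | P i) F i) \in in_sf E /\
  v (\sum_(i <- s | P i) F i) <= \sum_(i <- s | P i) v (F i) by case.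
apply: (big_ind2 (fun x y => x \in in_sf E /\ v x <= y)) => // [|x y x' y' [Ex h] [Ex' h']].
  by rewrite rpred0 place0.
split; first by rewrite rpredD.
by apply: le_trans (placeD _ _) _; rewrite // lerD.
Qed.

Lemma ratr_in_sf (q : rat) : ratr q \in in_sf E.
Proof. by apply: rat_in_sf; exact: Crat_rat. Qed.

(** The family spans the completion of [E] over the completion of the rationals, expressed by
    approximation inside [E]. *)
Definition dense_family n (y : 'I_n -> algC) :=
  (forall i, y i \in in_sf E) /\ forall x, x \in in_sf E -> forall e : R, 0 < e ->
    exists q : 'I_n -> rat, v (x - \sum_i ratr (q i) * y i) < e.

(* A dense family of minimal size is linearly independent over [Q_v], quantitatively:
   otherwise one of its members is a limit of rational combinations of the others. *)
Lemma minimal_dense_family n (y : 'I_n -> algC) : dense_family y ->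
  (forall k (y' : 'I_k -> algC), dense_family y' -> (n <= k)%N) ->
  exists2 d : R, 0 < d & forall q : 'I_n -> rat, forall i,
    d * v (ratr (q i)) <= v (\sum_j ratr (q j) * y j).
Proof.
move=> [Ey dense_y] min_n.
have Esum m (q : 'I_m -> rat) (t : 'I_m -> algC) : (forall i, t i \in in_sf E) ->
    \sum_i ratr (q i) * t i \in in_sf E.
  by move=> Et; rewrite rpred_sum // => i _; rewrite rpredM ?ratr_in_sf.
suff H i : exists2 d : R, 0 < d & forall q : 'I_n -> rat,
    d * v (ratr (q i)) <= v (\sum_j ratr (q j) * y j).
  have /choice[d Hd] : forall i, exists d : R, 0 < d /\ forall q : 'I_n -> rat,
    d * v (ratr (q i)) <= v (\sum_j ratr (q j) * y j) by move=> i; have [d] := H i; exists d.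
  exists (\big[Num.min/1]_i d i).
    by apply: (big_ind (fun x => 0 < x)) => // [x z x0 z0|i _]; rewrite ?lt_min ?x0 //; case: (Hd i).
  move=> q i; have [_ /(_ q)] := Hd i; apply: le_trans.
  by rewrite ler_wpM2r ?place_ge0 // bigmin_le_cond.
apply: contrapT => noH.
have bad e : 0 < e -> exists q : 'I_n -> rat, v (\sum_j ratr (q j) * y j) < e * v (ratr (q i)).
  move=> e_gt0; apply: contrapT => no; apply: noH; exists e => // q.
  by rewrite leNgt; apply/negP => lt; apply: no; exists q.
case: n y Ey dense_y min_n i Esum noH bad => [|n] y Ey dense_y min_n i Esum noH bad; first by case: i {noH bad}.
have bad1 (e : R) : 0 < e -> exists q : 'I_n -> rat,
    v (y i - \sum_j ratr (q j) * y (lift i j)) < e.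
  move=> e_gt0; have [q lt] := bad e e_gt0.
  have Sq : \sum_j ratr (q j) * y j \in in_sf E by apply: Esum.
  have nz_q : q i != 0.
    apply: contraTneq lt => q0; rewrite q0 rmorph0 place0 mulr0 -leNgt; exact: place_ge0.
  exists (fun j => - (q (lift i j) / q i)).
  have -> : y i - \sum_j ratr (- (q (lift i j) / q i)) * y (lift i j) =
     ratr (q i)^-1 * \sum_j ratr (q j) * y j.
    rewrite (bigD1_ord i) //= mulrDr mulrA -rmorphM mulVf // rmorph1 mul1r; congr (_ + _).
    rewrite mulr_sumr -sumrN; apply: eq_bigr => j _.
    by rewrite mulrA -rmorphM rmorphN mulNr opprK [_^-1 * _]mulrC.
  rewrite placeM ?ratr_in_sf // fmorphV placeV ?ratr_in_sf // mulrC ltr_pdivrMr //.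
  by rewrite lt_neqAle eq_sym place_eq0 ?ratr_in_sf // fmorph_eq0 nz_q place_ge0.
have : dense_family (fun j => y (lift i j)).
  split=> // x Ex e e_gt0; have e2 : 0 < e / 2 by rewrite divr_gt0.
  have [q ltq] := dense_y x Ex _ e2.
  have pos : 0 < v (ratr (q i)) + 1 by rewrite ltr_wpDl ?place_ge0.
  have [t ltt] := bad1 (e / 2 / (v (ratr (q i)) + 1)) (divr_gt0 e2 pos).
  exists (fun j => q (lift i j) + q i * t j).
  have -> : x - \sum_j ratr (q (lift i j) + q i * t j) * y (lift i j) =
     (x - \sum_j ratr (q j) * y j) + ratr (q i) * (y i - \sum_j ratr (t j) * y (lift i j)).
    rewrite [\sum_j ratr (q j) * y j](bigD1_ord i) //=.
    have -> : \sum_j ratr (q (lift i j) + q i * t j) * y (lift i j) =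
       \sum_j ratr (q (lift i j)) * y (lift i j) + ratr (q i) * \sum_j ratr (t j) * y (lift i j).
      rewrite mulr_sumr -big_split /=; apply: eq_bigr => j _.
      by rewrite rmorphD rmorphM mulrDl mulrA.
    by ring.
  apply: le_lt_trans (placeD _ _) _.
  - by rewrite rpredB // Esum.
  - by rewrite rpredM ?ratr_in_sf // rpredB // Esum.
  rewrite placeM ?ratr_in_sf //; last by rewrite rpredB // Esum.
  have : v (ratr (q i)) * v (y i - \sum_j ratr (t j) * y (lift i j)) <= e / 2.
    apply: (@le_trans _ _ ((v (ratr (q i)) + 1) * (e / 2 / (v (ratr (q i)) + 1)))).
      by rewrite ler_pM ?place_ge0 ?(ltW ltt) // lerDl.
    by rewrite mulrC divfK // gt_eqF.
  move: ltq; move: (v _) (v _ * v _) => a b ha hb; lra.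
by move/min_n; rewrite ltnn.
Qed.

(** A minimal dense family, as constant sequences, is a local basis: density provides coefficients,
    and the bound [d] makes them Cauchy and unique. So [local_degree] is never a default value. *)
Lemma local_basis_exists : number_field (scar E) ->
  exists n (x : 'I_n -> nat -> algC), local_basis (scar E) v x.
Proof.
move=> nfE; pose P n := `[< exists y : 'I_n -> algC, dense_family y >].
have exP : exists n, P n.
  have [m [nu [z emb]]] := number_field_embeddings nfE.
  have [_ /mxOverP Eb span_b _] := embeddings_basis emb; exists m; apply/asboolP.
  exists (fun j => (\row_(j < m) z ^+ j) 0 j); split=> // x Ex e e_gt0.
  have [c /mxOverP Qc Dx] := span_b x Ex.
  have /choice[q Dq] : forall i, exists q : rat, c 0 i = ratr q.
    by move=> i; apply/CratP; rewrite -in_Qsf.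
  exists q; suff -> : x - \sum_i ratr (q i) * (\row_(j < m) z ^+ j) 0 i = 0 by rewrite place0.
  apply/eqP; rewrite subr_eq0; apply/eqP/scalar1_inj; rewrite Dx mulmx_rowT.
  by congr (_%:M); apply: eq_bigr => i _; rewrite Dq.
have [n /asboolP[y dense_y] min_n] := ex_minnP exP.
have [Ey dy] := dense_y.
have [|d d_gt0 Hd] := minimal_dense_family dense_y.
  by move=> k y' dy'; apply: min_n; apply/asboolP; exists y'.
have QQratr (c : nat -> algC) : cauchy_in QQ v c -> exists q : nat -> rat, forall k, c k = ratr (q k).
  case=> Qc _; have /choice[q Dq] : forall k, exists q : rat, c k = ratr q.
    by move=> k; apply/CratP; exact: Qc.
  by exists q.
exists n, (fun i _ => y i); split.
- move=> i; apply/cauchy_inP; split=> [k|e e_gt0]; first exact/sfP.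
  by exists 0%N => k l _ _; rewrite subrr place0.
- move=> u /cauchy_inP[Eu cu]; have Eu' k : u k \in in_sf E by apply/sfP.
  have /choice[q Hq] : forall k : nat, exists q : 'I_n -> rat,
      v (u k - \sum_i ratr (q i) * y i) < k.+1%:R^-1.
    by move=> k; apply: dy => //; rewrite invr_gt0 ltr0n.
  have small (e : R) : 0 < e -> exists N, forall k, (N <= k)%N ->
      v (u k - \sum_i ratr (q k i) * y i) < e.
    move=> e_gt0; exists (Num.bound e^-1) => k le_Nk.
    apply: lt_trans (Hq k) _; rewrite -[e]invrK ltf_pV2 ?posrE ?invr_gt0 ?ltr0n //.
    apply: lt_le_trans (archi_boundP _) _; first by rewrite invr_ge0 ltW.
    by rewrite ler_nat; apply: leqW.
  exists (fun i k => ratr (q k i)).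
    move=> i; apply/cauchy_inP; split=> [k|e e_gt0].
      exact: Crat_rat.
    have e3 : 0 < d * e / 3 by rewrite divr_gt0 // mulr_gt0.
    have [N1 H1] := small _ e3; have [N2 H2] := cu _ e3.
    exists (maxn N1 N2) => k l; rewrite !geq_max => /andP[k1 k2] /andP[l1 l2].
    have := Hd (fun j => q k j - q l j) i.
    rewrite rmorphB /= => le1; rewrite -(ltr_pM2l d_gt0); apply: le_lt_trans le1 _.
    pose a k := u k - \sum_i ratr (q k i) * y i.
    have Ea h : a h \in in_sf E.
      by rewrite rpredB // rpred_sum // => j _; rewrite rpredM ?ratr_in_sf.
    have -> : \sum_j ratr (q k j - q l j) * y j = (u k - u l) + (- a k + a l).
      have -> : \sum_j ratr (q k j - q l j) * y j = \sum_j ratr (q k j) * y j - \sum_j ratr (q l j) * y j.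
        by rewrite -sumrB; apply: eq_bigr => j _; rewrite rmorphB mulrBl.
      by rewrite /a; ring.
    have E1 : u k - u l \in in_sf E by rewrite rpredB.
    have E2 : - a k + a l \in in_sf E by apply: rpredD; rewrite ?rpredN; exact: Ea.
    apply: le_lt_trans (placeD E1 E2) _.
    have h1 : v (- a k + a l) <= v (a k) + v (a l).
      by rewrite -(placeN (a k)); apply: placeD; rewrite ?rpredN; exact: Ea.
    have h2 := H2 k l k2 l2; have h3 := H1 k k1; have h4 := H1 l l1.
    move: h1 h2 h3 h4; rewrite -/(a k) -/(a l).
    move: (v (- a k + a l)) (v (u k - u l)) (v (a k)) (v (a l)) => r1 r2 r3 r4.
    by move: (d * e) => r5; lra.
  by apply/null_seqP; [exact: place_ge0 | exact: small].
- move=> c Qc null_c i; apply/null_seqP; first exact: place_ge0.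
  move=> e e_gt0; have de : 0 < d * e by rewrite mulr_gt0.
  have /choice[q Dq] : forall j, exists q : nat -> rat, forall k, c j k = ratr (q k).
    by move=> j; apply: QQratr.
  have [N HN] := (null_seqP _ place_ge0).1 null_c _ de.
  exists N => k le_Nk; rewrite Dq -(ltr_pM2l d_gt0); apply: le_lt_trans (HN k le_Nk).
  under eq_bigr do rewrite Dq.
  exact: (Hd (fun j => q j k) i).
Qed.

End Place.

Section LocalDegree.
Variables (R : realType) (E : sfield) (v : algC -> R).
Hypothesis pl_v : place (scar E) v.

(* A local basis of size [n] makes [1, a, ..., a^n] nearly dependent. *)
Lemma local_basis_small_relation n (x : 'I_n -> nat -> algC) (a : algC) (e : R) :
  local_basis (scar E) v x -> a \in in_sf E -> 0 < e ->
  exists2 q : 'I_n.+1 -> rat, (forall j, v (ratr (q j)) <= 1) /\ (exists j, v (ratr (q j)) = 1) &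
    v (\sum_j ratr (q j) * a ^+ j) < e.
Proof.
move=> [Ex span_x _] Ea e_gt0.
have n1_gt0 : 0 < n.+1%:R :> R by rewrite ltr0n.
have /choice[c Hc] : forall j : 'I_n.+1, exists c : 'I_n -> nat -> algC,
    (forall i, cauchy_in QQ v (c i)) /\ null_seq v (fun k => a ^+ j - \sum_i c i k * x i k).
  move=> j; have [|c Qc nc] := span_x (fun _ => a ^+ j); last by exists c.
  apply/cauchy_inP; split=> [_|e' e'_gt0]; first by apply/sfP; rewrite rpredX.
  by exists 0%N => k l _ _; rewrite subrr (place0 pl_v).
have e1 : 0 < e / n.+1%:R by rewrite divr_gt0.
have /choice[N HN] : forall j : 'I_n.+1, exists N, forall k, (N <= k)%N ->
    v (a ^+ j - \sum_i c j i k * x i k) < e / n.+1%:R.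
  by move=> j; have [_ /(null_seqP _ (place_ge0 pl_v))/(_ _ e1)] := Hc j.
pose k := \big[maxn/0%N]_j N j.
have Hk (j : 'I_n.+1) : v (a ^+ j - \sum_i c j i k * x i k) < e / n.+1%:R.
  by apply: HN; exact: leq_bigmax.
have /choice[C DC] : forall p : 'I_n.+1 * 'I_n, exists q : rat, c p.1 p.2 k = ratr q.
  move=> [j i] /=; apply/CratP; have [/(_ i)[Qc _] _] := Hc j; exact: Qc.
pose M : 'M[rat]_(n.+1, n) := \matrix_(j, i) C (j, i).
(* At a common index [k] the coordinates of the [n.+1] powers of [a] form a rational matrix with [n]
   columns, hence have a rational relation; it is scaled so that its largest coefficient has
   absolute value 1. *)
have [q /sub_kermxP qM nz_q] : exists2 q : 'rV[rat]_n.+1, (q <= kermx M)%MS & q != 0.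
  apply/rowV0Pn; rewrite kermx_eq0 /row_free neq_ltn ltnS.
  by rewrite (leq_trans (rank_leq_col M)).
pose f j := v (ratr (q 0 j)).
have [j0 max_j0] : exists j0, forall j, f j <= f j0.
  by case: (@Order.TotalTheory.arg_maxP _ _ _ ord0 xpredT f isT) => j0 _ H; exists j0 => j; exact: H.
have Eq j : ratr (q 0 j) \in in_sf E by exact: ratr_in_sf.
have f_gt0 : 0 < f j0.
  have [j nz] : exists j, q 0 j != 0.
    apply/existsP; apply: contraR nz_q; rewrite negb_exists => /forallP h.
    by apply/eqP/rowP => j; rewrite mxE; apply/eqP; rewrite -[_ == _]negbK.
  apply: lt_le_trans (max_j0 j).
  by rewrite lt_neqAle eq_sym (place_eq0 pl_v) // fmorph_eq0 nz (place_ge0 pl_v).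
have fE j : v (ratr (q 0 j / q 0 j0)) = f j / f j0.
  by rewrite fmorph_div (placeM pl_v) ?rpredV ?(Eq j) ?(Eq j0) ?(placeV pl_v) ?(Eq j0).
exists (fun j => q 0 j / q 0 j0).
  split=> [j|]; first by rewrite fE ler_pdivrMr // mul1r.
  by exists j0; rewrite fE divff // gt_eqF.
have Exk i : x i k \in in_sf E by apply/sfP; case: (Ex i) => /(_ k).
pose rest (j : 'I_n.+1) := a ^+ j - \sum_i c j i k * x i k.
have Erest j : rest j \in in_sf E.
  rewrite rpredB ?rpredX // rpred_sum // => i _; rewrite rpredM //.
  by rewrite (DC (j, i)) ratr_in_sf.
have -> : \sum_(j < n.+1) ratr (q 0 j / q 0 j0) * a ^+ j = \sum_(j < n.+1) ratr (q 0 j / q 0 j0) * rest j.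
  apply/eqP; rewrite -subr_eq0 -sumrB.
  have -> : \sum_(j < n.+1) (ratr (q 0 j / q 0 j0) * a ^+ j - ratr (q 0 j / q 0 j0) * rest j)
     = \sum_i (\sum_j ratr (q 0 j / q 0 j0) * c j i k) * x i k.
    under [RHS]eq_bigr do rewrite mulr_suml; rewrite exchange_big; apply: eq_bigr => j _.
    rewrite -mulrBr /rest opprB addrC subrK mulr_sumr; apply: eq_bigr => i _.
    by rewrite mulrA.
  rewrite big1 // => i _.
  suff -> : \sum_j ratr (q 0 j / q 0 j0) * c j i k = 0 by rewrite mul0r.
  have /matrixP/(_ 0 i) := qM; rewrite !mxE => h.
  transitivity (ratr ((q 0 j0)^-1 * \sum_j q 0 j * M j i) : algC); last by rewrite h mulr0 rmorph0.
  rewrite mulr_sumr rmorph_sum; apply: eq_bigr => j _.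
  by rewrite (DC (j, i)) mxE -rmorphM /=; congr ratr; ring.
apply: le_lt_trans (place_sum pl_v _ _ _) _; first by move=> j; rewrite rpredM ?ratr_in_sf.
have -> : e = \sum_(j < n.+1) e / n.+1%:R.
  by rewrite sumr_const card_ord -[RHS]mulr_natr divfK // gt_eqF.
apply: ltr_sum => [|j _]; first by apply/hasP; exists ord0; rewrite // mem_index_enum.
rewrite (placeM pl_v) ?ratr_in_sf // fE.
apply: le_lt_trans (Hk j); rewrite ler_piMl ?(place_ge0 pl_v) //.
by rewrite ler_pdivrMr // mul1r.
Qed.

(** If [n < N], a rational combination of [1, a, ..., a^n] is tiny under [n.+1] embeddings at once.
    Inverting their Vandermonde matrix makes all its coefficients small, although one has absolute
    value 1. *)
Lemma local_degree_ge (w : algC -> R) N (sigma : 'I_N -> {rmorphism algC -> algC}) (a : algC) :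
  number_field (scar E) -> is_absval w -> a \in in_sf E ->
  injective (fun i => sigma i a) ->
  (forall i x, x \in in_sf E -> w (sigma i x) = v x) ->
  (N <= local_degree (scar E) v)%N.
Proof.
move=> nfE abs_w Ea inj_s Hw.
have [n0 [x0 lb0]] := local_basis_exists pl_v nfE.
rewrite /local_degree; case: xgetP => [n _ [x lb]|/(_ n0) []]; last by exists x0.
rewrite leqNgt; apply/negP => lt_nN.
pose r (i : 'I_n.+1) := sigma (widen_ord lt_nN i) a.
have inj_r : injective r by move=> i j /inj_s/(congr1 val) /= e; apply: val_inj.
pose V : 'M[algC]_n.+1 := \matrix_(i, j) r i ^+ j.
have uV : V \in unitmx by exact: vandermonde_unit.
pose B := \sum_i \sum_j w (invmx V i j).
have w_ge0 := absval_ge0 abs_w.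
have B_ge0 : 0 <= B by rewrite /B sumr_ge0 // => i _; rewrite sumr_ge0.
have e_gt0 : 0 < (B + 1)^-1 by rewrite invr_gt0 ltr_wpDl.
have [q [q1 [j0 qj0]] small] := local_basis_small_relation lb Ea e_gt0.
have qE : \col_j ratr (q j) = invmx V *m \col_i (\sum_j ratr (q j) * r i ^+ j).
  suff -> : \col_i (\sum_j ratr (q j) * r i ^+ j) = V *m \col_j ratr (q j) by rewrite mulKmx.
  by apply/matrixP=> i j; rewrite !mxE; apply: eq_bigr => l _; rewrite !mxE mulrC.
have := congr1 (fun A : 'cV[algC]_n.+1 => w (A j0 0)) qE; rewrite !mxE => wq.
have : w (ratr (q j0)) = 1.
  by rewrite -(fmorph_rat (sigma (widen_ord lt_nN ord0))) Hw ?ratr_in_sf // qj0.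
apply/eqP; rewrite lt_eqF // wq.
apply: le_lt_trans (absval_sum abs_w _ _ _) _.
apply: (@le_lt_trans _ _ (\sum_j w (invmx V j0 j) * (B + 1)^-1)).
  apply: ler_sum => i _; rewrite (absvalM abs_w) ler_wpM2l // mxE.
  have -> : \sum_j ratr (q j) * r i ^+ j = sigma (widen_ord lt_nN i) (\sum_j ratr (q j) * a ^+ j).
    by rewrite rmorph_sum; apply: eq_bigr => j _; rewrite rmorphM fmorph_rat rmorphXn.
  rewrite Hw; first exact: ltW.
  by rewrite rpred_sum // => j _; rewrite rpredM ?ratr_in_sf ?rpredX.
rewrite -mulr_suml ltr_pdivrMr ?ltr_wpDl // mul1r.
apply: (@le_lt_trans _ _ B); last by rewrite ltrDl.
rewrite /B [X in _ <= X](bigD1 j0) //= lerDl sumr_ge0 // => i _; rewrite sumr_ge0 //.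
Qed.

End LocalDegree.

(** * Finiteness of the set of places *)

Definition eventually_nat (P : nat -> Prop) := exists N, forall n, (N <= n)%N -> P n.

Lemma eventually_natI (P Q : nat -> Prop) : eventually_nat P -> eventually_nat Q ->
  eventually_nat (fun n => P n /\ Q n).
Proof.
move=> [N HN] [M HM]; exists (maxn N M) => n; rewrite geq_max => /andP[? ?].
by split; [exact: HN | exact: HM].
Qed.

Lemma eventually_nat_all (T : eqType) (s : seq T) (P : T -> nat -> Prop) :
  (forall i, i \in s -> eventually_nat (P i)) ->
  eventually_nat (fun n => forall i, i \in s -> P i n).
Proof.
elim: s => [|j s IH] H; first by exists 0%N.
have [|N HN] := @eventually_natI _ _ (H j (mem_head _ _)) (IH _).
  by move=> i si; apply: H; rewrite inE si orbT.
exists N => n /HN[Pj Ps] i; rewrite inE => /orP[/eqP->//|]; exact: Ps.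
Qed.

Lemma eventually_exp_gt (R : realType) (x K : R) : 1 < x -> eventually_nat (fun n => K < x ^+ n).
Proof.
move=> x_gt1; have h_gt0 : 0 < x - 1 by rewrite subr_gt0.
have bern n : 1 + n%:R * (x - 1) <= x ^+ n.
  elim: n => [|n IH]; first by rewrite mul0r addr0.
  rewrite exprS -natr1; apply: (@le_trans _ _ (x * (1 + n%:R * (x - 1)))).
    have : 0 <= n%:R * (x - 1) * (x - 1) by rewrite !mulr_ge0 // ltW.
    move: (n%:R) => t; nra.
  by rewrite ler_wpM2l // ltW // (lt_trans _ x_gt1).
exists (Num.bound (`|K| / (x - 1))) => n le_n; apply: lt_le_trans (bern n).
apply: le_lt_trans (ler_norm K) _; rewrite ltr_wpDl // -ltr_pdivrMr //.
apply: lt_le_trans (archi_boundP _) _; last by rewrite ler_nat.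
by rewrite divr_ge0 // ltW.
Qed.

Lemma eventually_exp_lt (R : realType) (x e : R) : 0 <= x -> x < 1 -> 0 < e ->
  eventually_nat (fun n => x ^+ n < e).
Proof.
move=> x_ge0 x_lt1 e_gt0; have [->|nz_x] := eqVneq x 0.
  by exists 1%N => -[|n] // _; rewrite expr0n.
have x_gt0 : 0 < x by rewrite lt_neqAle eq_sym nz_x.
have [|N HN] := @eventually_exp_gt _ x^-1 e^-1; first by rewrite invf_gt1.
exists N => n /HN; rewrite exprVn ltf_pV2 ?posrE ?exprn_gt0 //.
Qed.

Section Places.
Variables (R : realType) (E : sfield).

(* Were [v x < v' x], some [x^n c^-m] would separate [v] from [v']. *)
Lemma place_eq (v v' : algC -> R) (c : rat) :
  place (scar E) v -> place (scar E) v' -> (forall q : rat, v (ratr q) = v' (ratr q)) ->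
  0 < v (ratr c) < 1 ->
  (forall x, x \in in_sf E -> v x < 1 -> v' x < 1) -> v = v'.
Proof.
move=> pv pv' vQ /andP[c_gt0 c_lt1] H.
have v_gt0 (u : algC -> R) x : place (scar E) u -> x \in in_sf E -> x != 0 -> 0 < u x.
  by move=> pu Ex nx; rewrite lt_neqAle eq_sym (place_eq0 pu) // nx (place_ge0 pu).
have nc : ratr c != 0 :> algC by rewrite -(place_eq0 pv) ?ratr_in_sf // gt_eqF.
have lnXz (u : algC -> R) x (z : int) : place (scar E) u -> x \in in_sf E -> x != 0 ->
    ln (u (x ^ z)) = z%:~R * ln (u x).
  move=> pu Ex nx; case: z => n.
    by rewrite -exprnP (placeX pu) // lnXn ?v_gt0 // -mulr_natl.
  rewrite NegzE -invr_expz (placeV pu) ?rpredX // lnV ?posrE ?v_gt0 ?rpredX ?expf_neq0 //.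
  by rewrite (placeX pu) // lnXn ?v_gt0 // rmorphN mulNr -mulr_natl.
have lnM (u : algC -> R) x y : place (scar E) u -> x \in in_sf E -> x != 0 -> y \in in_sf E -> y != 0 ->
    ln (u (x * y)) = ln (u x) + ln (u y).
  by move=> pu Ex nx Ey ny; rewrite (placeM pu) // lnM ?posrE ?v_gt0.
have lnc : ln (v (ratr c)) < 0 by rewrite ln_lt0 // c_gt0.
have noless x : x \in in_sf E -> x != 0 -> v' x <= v x.
  move=> Ex nx; rewrite leNgt; apply/negP => lt_x.
  have lt_ln : ln (v' x) / ln (v (ratr c)) < ln (v x) / ln (v (ratr c)).
    by rewrite ltr_ndivrMr // divfK ?lt_eqF // ltr_ln ?posrE ?v_gt0.
  have [q] := rat_in_itvoo lt_ln; rewrite in_itv /= => /andP[].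
  have d_gt0 : 0 < (denq q)%:~R :> R by rewrite ltr0z denq_gt0.
  have -> : ratr q = (numq q)%:~R / (denq q)%:~R :> R.
    by rewrite -[q in LHS]divq_num_den fmorph_div /= !ratr_int.
  rewrite ltr_ndivrMr // mulrAC ltr_pdivrMr // => h1.
  rewrite ltr_ndivlMr // mulrAC ltr_pdivlMr // => h2.
  (* As [q] lies between the two quotients and [ln (v (ratr c))] is negative, [v y < 1 < v' y]. *)
  pose y := x ^ denq q * ratr c ^ (- numq q).
  have Exz t (z : int) : t \in in_sf E -> t ^ z \in in_sf E.
    by move=> Et; case: z => n; rewrite ?NegzE -?invr_expz ?rpredV rpredX.
  have Ey : y \in in_sf E by rewrite rpredM ?Exz ?ratr_in_sf.
  have ny : y != 0 by rewrite mulf_neq0 // expfz_neq0.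
  have lny (u : algC -> R) : place (scar E) u -> ln (u y) = (denq q)%:~R * ln (u x) - (numq q)%:~R * ln (u (ratr c)).
    by move=> pu; rewrite lnM ?Exz ?ratr_in_sf ?expfz_neq0 // !lnXz ?ratr_in_sf // rmorphN mulNr.
  have : v' y < 1.
    apply: H => //; rewrite -ltr_ln ?posrE ?v_gt0 // ln1 lny //.
    by rewrite subr_lt0 mulrC.
  rewrite -ltr_ln ?posrE ?v_gt0 // ln1 lny // subr_lt0 -vQ mulrC.
  by rewrite ltNge (ltW h1).
apply/funext => x; have [Ex|nEx] := boolP (x \in in_sf E); last first.
  by rewrite (place_out pv) // (place_out pv').
have [->|nx] := eqVneq x 0; first by rewrite (place0 pv) (place0 pv').
apply/eqP; rewrite eq_le noless // andbT.
have := noless x^-1; rewrite rpredV Ex invr_eq0 nx => /(_ isT isT).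
by rewrite (placeV pv) // (placeV pv') // lef_pV2 ?posrE ?v_gt0.
Qed.

(** By [place_eq] neither open unit ball contains the other; the quotient of a witness on each side
    separates the two places. *)
Lemma place_separate (v v' : algC -> R) (c : rat) :
  place (scar E) v -> place (scar E) v' -> (forall q : rat, v (ratr q) = v' (ratr q)) ->
  0 < v (ratr c) < 1 -> v <> v' ->
  exists z, [/\ z \in in_sf E, 1 < v z & v' z < 1].
Proof.
move=> pv pv' vQ c01 ne_v.
have ex (u u' : algC -> R) : (forall x, x \in in_sf E -> u x < 1 -> u' x < 1) \/
    exists x, [/\ x \in in_sf E, u x < 1 & 1 <= u' x].
  have [h|h] := pselect (exists x, [/\ x \in in_sf E, u x < 1 & 1 <= u' x]); [by right|left].
  by move=> x Ex ux; rewrite ltNge; apply/negP => u'x; apply: h; exists x.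
have [H|[x [Ex vx v'x]]] := ex v v'.
  by case: ne_v; exact: place_eq pv pv' vQ c01 H.
have [H|[y [Ey v'y vy]]] := ex v' v.
  by case: ne_v; apply/esym; apply: (@place_eq v' v c pv' pv) H => [q|]; rewrite -vQ.
have nx : x != 0.
  by apply: contraTneq v'x => ->; rewrite (place0 pv') -ltNge.
have vx_gt0 : 0 < v x by rewrite lt_neqAle eq_sym (place_eq0 pv) // nx (place_ge0 pv).
have v'x_gt0 : 0 < v' x by exact: lt_le_trans v'x.
exists (y / x); split; first by rewrite rpred_div.
  rewrite (placeM pv) ?rpredV // (placeV pv) // ltr_pdivlMr // mul1r.
  exact: lt_le_trans vy.
rewrite (placeM pv') ?rpredV // (placeV pv') // ltr_pdivrMr // mul1r.
exact: lt_le_trans v'x.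
Qed.

Section Family.
Variables (r : nat) (v : 'I_r -> algC -> R) (c : rat).
Hypotheses (pv : forall i, place (scar E) (v i)) (inj_v : injective v)
  (vQ : forall i j (q : rat), v i (ratr q) = v j (ratr q))
  (c01 : forall i, 0 < v i (ratr c) < 1).

(* Artin-Whaples: multiply by [z^n] or by [z^n / (1 + z^n)]. *)
Lemma place_isolate i (s : seq 'I_r) : i \notin s ->
  exists z, [/\ z \in in_sf E, 1 < v i z & forall j, j \in s -> v j z < 1].
Proof.
elim: s => [_|j s IH].
  exists (ratr c)^-1; rewrite rpredV ratr_in_sf; split=> //.
  by rewrite (placeV (pv i)) ?ratr_in_sf // invf_gt1; case/andP: (c01 i).
rewrite inE negb_or => /andP[ne_ij /IH[z [Ez vz sz]]].
have [|y [Ey vy v'y]] := place_separate (pv i) (pv j) (vQ i j) (c01 i).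
  by move=> /inj_v/eqP; rewrite (negPf ne_ij).
have ge0 k x : 0 <= v k x by exact: place_ge0 (pv k) x.
have [le1|gt1] := leP (v j z) 1.
  have [|N HN] := @eventually_nat_all _ s (fun k n => v k z ^+ n < (v k y + 1)^-1).
    by move=> k sk; apply: eventually_exp_lt => //; [exact: sz | rewrite invr_gt0 ltr_wpDl].
  exists (z ^+ N * y); rewrite rpredM ?rpredX //; split=> // [|k].
    rewrite (placeM (pv i)) ?rpredX // (placeX (pv i)) //.
    by apply: (lt_le_trans vy); rewrite ler_peMl // exprn_ege1 // ltW.
  rewrite (placeM (pv k)) ?rpredX // (placeX (pv k)) // inE => /orP[/eqP->|sk].
    by apply: le_lt_trans v'y; rewrite ler_piMl // exprn_ile1.
  have pos : 0 < v k y + 1 by rewrite ltr_wpDl.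
  apply: (@le_lt_trans _ _ (v k z ^+ N * (v k y + 1))).
    by rewrite ler_wpM2l ?exprn_ge0 // lerDl.
  by rewrite -ltr_pdivlMr // div1r HN.
(* Here [z] is large at both [i] and [j], so [z^n / (1 + z^n)] is near 1 there and near 0 on [s];
   the thresholds for [n] are those keeping [y] above 1 at [i] and below 1 at [j]. *)
have h1 : 0 < v i y - 1 by rewrite subr_gt0.
have h2 : 0 < 1 - v j y by rewrite subr_gt0.
have [|N1 H1] := @eventually_nat_all _ s (fun k n => v k z ^+ n < (v k y + 1)^-1).
  by move=> k sk; apply: eventually_exp_lt => //; [exact: sz | rewrite invr_gt0 ltr_wpDl].
have [N2 H2] := eventually_exp_gt (v i y - 1)^-1 vz.
have [N3 H3] := eventually_exp_gt (1 + (1 - v j y)^-1) gt1.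
pose n := maxn N1 (maxn N2 N3).
have {}H1 := H1 n (leq_maxl _ _).
have {}H2 : (v i y - 1)^-1 < v i z ^+ n by apply: H2; rewrite /n !leq_max leqnn orbT.
have {}H3 : 1 + (1 - v j y)^-1 < v j z ^+ n by apply: H3; rewrite /n !leq_max leqnn !orbT.
have Ezn : z ^+ n \in in_sf E by rewrite rpredX.
have E1zn : 1 + z ^+ n \in in_sf E by rewrite rpredD ?rpred1.
have vle k : v k (1 + z ^+ n) <= 1 + v k z ^+ n.
  by rewrite -(placeX (pv k)) // -[X in _ <= X + _](place1 (pv k)) (placeD (pv k)) // rpred1.
have vge1 k : v k z ^+ n - 1 <= v k (1 + z ^+ n).
  have := placeD (pv k) E1zn (y := -1); rewrite rpredN rpred1 => /(_ isT).
  by rewrite addrAC subrr add0r (placeN (pv k)) (place1 (pv k)) (placeX (pv k)) // lerBlDr.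
have vge2 k : 1 - v k z ^+ n <= v k (1 + z ^+ n).
  have := placeD (pv k) E1zn (y := - z ^+ n); rewrite rpredN Ezn => /(_ isT).
  by rewrite addrK (placeN (pv k)) (place1 (pv k)) (placeX (pv k)) // lerBlDr.
have nz1 : 1 + z ^+ n != 0.
  rewrite -(place_eq0 (pv j)) // gt_eqF //; apply: lt_le_trans (vge1 j).
  by rewrite subr_gt0; apply: le_lt_trans H3; rewrite lerDl invr_ge0 ltW.
have vpos k : 0 < v k (1 + z ^+ n).
  by rewrite lt_neqAle eq_sym (place_eq0 (pv k)) // nz1 ge0.
have vE k : v k (z ^+ n / (1 + z ^+ n) * y) = v k z ^+ n * v k y / v k (1 + z ^+ n).
  rewrite (placeM (pv k)) ?rpred_div // (placeM (pv k)) ?rpredV // (placeV (pv k)) //.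
  by rewrite (placeX (pv k)) // mulrAC.
exists (z ^+ n / (1 + z ^+ n) * y); split; first by rewrite rpredM ?rpred_div.
- rewrite vE ltr_pdivlMr // mul1r; apply: le_lt_trans (vle i) _.
  move: H2; rewrite -div1r ltr_pdivrMr // => H2; move: H2; move: (v i z ^+ n) (v i y) => a b; lra.
- move=> k; rewrite vE ltr_pdivrMr // mul1r inE => /orP[/eqP->|sk].
    apply: lt_le_trans (vge1 j); move: H3; rewrite -ltrBrDl -div1r ltr_pdivrMr //.
    move: (v j z ^+ n) (v j y) v'y (ge0 j y) => a b hb hb0; nra.
  apply: lt_le_trans (vge2 k); have pos : 0 < v k y + 1 by rewrite ltr_wpDl.
  have := H1 k sk; rewrite -(ltr_pM2r pos) mulVf ?gt_eqF // mulrDr mulr1.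
  by rewrite ltrBrDr.
Qed.

(** High powers of elements isolating the [r] places are independent over the rationals: in a
    relation, the term with the largest coefficient would dominate at its own place. *)
Lemma places_le_degree d (b : 'rV[algC]_d) : sf_basis Qsf E b -> (r <= d)%N.
Proof.
move=> hb; rewrite leqNgt; apply/negP => lt_dr.
have /choice[z Hz] : forall i, exists z, [/\ z \in in_sf E, 1 < v i z & forall j, j != i -> v j z < 1].
  move=> i; have [|z [Ez vz sz]] := @place_isolate i [seq j <- enum 'I_r | j != i].
    by rewrite mem_filter eqxx.
  by exists z; split=> // j ne; apply: sz; rewrite mem_filter ne mem_enum.
have ge0 k x : 0 <= v k x by exact: place_ge0 (pv k) x.
have rpos : 0 < r%:R :> R by rewrite ltr0n (leq_ltn_trans _ lt_dr).
have [|N0 HN0] := @eventually_nat_all _ (enum [set: 'I_r * 'I_r]%SET)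
    (fun p n => p.2 != p.1 -> v p.2 (z p.1) ^+ n < r%:R^-1).
  move=> [i j] _ /=; have [->|ne] := eqVneq j i; first by exists 0%N.
  have [N HN] : eventually_nat (fun n => v j (z i) ^+ n < r%:R^-1).
    by apply: eventually_exp_lt; rewrite ?invr_gt0 //; case: (Hz i) => _ _; apply.
  by exists N => n /HN.
(* The exponent must be positive for the isolated power to exceed 1 strictly. *)
pose N := N0.+1; have HN i j : j != i -> v j (z i) ^+ N < r%:R^-1.
  by apply: (HN0 N (leqnSn N0) (i, j)); rewrite mem_enum finset.in_setT.
have Ez i : z i \in in_sf E by case: (Hz i).
have [|C QC DC] := sf_basis_span (b' := \row_i z i ^+ N) hb.
  by apply/mxOverP=> i j; rewrite mxE rpredX.
have /choice[M DM] : forall p : 'I_r * 'I_d, exists q : rat, C p.1 p.2 = ratr q.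
  by move=> p; apply/CratP; rewrite -in_Qsf; move/mxOverP: QC; apply.
pose M' : 'M[rat]_(r, d) := \matrix_(i, j) M (i, j).
have CM : C = map_mx ratr M' by apply/matrixP=> i j; rewrite !mxE -DM.
have [q /sub_kermxP qM nz_q] : exists2 q : 'rV[rat]_r, (q <= kermx M')%MS & q != 0.
  apply/rowV0Pn; rewrite kermx_eq0 /row_free neq_ltn.
  by rewrite (leq_ltn_trans (rank_leq_col M')).
have rel : \sum_i ratr (q 0 i) * z i ^+ N = 0.
  have : map_mx ratr q *m (\row_i z i ^+ N)^T = 0 by rewrite DC CM mulmxA -map_mxM qM map_mx0 mul0mx.
  rewrite mulmx_rowT => /matrixP/(_ 0 0); rewrite !mxE mulr1n => h; rewrite -[RHS]h.
  by apply: eq_bigr => i _; rewrite !mxE.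
have [i0 nz_i0] : exists i, q 0 i != 0.
  apply/existsP; apply: contraR nz_q; rewrite negb_exists => /forallP h.
  by apply/eqP/rowP => j; rewrite mxE; apply/eqP; rewrite -[_ == _]negbK.
pose f i := v i0 (ratr (q 0 i)).
have [i1 max_i1] : exists i1, forall i, f i <= f i1.
  by case: (@Order.TotalTheory.arg_maxP _ _ _ i0 xpredT f isT) => j0 _ H; exists j0 => j; exact: H.
have f_gt0 : 0 < f i1.
  apply: lt_le_trans (max_i1 i0).
  by rewrite lt_neqAle eq_sym (place_eq0 (pv i0)) ?ratr_in_sf // fmorph_eq0 nz_i0 ge0.
have fE i j : v j (ratr (q 0 i)) = f i by exact: vQ.
have Et i : ratr (q 0 i) * z i ^+ N \in in_sf E by rewrite rpredM ?ratr_in_sf ?rpredX.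
have : v i1 (ratr (q 0 i1) * z i1 ^+ N) <= \sum_(i | i != i1) v i1 (ratr (q 0 i) * z i ^+ N).
  move: rel; rewrite (bigD1 i1) //= => /eqP; rewrite addr_eq0 => /eqP ->.
  by rewrite (placeN (pv i1)); exact: place_sum.
apply/negP; rewrite -ltNge.
apply: (@le_lt_trans _ _ (\sum_(i | i != i1) f i1 * r%:R^-1)).
  apply: ler_sum => i ne; rewrite (placeM (pv i1)) ?ratr_in_sf ?rpredX // fE (placeX (pv i1)) //.
  by apply: ler_pM; rewrite ?ge0 ?exprn_ge0 ?(ltW (HN _ _ _)) 1?eq_sym // /f ge0.
rewrite (placeM (pv i1)) ?ratr_in_sf ?rpredX // fE (placeX (pv i1)) //.
apply: (@le_lt_trans _ _ (\sum_(i < r) f i1 * r%:R^-1)).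
  rewrite [X in _ <= X](bigD1 i1) //= lerDr mulr_ge0 ?ltW // invr_gt0 //.
rewrite sumr_const card_ord -[X in X < _]mulr_natr divfK ?gt_eqF //.
rewrite -[X in X < _]mulr1 ltr_pM2l //.
by rewrite exprn_egt1 //; case: (Hz i1).
Qed.
End Family.

End Places.

Lemma finite_places_over (R : realType) (E : sfield) (u : rat -> R) (c : rat) :
  number_field (scar E) -> 0 < u c < 1 ->
  finite_set [set v : algC -> R | place (scar E) v /\ forall q, v (ratr q) = u q].
Proof.
move=> nfE c01; apply: contrapT => infA.
have [m [nu [z emb]]] := number_field_embeddings nfE.
have hb := embeddings_basis emb.
have [B BA szB] := infinite_set_fset m.+1 infA.
pose v (i : 'I_(size (enum_fset B))) := nth (fun=> 0) (enum_fset B) i.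
have vA i : place (scar E) (v i) /\ forall q, v i (ratr q) = u q.
  by apply: BA; rewrite /= mem_nth.
have : (size (enum_fset B) <= m)%N.
  apply: (@places_le_degree R E _ v c) hb.
  - by move=> i; case: (vA i).
  - by move=> i j /eqP; rewrite nth_uniq ?fset_uniq // => /eqP/val_inj.
  - by move=> i j q; rewrite (vA i).2 (vA j).2.
  - by move=> i; rewrite (vA i).2.
by move=> /(leq_trans szB); rewrite ltnn.
Qed.

(** * The places above a prime, and coefficients of products of linear factors *)

Lemma padic_abs_self (R : realType) p : prime p -> padic_abs R p p%:R = p%:R^-1.
Proof.
move=> pr_p; have nz : (p%:R : rat) != 0 by rewrite pnatr_eq0 -lt0n prime_gt0.
have e : (p%:R : rat) = (p%:Z)%:~R by [].
rewrite /padic_abs (negPf nz) e numq_int denq_int.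
by rewrite logn1 expr0 div1r logn_prime // eqxx expr1.
Qed.

Lemma padic_abs_int (R : realType) p (n : int) : n != 0 ->
  padic_abs R p n%:~R = (p%:R ^+ logn p `|n|)^-1.
Proof.
move=> nz; rewrite /padic_abs intr_eq0 (negPf nz) numq_int denq_int.
by rewrite logn1 expr0 div1r.
Qed.

Lemma padic_abs_int_le1 (R : realType) p (n : int) : prime p -> padic_abs R p n%:~R <= 1.
Proof.
move=> pr_p; have [->|nz] := eqVneq n 0; first by rewrite /padic_abs eqxx.
by rewrite padic_abs_int // invf_le1 ?exprn_gt0 ?exprn_ege1 ?ltr0n ?ler1n ?prime_gt0.
Qed.

Section PadicPlace.
Variables (R : realType) (E : sfield) (v : algC -> R) (p : nat).
Hypotheses (pv : place (scar E) v) (pr_p : prime p)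
  (vQ : forall q : rat, v (ratr q) = padic_abs R p q).

Lemma padic_place_int_le1 (n : int) : v n%:~R <= 1.
Proof. by rewrite -(ratr_int algC) vQ padic_abs_int_le1. Qed.

(* The powers of [b] have integral coordinates on [1, b, ..., b^(n-1)], so they stay bounded. *)
Lemma padic_place_Aint_le1 b : b \in in_sf E -> b \in Aint -> v b <= 1.
Proof.
move=> Eb Ab; have /floorpP[f Df] : minCpoly b \is a polyOver Num.int by [].
have mon_f : lead_coef f = 1.
  apply: (@intr_inj algC); rewrite -lead_coef_map_inj //; last exact: intr_inj.
  by rewrite -Df (monicP (minCpoly_monic b)).
have fb : (pZtoC f).[b] = 0 by rewrite -Df; apply/rootP/root_minCpoly.
have sz_f : (1 < size f)%N.
  by rewrite -(size_map_inj_poly (@intr_inj algC)) ?rmorph0 // -Df size_minCpoly.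
pose n := (size f).-1.
have Dn : size f = n.+1 by rewrite /n prednK // ltnW.
have pow N : exists2 q : {poly int}, (size q <= n)%N & (pZtoC q).[b] = b ^+ N.
  elim: N => [|N [q sz_q Dq]].
    exists 1; last by rewrite rmorph1 hornerC expr0.
    by rewrite size_poly1 -ltnS -Dn.
  exists (q * 'X - q`_n.-1 *: f); last first.
    by rewrite rmorphB rmorphM /= map_polyX map_polyZ /= !hornerE fb mulr0 subr0 Dq exprSr.
  apply/leq_sizeP => j le_nj; rewrite coefB coefZ coefMX.
  have n_gt0 : (0 < n)%N by rewrite -ltnS -Dn.
  have -> : (j == 0)%N = false by rewrite gtn_eqF // (leq_trans n_gt0).
  move: le_nj; rewrite leq_eqVlt => /orP[/eqP<-|lt_nj].
    by move: mon_f; rewrite lead_coefE => ->; rewrite mulr1 subrr.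
  rewrite (nth_default _ (_ : size f <= j)%N) ?Dn // mulr0 subr0 nth_default //.
  by apply: leq_trans sz_q _; rewrite -ltnS (ltn_predK lt_nj).
have bound N : v b ^+ N <= \sum_(i < n) v b ^+ i.
  have [q sz_q Dq] := pow N; rewrite -(placeX pv) // -Dq (@horner_coef_wide _ n); last first.
    by rewrite (leq_trans (size_poly _ _)).
  apply: le_trans (place_sum pv _ _ _) _.
    by move=> i; rewrite coef_map /= rpredM ?rpred_int ?rpredX.
  apply: ler_sum => i _; rewrite coef_map (placeM pv) ?rpred_int ?rpredX // (placeX pv) //.
  by rewrite ler_piMl ?exprn_ge0 ?(place_ge0 pv) // padic_place_int_le1.
rewrite leNgt; apply/negP => gt1.
have [N HN] := eventually_exp_gt (\sum_(i < n) v b ^+ i) gt1.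
by have := HN N (leqnn N); rewrite ltNge bound.
Qed.

(** [lead_coef g * a] is integral, so a pole of [a] must be cancelled by the leading coefficient.
    This confines the places with [v a > 1] to finitely many primes. *)
Lemma padic_place_gt1 (g : {poly int}) a : a \in in_sf E ->
  pZtoC g = (lead_coef g)%:~R *: minCpoly a -> lead_coef g != 0 -> 1 < v a ->
  (p %| `|lead_coef g|)%N.
Proof.
move=> Ea Dg nz_g; apply: contraTT => ndvd; rewrite -leNgt.
have Ab : (lead_coef g)%:~R * a \in Aint.
  have -> : (lead_coef g)%:~R = lead_coef (pZtoC g).
    by rewrite Dg lead_coefZ (monicP (minCpoly_monic a)) mulr1.
  apply: Aint_lead_coefM_root; first by apply/polyOverP=> i; rewrite coef_map Aint_int.
  by rewrite Dg rootZ ?root_minCpoly // intr_eq0.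
have := padic_place_Aint_le1 _ Ab; rewrite rpredM ?rpred_int // => /(_ isT).
rewrite (placeM pv) ?rpred_int // -(ratr_int algC) vQ padic_abs_int //.
by rewrite lognE (negPf ndvd) !andbF expr0 invr1 mul1r.
Qed.

End PadicPlace.

Lemma ultrametric_coef_prod (R : realType) (w : algC -> R) (rs : seq algC) i :
  is_absval w -> (forall x y, w (x + y) <= Num.max (w x) (w y)) ->
  w (\prod_(y <- rs) ('X - y%:P))`_i <= \prod_(y <- rs) Num.max 1 (w y).
Proof.
move=> abs_w ult; elim: rs i => [|y rs IH] i.
  by rewrite !big_nil coef1; case: eqP => _; rewrite ?(absval1 abs_w) ?(absval0 abs_w).
rewrite !big_cons mulrBl coefB coefXM coefCM.
have B_ge0 : 0 <= \prod_(j <- rs) Num.max 1 (w j).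
  by rewrite prodr_ge0 // => j _; apply: ltW; exact: max1_gt0.
apply: le_trans (ult _ _) _; rewrite ge_max (absvalN abs_w) (absvalM abs_w); apply/andP; split.
  case: eqP => _; first by rewrite (absval0 abs_w) mulr_ge0 // ltW // max1_gt0.
  by rewrite -[X in X <= _]mul1r ler_pM ?(absval_ge0 abs_w) ?le1_max1.
by rewrite ler_pM ?(absval_ge0 abs_w) // le_max lexx orbT.
Qed.

Lemma archimedean_coef_prod (R : realType) (w : algC -> R) (rs : seq algC) i :
  is_absval w ->
  w (\prod_(y <- rs) ('X - y%:P))`_i <= 2 ^+ size rs * \prod_(y <- rs) Num.max 1 (w y).
Proof.
move=> abs_w; elim: rs i => [|y rs IH] i.
  by rewrite !big_nil coef1 expr0 mul1r; case: eqP => _; rewrite ?(absval1 abs_w) ?(absval0 abs_w).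
rewrite !big_cons mulrBl coefB coefXM coefCM.
set B := \prod_(j <- rs) Num.max 1 (w j) in IH *.
have B_ge0 : 0 <= B by rewrite prodr_ge0 // => j _; apply: ltW; exact: max1_gt0.
have B2_ge0 : 0 <= 2 ^+ size rs * B by rewrite mulr_ge0 // exprn_ge0.
apply: le_trans (absvalD abs_w _ _) _; rewrite (absvalN abs_w) (absvalM abs_w).
rewrite /= exprS.
have -> : 2 * 2 ^+ size rs * (Num.max 1 (w y) * B) =
   Num.max 1 (w y) * (2 ^+ size rs * B) + Num.max 1 (w y) * (2 ^+ size rs * B) by ring.
apply: lerD.
  case: eqP => _; first by rewrite (absval0 abs_w) mulr_ge0 // ltW // max1_gt0.
  by rewrite -[X in X <= _]mul1r ler_pM ?(absval_ge0 abs_w) ?le1_max1.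
by rewrite ler_pM ?(absval_ge0 abs_w) // le_max lexx orbT.
Qed.

(* The Gauss norm of the monic minimal polynomial is [p ^ v_p(lead_coef g)]. *)
Lemma padic_mahler (R : realType) (w : algC -> R) (p : nat) (a : algC) (g : {poly int}) rs :
  is_absval w -> (forall x y, w (x + y) <= Num.max (w x) (w y)) -> prime p ->
  (forall q : rat, w (ratr q) = padic_abs R p q) ->
  zcontents g = 1 -> pZtoC g = (lead_coef g)%:~R *: minCpoly a ->
  minCpoly a = \prod_(y <- rs) ('X - y%:P) ->
  p%:R ^+ logn p `|lead_coef g| <= \prod_(y <- rs) Num.max 1 (w y).
Proof.
move=> abs_w ult pr_p wQ cg Dg Drs.
have nz_lg : lead_coef g != 0 by rewrite lead_coef_eq0 -zcontents_eq0 cg.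
have w_int (n : int) : w n%:~R = padic_abs R p n%:~R by rewrite -wQ ratr_int.
(* A primitive [g] has a coefficient prime to [p]; the same coefficient of [minCpoly a] has absolute
   value [p ^ v_p(lead_coef g)]. *)
have [j ndvd] : exists j, ~~ (p%:Z %| g`_j)%Z.
  apply: contrapT => no; have : (p%:Z %| zcontents g)%Z.
    rewrite dvdz_contents; apply/polyOverP => j; apply: contraT => h.
    by case: no; exists j.
  by rewrite cg dvdz1 absz_nat => /eqP p1; move: pr_p; rewrite p1.
have nz_gj : g`_j != 0 by apply: contraNneq ndvd => ->; rewrite dvdz0.
have := congr1 (fun q : {poly algC} => w q`_j) Dg.
rewrite coef_map coefZ (absvalM abs_w) /= !w_int !padic_abs_int //.
rewrite (_ : logn p `|g`_j| = 0%N); last by rewrite lognE -[(p %| _)%N]/(p%:Z %| g`_j)%Z (negPf ndvd) !andbF.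
have pos : 0 < (p%:R : R) ^+ logn p `|lead_coef g| by rewrite exprn_gt0 // ltr0n prime_gt0.
rewrite expr0 invr1 => /(congr1 (fun x => p%:R ^+ logn p `|lead_coef g| * x)).
rewrite mulr1 mulrA divff ?gt_eqF // mul1r Drs => ->.
exact: ultrametric_coef_prod.
Qed.

(** * Mahler measure and height *)

Lemma adjoin_rat_adj a : adjoin_rat a = scar (adj Qsf a).
Proof.
apply/seteqP; split=> x.
  apply; split; first exact: scarP.
  by move=> _ ->; apply/sfP/adj_gen.
move=> /sfP Ex A [hA sub]; have [E DE] := sfieldP hA.
move: sub; rewrite -DE => sub; apply/sfP.
apply: (@adj_min Qsf a E) Ex => [y|]; last by apply/sfP; apply: sub.
by rewrite in_Qsf; exact: rat_in_sf.
Qed.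

(** Omitting factors at least 1 decreases a product. Finiteness of the support keeps the big
    operator off its default value. *)
Lemma fsbig_ge1_ge_seq (R : realType) (T : choiceType) (A : set T) (F : T -> R) (s : seq T) :
  (forall i, A i -> 1 <= F i) -> finite_set [set i | A i /\ F i != 1] ->
  uniq s -> (forall i, i \in s -> A i) ->
  \prod_(i <- s) F i <= \big[*%R/1]_(i \in A) F i.
Proof.
move=> F1 finA us sA.
have fin' : finite_set (A `&` F @^-1` [set~ 1]).
  by apply: sub_finite_set finA => i [Ai /eqP Fi].
have sup := in_finite_support fin'; set t := finite_support _ _ _ in sup *.
have ut : uniq t by exact: finite_support_uniq.
rewrite (bigID (fun i => F i != 1)) /= [X in _ * X]big1 ?mulr1; last first.
  by move=> i; rewrite negbK => /eqP.
rewrite -big_filter [X in _ <= X](bigID (mem s)) /= -[X in X <= _]mulr1.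
have -> : \prod_(i <- t | i \in s) F i = \prod_(i <- [seq i <- s | F i != 1]) F i.
  rewrite -big_filter; apply: perm_big; apply: uniq_perm; rewrite ?filter_uniq // => i.
  rewrite !mem_filter andbC; case si: (i \in s); rewrite ?andbF ?andbT //.
  rewrite sup; apply/idP/idP => [/set_mem[_ /= /eqP]//|ne].
  by apply/mem_set; split; [exact: sA | exact/eqP].
apply: ler_pM => //.
- rewrite big_seq prodr_ge0 // => i; rewrite mem_filter => /andP[_ si].
  by apply: le_trans (F1 _ (sA _ si)).
- rewrite big_seq_cond; apply: (big_ind (fun x => 1 <= x)) => // [x y|i /andP[ti _]]; first exact: mulr_ege1.
  by apply: F1; move: ti; rewrite sup => /set_mem[].
Qed.

Section Height.
Variables (R : realType) (a : algC) (g : {poly int}) (rs : seq algC).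
Hypotheses (cg : zcontents g = 1) (g_gt0 : 0 < lead_coef g)
  (Dg : pZtoC g = (lead_coef g)%:~R *: minCpoly a)
  (Drs : minCpoly a = \prod_(y <- rs) ('X - y%:P)) (urs : uniq rs).

Let E := adj Qsf a.
Let d := size rs.

Let sz_min : size (minCpoly a) = d.+1.
Proof. by rewrite Drs size_prod_XsubC. Qed.

Let d_gt0 : (0 < d)%N.
Proof. by have := size_minCpoly a; rewrite sz_min. Qed.

Let basisE : sf_basis Qsf E (\row_(j < d) a ^+ j).
Proof. exact: power_basis_size (minpoly_Q a) sz_min. Qed.

Let nfE : number_field (scar E).
Proof.
split; first exact: scarP; split.
  by move=> x Qx; apply/sfP/adj_sub; rewrite in_Qsf.
exists d, (\row_(j < d) a ^+ j); apply: (proj2 (@field_basisP Qsf E _ _ _)) basisE.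
exact: adj_sub.
Qed.

Definition height_factor (v : algC -> R) : R :=
  Num.max 1 (v a) `^ ((local_degree (scar E) v)%:R / d%:R).

Let factor_ge1 v : 1 <= height_factor v.
Proof.
rewrite /height_factor -[X in X <= _](powRr0 (Num.max 1 (v a))).
by rewrite ler_powR ?le1_max1 // divr_ge0.
Qed.

Let factorX v : height_factor v ^+ d = Num.max 1 (v a) ^+ local_degree (scar E) v.
Proof.
rewrite /height_factor -powR_mulrn ?powR_ge0 // -powRrM divfK ?pnatr_eq0 -?lt0n //.
by rewrite powR_mulrn // ltW // max1_gt0.
Qed.

Let nu_ex : exists nu : 'I_d -> {rmorphism algC -> algC}, forall k, nu k a = rs`_k.
Proof.
have /choice[nu Dnu] : forall k : 'I_d, exists nu : {rmorphism algC -> algC}, nu a = rs`_k.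
  by move=> k; apply: minCpoly_conj_aut; rewrite Drs root_prod_XsubC mem_nth.
by exists nu.
Qed.

(** The absolute value [w \o nu] on [E], set to 0 elsewhere as [place] demands. *)
Definition restrict_place (w : algC -> R) (nu : {rmorphism algC -> algC}) : algC -> R :=
  fun x => if x \in in_sf E then w (nu x) else 0.

Lemma restrict_place_rat w nu (q : rat) : restrict_place w nu (ratr q) = w (ratr q).
Proof. by rewrite /restrict_place ratr_in_sf fmorph_rat. Qed.

Lemma place_restrict w nu : is_absval w ->
  ((forall q : rat, w (ratr q) = `|ratr q|) \/
   (exists2 p : nat, prime p & forall q : rat, w (ratr q) = padic_abs R p q)) ->
  place (scar E) (restrict_place w nu).
Proof.
move=> abs_w wQ; rewrite /restrict_place; split.
- split=> x /sfP Ex; rewrite Ex; first exact: absval_ge0.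
  split=> [/eqP|->]; last by rewrite rmorph0 (absval0 abs_w).
  by rewrite (absval_eq0 abs_w) fmorph_eq0 => /eqP.
- move=> x y /sfP Ex /sfP Ey; rewrite Ex Ey rpredM //= rmorphM; exact: absvalM.
- move=> x y /sfP Ex /sfP Ey; rewrite Ex Ey rpredD //= rmorphD; exact: absvalD.
- case: wQ => [wQ|[p pr_p wQ]]; [left|right; exists p => //] => q;
    by rewrite ratr_in_sf fmorph_rat.
- by move=> x nEx; case: ifP => // /sfP.
Qed.

(* The place [v] lies under the embeddings [nu] with [w \o nu = v], and there are at most
   [local_degree v] of them. *)
Lemma places_under_absval (w : algC -> R) : is_absval w ->
  ((forall q : rat, w (ratr q) = `|ratr q|) \/
   (exists2 p : nat, prime p & forall q : rat, w (ratr q) = padic_abs R p q)) ->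
  exists s : seq (algC -> R), [/\ uniq s,
    forall v, v \in s -> place (scar E) v /\ forall q : rat, v (ratr q) = w (ratr q) &
    \prod_(y <- rs) Num.max 1 (w y) <= \prod_(v <- s) height_factor v ^+ d].
Proof.
move=> abs_w wQ; have [nu Dnu] := nu_ex.
pose l := [seq restrict_place w (nu k) | k <- enum 'I_d].
have plE k x : x \in in_sf E -> restrict_place w (nu k) x = w (nu k x).
  by rewrite /restrict_place => ->.
exists (undup l); split; first exact: undup_uniq.
  move=> v; rewrite mem_undup => /mapP[k _ ->]; split; first exact: place_restrict.
  by move=> q; exact: restrict_place_rat.
have -> : \prod_(y <- rs) Num.max 1 (w y) = \prod_(v <- l) Num.max 1 (v a).
  rewrite (big_nth 0) big_mkord /l big_map big_enum /=; apply: eq_bigr => k _.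
  by rewrite plE ?adj_gen // Dnu.
(* Grouping the embeddings by the place they induce: the multiplicity of [v] is compared with its
   local degree. *)
rewrite -(prodr_undup_exp_count _ xpredT) big_seq [X in _ <= X]big_seq.
apply: ler_prod => v; rewrite mem_undup => l_v.
rewrite exprn_ge0 /= ?factorX; last exact: ltW (max1_gt0 _).
apply: ler_weXn2l; first exact: le1_max1.
pose B := [set k | restrict_place w (nu k) == v]%SET.
have -> : count_mem v l = #|B|.
  rewrite /l -sum1_count big_map -sum1_card [LHS]big_enum_cond /=.
  by apply: eq_bigl => k; rewrite finset.in_set.
have pv : place (scar E) v by case/mapP: l_v => k _ ->; exact: place_restrict.
apply: (@local_degree_ge R E v pv w #|B| (fun i => nu (enum_val i)) a nfE abs_w).
- exact: adj_gen.
- move=> i j; rewrite !Dnu => /eqP; rewrite nth_uniq // => /eqP/val_inj.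
  exact: enum_val_inj.
- move=> i x Ex; have := enum_valP i; rewrite finset.in_set => /eqP <-.
  by rewrite plE.
Qed.

(** The archimedean places account for the roots, and the places above each prime dividing the
    leading coefficient for its [p]-part. *)
Lemma mahler_le_places (w : algC -> R) : is_absval w ->
  (forall q : rat, w (ratr q) = `|ratr q|) ->
  exists s : seq (algC -> R), [/\ uniq s, forall v, v \in s -> place (scar E) v &
    `|lead_coef g|%:~R * \prod_(y <- rs) Num.max 1 (w y) <= \prod_(v <- s) height_factor v ^+ d].
Proof.
move=> abs_w wQ.
have F_ge0 v : 0 <= height_factor v ^+ d by rewrite exprn_ge0 // (le_trans _ (factor_ge1 v)).
have M_ge0 (t : algC -> R) : 0 <= \prod_(y <- rs) Num.max 1 (t y).
  by rewrite prodr_ge0 // => i _; rewrite ltW // max1_gt0.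
have H (ps : seq nat) : uniq ps -> all prime ps ->
  exists s : seq (algC -> R), [/\ uniq s,
    forall v, v \in s -> place (scar E) v /\ ((forall q : rat, v (ratr q) = `|ratr q|) \/
      exists2 p, p \in ps & forall q : rat, v (ratr q) = padic_abs R p q) &
    \prod_(p <- ps) p%:R ^+ logn p `|lead_coef g| * \prod_(y <- rs) Num.max 1 (w y) <=
      \prod_(v <- s) height_factor v ^+ d].
  elim: ps => [_ _|p ps IH /= /andP[nps ups] /andP[pr_p pr_ps]].
    have [s [us sP le_s]] := places_under_absval abs_w (or_introl wQ).
    exists s; split=> //; last by rewrite big_nil mul1r.
    by move=> v /sP[pv vQ]; split=> //; left=> q; rewrite vQ.
  have [s [us sP le_s]] := IH ups pr_ps.
  have [w' [abs_w' ult w'Q]] := padic_absval R pr_p.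
  have [s' [us' s'P le_s']] := places_under_absval abs_w' (or_intror (ex_intro2 _ _ p pr_p w'Q)).
  exists (s' ++ s); split.
  (* The new places satisfy [v p < 1], while those collected so far, archimedean or above other
     primes, satisfy [v p >= 1]. *)
  - rewrite cat_uniq us us' andbT /=; apply/hasPn => v sv; apply/negP => s'v.
    have [_ vQ'] := s'P v s'v; have [_ vQ] := sP v sv.
    have vp : v (ratr p%:R) = p%:R^-1 by rewrite vQ' w'Q padic_abs_self.
    have p_lt1 : (p%:R : R)^-1 < 1 by rewrite invf_lt1 ?ltr0n ?ltr1n ?prime_gt1 ?prime_gt0.
    have : 1 <= v (ratr p%:R).
      case: vQ => [->|[p' ps_p' ->]].
        by rewrite ratr_nat normr_nat ler1n prime_gt0.
      have pr_p' : prime p' by exact: (allP pr_ps).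
      have nz : (p%:Z != 0) by rewrite -lt0n prime_gt0.
      rewrite -[p%:R]/((p%:Z)%:~R) padic_abs_int // absz_nat logn_prime //.
      case: eqP => [e|_]; last by rewrite expr0 invr1.
      by move: nps; rewrite -e ps_p'.
    by rewrite vp leNgt p_lt1.
  - move=> v; rewrite mem_cat => /orP[/s'P[pv vQ]|/sP[pv vQ]]; split=> //.
      by right; exists p; rewrite ?mem_head // => q; rewrite vQ.
    case: vQ => [?|[p' ? ?]]; [by left | right; exists p' => //].
    by rewrite inE orbC; apply/orP; left.
  - rewrite big_cat big_cons -mulrA ler_pM //.
    + by rewrite mulr_ge0 // prodr_ge0 // => i _; rewrite exprn_ge0.
    + apply: le_trans le_s'; exact: padic_mahler w'Q cg Dg Drs.
have [|s [us sP le_s]] := H (primes `|lead_coef g|) (primes_uniq _) _.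
  by apply/allP => p; rewrite mem_primes => /andP[].
exists s; split=> // [v /sP[]//|].
suff -> : `|lead_coef g|%:~R = \prod_(p <- primes `|lead_coef g|) p%:R ^+ logn p `|lead_coef g| :> R by [].
have lg_gt0 : (0 < `|lead_coef g|)%N by rewrite absz_gt0 gt_eqF.
rewrite -abszE -[LHS]/(`|lead_coef g|%:R) {1}(prod_prime_decomp lg_gt0) prime_decompE big_map /=.
by rewrite natr_prod; apply: eq_bigr => p _; rewrite natrX.
Qed.

Lemma finite_places_gt1 : finite_set [set v : algC -> R | place (scar E) v /\ 1 < v a].
Proof.
pose PA (u : rat -> R) := [set v : algC -> R | place (scar E) v /\ forall q, v (ratr q) = u q].
have finp p : prime p -> finite_set (PA (padic_abs R p)).
  move=> pr_p; apply: (@finite_places_over R E _ p%:R nfE).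
  rewrite padic_abs_self // invr_gt0 ltr0n prime_gt0 //=.
  by rewrite invf_lt1 ?ltr0n ?ltr1n ?prime_gt1 ?prime_gt0.
have fino : finite_set (PA (fun q => `|ratr q|)).
  apply: (@finite_places_over R E _ (2%:R)^-1 nfE).
  rewrite fmorphV rmorph_nat ger0_norm ?invr_ge0 // invr_gt0 ltr0n /=.
  by rewrite invf_lt1 ?ltr0n ?ltr1n.
apply: (@sub_finite_set _ _ (PA (fun q => `|ratr q|) `|`
  \bigcup_(p in [set` primes `|lead_coef g|]) PA (padic_abs R p))).
  move=> v [pv gt1]; have [_ _ _ [vQ|[p pr_p vQ]] _] := pv; first by left.
  right; exists p => //=; rewrite mem_primes pr_p absz_gt0 gt_eqF //=.
  by apply: (padic_place_gt1 pv pr_p vQ (adj_gen _ _) Dg) gt1; rewrite gt_eqF.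
rewrite finite_setU; split=> //; apply: bigcup_finite; first exact: finite_seq.
by move=> p /=; rewrite mem_primes => /andP[pr_p _]; exact: finp.
Qed.

Lemma mahler_le_height (w : algC -> R) : is_absval w ->
  (forall q : rat, w (ratr q) = `|ratr q|) ->
  `|lead_coef g|%:~R * \prod_(y <- rs) Num.max 1 (w y) <= weil_height R a ^+ size rs.
Proof.
move=> abs_w wQ; have [s [us sP le_s]] := mahler_le_places abs_w wQ.
apply: le_trans le_s _; rewrite prodrXl.
have le_h : \prod_(v <- s) height_factor v <= weil_height R a.
  rewrite /weil_height /height_over adjoin_rat_adj (ext_degreeE basisE).
  apply: fsbig_ge1_ge_seq => //.
  - apply: sub_finite_set finite_places_gt1 => v [pv ne1]; split=> //.
    rewrite ltNge; apply: contra ne1 => le1.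
    by rewrite /height_factor (max_l le1) powR1.
apply: lerXn2r => //; rewrite nnegrE.
  by rewrite prodr_ge0 // => v _; apply: le_trans (factor_ge1 v).
by apply: le_trans le_h; rewrite prodr_ge0 // => v _; apply: le_trans (factor_ge1 v).
Qed.

End Height.

(** * The Northcott property *)

Lemma finite_bounded_intpoly_roots (m B : nat) :
  finite_set [set a : algC | exists g : {poly int},
    [/\ g != 0, (size g <= m.+1)%N, forall j, (absz (g`_j)%R <= B)%N & root (pZtoC g) a]].
Proof.
(* Coefficients in the interval from [-B] to [B] are shifted by [B] to become ordinals below
   [2 B + 1]. *)
pose Phi (f : {ffun 'I_m.+1 -> 'I_(B.*2.+1)}) : {poly int} :=
  \poly_(i < m.+1) ((f (inord i))%:Z - B%:Z).
pose A (f : {ffun 'I_m.+1 -> 'I_(B.*2.+1)}) := [set a : algC | Phi f != 0 /\ root (pZtoC (Phi f)) a].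
apply: (@sub_finite_set _ _ (\bigcup_(f in [set: {ffun 'I_m.+1 -> 'I_(B.*2.+1)}]) A f)).
  move=> a [g [nz_g sz_g leB ga]].
  exists [ffun i : 'I_m.+1 => inord (absz (g`_i + B%:Z))] => //.
  suff e : Phi [ffun i : 'I_m.+1 => inord (absz (g`_i + B%:Z))] = g by rewrite /A /= e.
  apply/polyP=> i; rewrite coef_poly; case: ltnP => [lt_im|le_mi]; last first.
    by rewrite nth_default // (leq_trans sz_g).
  have le_iB := leB i; rewrite ffunE (inordK lt_im).
  rewrite inordK; last by rewrite ltnS -addnn; move: le_iB; lia.
  by move: le_iB; lia.
apply: bigcup_finite => [|f _]; first exact: finite_finset.
have [nz|z0] := eqVneq (Phi f) 0; first by apply: sub_finite_set (finite_set0 _) => a []; rewrite nz eqxx.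
have [rs Drs] := closed_field_poly_normal (pZtoC (Phi f)).
apply: sub_finite_set (finite_seq rs) => a [_] /=.
rewrite Drs rootZ ?root_prod_XsubC // lead_coef_eq0 map_poly_eq0_id0 ?intr_eq0 //.
by rewrite lead_coef_eq0.
Qed.

Lemma weil_height_ge0 (R : realType) (a : algC) : 0 <= weil_height R a.
Proof. by rewrite /weil_height /height_over prodr_ge0 // => v _; exact: powR_ge0. Qed.

Section HeightBounds.
Variables (R : realType) (w : algC -> R).
Hypotheses (abs_w : is_absval w) (wQ : forall q : rat, w (ratr q) = `|ratr q|).

Let w_int (n : int) : w n%:~R = `|n|%:~R.
Proof. by rewrite -(ratr_int algC) wQ ratr_int intr_norm. Qed.

Lemma gamma_le_height (K : sfield) (a : algC) (X : R) : 1 <= X -> weil_height R a <= X ->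
  (gamma R (scar K) (scar (adj K a)) <= (4 * X ^+ 2)%:E)%E.
Proof.
move=> X1 hX; apply: ge_ereal_sup => _ [F0 [nfF sKF] <-].
have [F DF] := sfieldP nfF.1; rewrite -DF in nfF sKF *.
have {}sKF : {subset in_sf K <= in_sf F} by move=> x /sfP Kx; apply/sfP/sKF.
rewrite (compositum_adj a sKF) lee_fin.
have [m [nu [z emb]]] := number_field_embeddings nfF.
have [f min_f] := rel_minpoly F a.
have [d [r [fE inj_r]]] := minpoly_roots min_f.
have hb := embeddings_basis emb; have hc := minpoly_power_basis min_f fE.
have [e he] := tower_basis hb hc.
rewrite (ext_degreeE hc) (ext_degreeE (F := Qsf) he).
have [g [cg g_gt0 Dg]] := primitive_intpoly a.
have [rs urs Drs] := minCpoly_prod_uniq a.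
have d_gt0 := minpoly_degree_gt0 min_f fE.
have m_gt0 : (0 < m)%N by have := size_minCpoly z; rewrite (embeddings_size emb).
have h_ge0 := weil_height_ge0 R a.
have leX : `|lead_coef g|%:~R * \prod_(y <- rs) Num.max 1 (w y) <= X ^+ size rs.
  apply: le_trans (mahler_le_height cg g_gt0 Dg Drs urs abs_w wQ) _.
  by apply: lerXn2r; rewrite ?nnegrE // (le_trans h_ge0).
have bound := rel_disc_norm_bound emb min_f fE inj_r abs_w w_int cg Dg Drs leX X1.
have c_ge0 : 0 <= 4 * X ^+ 2 by rewrite mulr_ge0 // sqr_ge0.
have n_gt0 : (m * d * d)%:R != 0 :> R by rewrite pnatr_eq0 -lt0n !muln_gt0 m_gt0 d_gt0.
(* The exponent of [gamma] is the product of the degrees [m * d] and [d], so the root extracted is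
   exactly the one that undoes the bound. *)
have -> : 4 * X ^+ 2 = ((4 * X ^+ 2) ^+ (m * d * d)) `^ (m * d * d)%:R^-1.
  by rewrite -(powR_mulrn _ c_ge0) -powRrM mulfV // powRr1.
by apply: ge0_ler_powR; rewrite ?nnegrE ?invr_ge0 ?exprn_ge0.
Qed.

Lemma northcott_number_field (M : sfield) (X : R) : number_field (scar M) -> 1 <= X ->
  finite_set [set a | scar M a /\ weil_height R a <= X].
Proof.
move=> nfM X1; have [m [nu [z emb]]] := number_field_embeddings nfM.
(* A coefficient of [g] is at most [2^(deg a) M(g)], with [M(g) <= X^(deg a)] and [deg a <= m]. *)
pose B := Num.bound ((2 * X) ^+ m).
apply: sub_finite_set (finite_bounded_intpoly_roots m B) => a [/sfP Ma hX].
have [g [cg g_gt0 Dg]] := primitive_intpoly a.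
have [rs urs Drs] := minCpoly_prod_uniq a.
have sz_rs : (size rs <= m)%N.
  have -> : m = size [seq nu k a | k <- enum 'I_m] by rewrite size_map size_enum_ord.
  apply: uniq_leq_size => // y rs_y.
  have [|mu <-] := @minCpoly_conj_aut a y; first by rewrite Drs root_prod_XsubC.
  have [_ _ Dz _] := emb.
  have : root (minCpoly z) (mu z) by rewrite -(minCpoly_aut mu) root_minCpoly.
  rewrite Dz /root horner_prod prodf_seq_eq0 => /hasP[k _].
  rewrite hornerXsubC subr_eq0 => /eqP muz.
  by apply/mapP; exists k; rewrite ?mem_enum // (aut_ext_eq emb muz).
have nz_g : g != 0 by rewrite -zcontents_eq0 cg.
have sz_g : size g = (size rs).+1.
  rewrite -(size_map_inj_poly (@intr_inj algC)) ?rmorph0 // Dg size_scale ?intr_eq0 ?gt_eqF //.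
  by rewrite Drs size_prod_XsubC.
have X2 : 1 <= 2 * X by lra.
exists g; split=> // [|j|].
- by rewrite sz_g.
- have h_ge0 := weil_height_ge0 R a.
  have le1 : (`|g`_j|)%:~R <= (2 * X) ^+ m.
    apply: (@le_trans _ _ ((2 * X) ^+ size rs)); last exact: ler_weXn2l.
    have -> : `|g`_j|%:~R = w ((lead_coef g)%:~R * (minCpoly a)`_j).
      by rewrite -w_int -coefZ -Dg coef_map.
    rewrite (absvalM abs_w) w_int Drs exprMn.
    apply: (@le_trans _ _ (`|lead_coef g|%:~R * (2 ^+ size rs * \prod_(y <- rs) Num.max 1 (w y)))).
      by rewrite ler_wpM2l ?ler0z //; exact: archimedean_coef_prod.
    rewrite mulrCA ler_wpM2l ?exprn_ge0 //.
    apply: le_trans (mahler_le_height cg g_gt0 Dg Drs urs abs_w wQ) _.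
    by apply: lerXn2r; rewrite ?nnegrE // (le_trans h_ge0).
  rewrite -(ler_nat R) -[(absz (g`_j))%:R]/((Posz (absz (g`_j)))%:~R) abszE.
  by apply: le_trans le1 _; apply/ltW/archi_boundP; rewrite exprn_ge0 // (le_trans _ X2).
- by rewrite Dg rootZ ?root_minCpoly // intr_eq0 gt_eqF.
Qed.

End HeightBounds.

Theorem theorem1p8 (R : realType) (K L : set algC)
  (hK : number_field K)
  (hL : subfield L)
  (hKL : K `<=` L)
  (hinf : ~ finite_extension K L)
  (hgamma : forall X : R,
     finite_set [set M : set algC |
       [/\ number_field M, K `<=` M, M `<=` L & (gamma R K M <= X%:E)%E]]) :
  northcott R L.
Proof.
move=> X X1; have [w [abs_w wQ]] := archimedean_absval R.
have [K' DK] := sfieldP hK.1; have [L' DL] := sfieldP hL.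
rewrite -DK -DL in hK hKL hgamma *.
have sKL : {subset in_sf K' <= in_sf L'} by move=> x /sfP Kx; apply/sfP/hKL.
pose A := [set M : set algC | [/\ number_field M, scar K' `<=` M, M `<=` scar L' &
  (gamma R (scar K') M <= (4 * X ^+ 2)%:E)%E]].
apply: (@sub_finite_set _ _ (\bigcup_(M in A) [set a | M a /\ weil_height R a <= X])).
  move=> a [/sfP La hX]; exists (scar (adj K' a)); last by split=> //; apply/sfP/adj_gen.
  split.
  - exact: number_field_adj.
  - by move=> x /sfP Kx; apply/sfP/adj_sub.
  - by move=> x /sfP Mx; apply/sfP; apply: adj_min Mx.
  - exact: gamma_le_height abs_w wQ _ _ _ X1 hX.
apply: bigcup_finite; first exact: hgamma.
move=> M [nfM _ _ _]; have [M' DM] := sfieldP nfM.1; rewrite -DM in nfM *.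
exact: northcott_number_field abs_w wQ _ _ nfM X1.
Qed.
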